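(* Let $\lambda>\lambda_0$ and let $u_{\lambda_0}$ be a Lipschitz viscosity solution of $a u''+H(x,u')=\lambda_0$ in $\mathbb R$. (a) There exists a unique viscosity solution $u^+_\lambda$ of $a u''+H(x,u')=\lambda$ in $\mathbb R$ with $(u^+_\lambda)'>u'_{\lambda_0}$ a.e. on $\mathbb R$ and $u^+_\lambda(0)=0$. It is of class $C^1$ on $\mathbb R$, of class $C^2$ on $A$, satisfies $(u^+_\lambda)'(x)=p^+_\lambda(x)$ for all $x\in\{a=0\}$ (in particular it is a classical pointwise solution), and does not depend on the choice of $u_{\lambda_0}$. (b) There exists a unique viscosity solution $u^-_\lambda$ of the same equation with $(u^-_\lambda)'<u'_{\lambda_0}$ a.e. on $\mathbb R$ and $u^-_\lambda(0)=0$. It is $C^1$ on $\mathbb R$, $C^2$ on $A$, satisfies $(u^-_\lambda)'=p^-_\lambda$ on $\{a=0\}$, and does not depend on the choice of $u_{\lambda_0}$.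
   Context: Deterministic setting: $a:\mathbb R\to[0,1]$ with $\sqrt a$ $\kappa$-Lipschitz and (A1$'$): $a\not\equiv0$ and every connected component of $A:=\{a>0\}$ is a bounded interval. $H:\mathbb R\times\mathbb R\to\mathbb R$ in $\mathscr H_{sqc}(\alpha_0,\alpha_1,\gamma,\eta)$, $\gamma>2$, $\eta>0$: (H1) $\alpha_0|p|^\gamma-1/\alpha_0\le H(x,p)\le\alpha_1(|p|^\gamma+1)$, (H2) $|H(x,p)-H(x,q)|\le\alpha_1(|p|+|q|+1)^{\gamma-1}|p-q|$, (H3) $|H(x,p)-H(y,p)|\le\alpha_1(|p|^\gamma+1)|x-y|$, $H(x,\cdot)$ strictly quasiconvex with unique minimizer $\hat p(x)$, $H(x,p_1)-H(x,p_2)\ge\eta|p_1-p_2|$ for $p_1<p_2\le\hat p(x)$, $H(x,p_2)-H(x,p_1)\ge\eta|p_1-p_2|$ for $p_2>p_1\ge\hat p(x)$. $\hat\lambda(x):=\min_pH(x,p)$; for $\lambda\ge\hat\lambda(x)$, $\{p:H(x,p)\le\lambda\}=[p^-_\lambda(x),p^+_\lambda(x)]$. Viscosity conventions: supersolution if $a\varphi''+H(x,\varphi')\le\lambda$ for $C^2$ $\varphi$ touching from below; subsolution if $\ge\lambda$ from above. $\lambda_0:=\inf\{\lambda:\ a u''+H(x,u')=\lambda$ admits a continuous viscosity supersolution on $\mathbb R\}$. *)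

(* Defs.v *)
From mathcomp Require Import all_boot all_order all_algebra.
From mathcomp Require Import all_classical all_reals all_analysis.
Set Implicit Arguments. Unset Strict Implicit. Unset Printing Implicit Defensive.
Import Order.TTheory GRing.Theory Num.Theory.
Import numFieldTopology.Exports numFieldNormedType.Exports.
Local Open Scope classical_set_scope.
Local Open Scope ring_scope.

Section Defs.
Variable R : realType.

Definition lipschitz_with (L : R) (f : R -> R) :=
  forall x y, `|f x - f y| <= L * `|x - y|.

Definition is_lipschitz (f : R -> R) := exists L : R, lipschitz_with L f.

Definition diffusion_ok (kappa : R) (a : R -> R) :=
  [/\ forall x, 0 <= a x <= 1,
      lipschitz_with kappa (fun x => Num.sqrt (a x)),
      exists x, a x != 0 &
      forall x, 0 < a x ->
        exists M : R, forall y : R,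
          @connected_component R [set z | 0 < a z] x y -> `|y| <= M].

Definition H_sqc (alpha0 alpha1 gamma eta : R) (H : R -> R -> R) :=
  [/\ forall x p, alpha0 * (`|p| `^ gamma) - alpha0^-1 <= H x p
                  /\ H x p <= alpha1 * (`|p| `^ gamma + 1),
      forall x p q, `|H x p - H x q| <= alpha1 * ((`|p| + `|q| + 1) `^ (gamma - 1)) * `|p - q|,
      forall x y p, `|H x p - H y p| <= alpha1 * (`|p| `^ gamma + 1) * `|x - y|,
      forall x p q t, p != q -> 0 < t < 1 ->
         H x (t * p + (1 - t) * q) < Num.max (H x p) (H x q) &
      exists phat : R -> R, forall x,
        [/\ forall p, p != phat x -> H x (phat x) < H x p,
            forall p1 p2, p1 < p2 -> p2 <= phat x -> H x p1 - H x p2 >= eta * `|p1 - p2| &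
            forall p1 p2, p2 > p1 -> p1 >= phat x -> H x p2 - H x p1 >= eta * `|p1 - p2|]].

Definition C2 (phi : R -> R) :=
  [/\ forall x, derivable phi x 1,
      forall x, derivable (derive1 phi) x 1 &
      continuous (derive1 (derive1 phi))].

Definition visc_super (a : R -> R) (H : R -> R -> R) (lam : R) (u : R -> R) :=
  continuous u /\
  forall (phi : R -> R) (x0 : R), C2 phi -> phi x0 = u x0 ->
    (exists2 e : R, 0 < e & forall y, `|y - x0| < e -> phi y <= u y) ->
    a x0 * derive1 (derive1 phi) x0 + H x0 ((derive1 phi) x0) <= lam.

Definition visc_sub (a : R -> R) (H : R -> R -> R) (lam : R) (u : R -> R) :=
  continuous u /\
  forall (phi : R -> R) (x0 : R), C2 phi -> phi x0 = u x0 ->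
    (exists2 e : R, 0 < e & forall y, `|y - x0| < e -> u y <= phi y) ->
    a x0 * derive1 (derive1 phi) x0 + H x0 ((derive1 phi) x0) >= lam.

Definition visc_sol a H lam u := visc_super a H lam u /\ visc_sub a H lam u.

Definition lambda0_set a H : set R := [set lam | exists u, visc_super a H lam u].

Definition is_lambda0 a H (lam0 : R) :=
  (lam0%:E = ereal_inf [set l%:E | l in lambda0_set a H])%E.

Definition is_pplus (H : R -> R -> R) (lam x p : R) :=
  H x p <= lam /\ forall q, H x q <= lam -> q <= p.

Definition is_pminus (H : R -> R -> R) (lam x p : R) :=
  H x p <= lam /\ forall q, H x q <= lam -> p <= q.

Definition ae_deriv_gt (v w : R -> R) :=
  {ae (@lebesgue_measure R), forall x,
     derivable v x 1 /\ derivable w x 1 /\ (derive1 w) x < (derive1 v) x}.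

Definition regular_classical (a : R -> R) (H : R -> R -> R) (lam : R) (u : R -> R) :=
  [/\ forall x, derivable u x 1,
      continuous (derive1 u),
      forall x, 0 < a x -> derivable (derive1 u) x 1 /\ {for x, continuous (derive1 (derive1 u))},
      forall x, a x = 0 -> H x ((derive1 u) x) = lam &
      forall x, 0 < a x -> a x * derive1 (derive1 u) x + H x ((derive1 u) x) = lam].

End Defs.

(* Main.v *)
(* On a component (l, r) of {a > 0} a solution is C^2 and its slope q solves the scalar ODE
   a q' + H(x, q) = lam.  Since sqrt a is Lipschitz, a vanishes quadratically at the ends and
   the integral of 1/a diverges there, so a bounded slope is forced towards the roots
   p^-_lam, p^+_lam of H(x, .) = lam.  The branch p^+ is attracting to the right and repelling
   to the left.  Hence the infimum of the solutions started at a large value P at points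
   tending to l is the only slope that leaves l along p^+, and it stays above the slope of
   u_{lam0}, which satisfies the same equation at a lower level; as the latter tends to a root
   at level lam0, the new slope cannot fall to p^-_lam, so it reaches r along p^+.  This gives a
   continuous slope on the line, equal to p^+_lam on {a = 0}, and u^+_lam is its primitive.

   For uniqueness, let v be a viscosity solution with v - u_{lam0} nondecreasing.  At a point
   where a = 0 the diffusion is negligible at small scales: comparing v with parabolas on short
   chords through that point shows that all secant slopes converge to p^+_lam, since v - u_{lam0}
   nondecreasing excludes p^-_lam.  So v is differentiable there with derivative p^+_lam, and on
   each component the ODE determines the remaining slopes.

   Part (b) is part (a) for a(-x), H(-x, -p), u(-x). *)
Require Import Defs.
From mathcomp Require Import all_boot all_order all_algebra.
From mathcomp Require Import all_classical all_reals all_analysis.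
From mathcomp Require Import ring lra.
Set Implicit Arguments. Unset Strict Implicit. Unset Printing Implicit Defensive.
Import Order.TTheory GRing.Theory Num.Theory.
Import numFieldTopology.Exports numFieldNormedType.Exports.
Local Open Scope classical_set_scope.
Local Open Scope ring_scope.

(** * Real functions *)

Section Basics.
Variable R : realType.
Implicit Types (f g : R -> R) (x y z : R).

(** Components of {a > 0} may accumulate at a zero of [a], where every bound that involves a lower
    bound of [a] is lost. Near zeros the slope is therefore controlled by the sign of the drift (lam
    - H) / a and by the upper bound on [a], while Gronwall estimates serve only on compact parts of
    a component. Interior regularity comes from bounded slopes: they bound second differences on
    both sides, so v is C^{1,1}; then v minus a second primitive of the now known right-hand side
    has arbitrarily small second differences, hence is affine. The almost everywhere inequality
    enters uniqueness only through monotonicity of v - u_{lam0}, obtained by covering the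
    exceptional null set by an open set of small measure. For existence that inequality has to be
    proved although u_{lam0} may fail to be differentiable at zeros of [a], which may have positive
    measure: there the only failure is a convex corner with a strict gap, and such corners are
    countable. *)

Lemma continuous_forP f x :
  {for x, continuous f} <->
  forall e : R, 0 < e -> exists2 d : R, 0 < d & forall y, `|y - x| < d -> `|f y - f x| < e.
Proof.
split=> [cf e e0|h].
  have /cvgrPdist_lt/(_ e e0) := cf.
  move/nbhs_ballP => [d /= d0 hd]; exists d => // y xy.
  by have := hd y; rewrite /ball /= distrC [`|f x - _|]distrC; apply.
apply/cvgrPdist_lt => e e0; have [d d0 hd] := h e e0.
apply/nbhs_ballP; exists d => //= y; rewrite /ball /= distrC => xy.
by rewrite distrC; apply: hd.
Qed.

Lemma continuous_pointwise f : (forall x : R, {for x, continuous f}) -> continuous f.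
Proof. by []. Qed.

Lemma max_dist_le (x z s : R) : `|Num.max z s - Num.max x s| <= `|z - x|.
Proof.
have : - `|z - x| <= z - x <= `|z - x| by rewrite -ler_norml.
rewrite ler_norml; case: (ltP z s); case: (ltP x s); lra.
Qed.

Lemma min_dist_le (x z s : R) : `|Num.min z s - Num.min x s| <= `|z - x|.
Proof.
have : - `|z - x| <= z - x <= `|z - x| by rewrite -ler_norml.
rewrite ler_norml; case: (ltP z s); case: (ltP x s); lra.
Qed.

Lemma is_deriveP f x (df : R) :
  is_derive x 1 f df <->
  forall e : R, 0 < e -> exists2 d : R, 0 < d &
    forall y, `|y - x| < d -> `|f y - f x - df * (y - x)| <= e * `|y - x|.
Proof.
rewrite is_derive1_caratheodory; split.
  move=> [g [hg /continuous_forP cg gx]] e e0.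
  have [d d0 hd] := cg _ e0; exists d => // y /hd.
  by rewrite hg gx -mulrBl normrM => /ltW h; rewrite ler_wpM2r.
move=> h; exists (fun z => if z == x then df else (f z - f x) / (z - x)); split.
- move=> z; case: eqVneq => [->|zx]; first by rewrite !subrr mulr0.
  by rewrite divfK // subr_eq0.
- apply/continuous_forP => e e0; rewrite eqxx.
  have e20 : 0 < e / 2 by rewrite divr_gt0.
  have [d d0 hd] := h _ e20; exists d => // y /hd.
  case: eqVneq => [_ _|yx]; first by rewrite subrr normr0.
  have n0 : 0 < `|y - x| by rewrite normr_gt0 subr_eq0.
  have yx0 : y - x != 0 by rewrite subr_eq0.
  rewrite -{1}[f y - f x](divfK yx0) -mulrBl normrM ler_pM2r // => /le_lt_trans; apply.
  lra.
- by rewrite eqxx.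
Qed.

Lemma continuous_within_itv f (a b : R) :
  (forall x, a <= x <= b -> {for x, continuous f}) -> {within `[a, b], continuous f}.
Proof.
move=> cf; apply: continuous_in_subspaceT => x; rewrite inE /= in_itv /= => xab.
exact: cf.
Qed.

Lemma is_derive_continuous f x (df : R) : is_derive x 1 f df -> {for x, continuous f}.
Proof. by move=> [df1 _]; apply/differentiable_continuous; rewrite -derivable1_diffP. Qed.

Lemma EVT_min_itv f (a b : R) : a <= b ->
  (forall x, a <= x <= b -> {for x, continuous f}) ->
  exists2 c, a <= c <= b & forall t, a <= t <= b -> f c <= f t.
Proof.
move=> ab /continuous_within_itv cf; have [c cab hc] := EVT_min ab cf.
exists c; first by move: cab; rewrite in_itv.
by move=> t tab; apply: hc; rewrite in_itv.
Qed.

Lemma MVT_itv f (df : R -> R) (a b : R) : a < b ->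
  (forall x, a <= x <= b -> is_derive x 1 f (df x)) ->
  exists2 c, a < c < b & f b - f a = df c * (b - a).
Proof.
move=> ab h; have [|||c + E] := @MVT R f df a b.
- exact: ab.
- by move=> x; rewrite in_itv /= => /andP[ax xb]; apply: h; rewrite !ltW.
- by apply: continuous_within_itv => x /h /is_derive_continuous.
by rewrite in_itv /= => cab; exists c.
Qed.

Lemma derive_le f g (df dg : R -> R) (a b : R) : a <= b ->
  (forall x, a <= x <= b -> is_derive x 1 f (df x)) ->
  (forall x, a <= x <= b -> is_derive x 1 g (dg x)) ->
  (forall x, a < x < b -> df x <= dg x) -> f b - f a <= g b - g a.
Proof.
rewrite le_eqVlt => /predU1P[->|ab] hf hg hle; first by rewrite !subrr.
have [|c cab E] := @MVT_itv (g \- f) (fun x => dg x - df x) _ _ ab.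
  by move=> x xab; have := hf x xab; have := hg x xab => ? ?; apply: is_deriveB.
rewrite -subr_ge0; have -> : g b - g a - (f b - f a) = (g \- f) b - (g \- f) a.
  by rewrite /=; ring.
by rewrite E mulr_ge0 // subr_ge0 ?hle // ltW.
Qed.

Lemma derive_abs_le f g (df dg : R -> R) (a b : R) : a <= b ->
  (forall x, a <= x <= b -> is_derive x 1 f (df x)) ->
  (forall x, a <= x <= b -> is_derive x 1 g (dg x)) ->
  (forall x, a < x < b -> `|df x| <= dg x) -> `|f b - f a| <= g b - g a.
Proof.
move=> ab hf hg hle; rewrite ler_norml; apply/andP; split; last first.
  by apply: derive_le => // x xab; apply: le_trans (hle x xab); rewrite ler_norm.
have hf' x : a <= x <= b -> is_derive x 1 (\- f) (- df x).
  by move=> xab; have := hf x xab => ?; apply: is_deriveN.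
rewrite lerNl; apply: le_trans (derive_le ab hf' hg _); first by rewrite /= opprB opprK addrC.
by move=> x xab; apply: le_trans (hle x xab); rewrite -normrN ler_norm.
Qed.

Lemma last_nonneg f (s t : R) : s <= t ->
  (forall x, s <= x <= t -> {for x, continuous f}) -> 0 <= f s -> f t < 0 ->
  exists z, [/\ s <= z < t, f z = 0 & forall x, z < x <= t -> f x < 0].
Proof.
move=> st cf fs ft.
pose S := [set w | s <= w <= t /\ 0 <= f w].
have S0 : has_sup S.
  split; first by exists s; split => //; rewrite lexx.
  by exists t => w [] /andP[].
pose z := sup S.
have sz : s <= z by apply: ub_le_sup; [exact: S0.2|split => //; rewrite lexx].
have zt : z <= t by apply: ge_sup => [|w [] /andP[]//]; exact: S0.1.
have hneg x : z < x <= t -> f x < 0.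
  move=> /andP[zx xt]; rewrite ltNge; apply/negP => fx.
  suff : x <= z by rewrite leNgt zx.
  by apply: ub_le_sup; [exact: S0.2|split => //; rewrite xt (le_trans sz) ?ltW].
have /continuous_forP cz := cf z (ltac:(by rewrite sz zt)).
have fz0 : 0 <= f z.
  rewrite leNgt; apply/negP => fz; have [|d d0 hd] := cz (- f z); first by rewrite oppr_gt0.
  have [w [sw fw] zw] := sup_adherent d0 S0.
  have wz : w <= z by apply: (ub_le_sup S0.2); split.
  have /hd : `|w - z| < d by move: zw; rewrite -/z ltr_norml; lra.
  by rewrite ltr_norml; lra.
have ztt : z < t by rewrite lt_neqAle zt andbT; apply/eqP => E; move: ft; rewrite -E ltNge fz0.
exists z; split => //; first by rewrite sz.
apply/eqP; rewrite eq_le fz0 andbT leNgt; apply/negP => fz; have [d d0 hd] := cz _ fz.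
pose x := Num.min (z + d / 2) t.
have /hneg fx : z < x <= t by rewrite /x lt_min ge_min lexx orbT ztt !andbT; lra.
have xz : z < x by rewrite /x lt_min ztt andbT; lra.
have xd : x <= z + d / 2 by rewrite /x ge_min lexx.
have /hd : `|x - z| < d by rewrite ltr_norml; lra.
by rewrite ltr_norml; lra.
Qed.

Lemma is_derive_mull (c x : R) : is_derive x 1 ( *%R c) c.
Proof. by apply: is_derive_eq; rewrite -[RHS]mulr1. Qed.

Lemma is_derive_scale (c x : R) f (df : R) :
  is_derive x 1 f df -> is_derive x 1 (fun y => c * f y) (c * df).
Proof. by move=> h; have := is_deriveZ c h. Qed.

Lemma is_derive_add x f g (df dg : R) : is_derive x 1 f df -> is_derive x 1 g dg ->
  is_derive x 1 (fun y => f y + g y) (df + dg).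
Proof. by move=> h1 h2; have := is_deriveD h1 h2. Qed.

Lemma is_derive_sub x f g (df dg : R) : is_derive x 1 f df -> is_derive x 1 g dg ->
  is_derive x 1 (fun y => f y - g y) (df - dg).
Proof. by move=> h1 h2; have := is_deriveB h1 h2. Qed.

Lemma is_derive_opp x f (df : R) : is_derive x 1 f df ->
  is_derive x 1 (fun y => - f y) (- df).
Proof. by move=> h; have := is_deriveN h. Qed.

Lemma is_derive_const (c x : R) : is_derive x 1 (fun=> c) 0.
Proof. exact: is_derive_cst. Qed.

Lemma is_derive_expR_affine (K x : R) : is_derive x 1 (fun t => expR (K * t)) (K * expR (K * x)).
Proof.
have h := is_derive_mull K x.
have := is_derive_expR (K * x) => h2.
have h3 := @is_derive1_comp R expR ( *%R K) x (expR (K * x)) K h2 h.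
by apply: is_derive_eq h3 _; rewrite /GRing.scale /= mulrC.
Qed.

(** Past its last zero before [t], [f] times exp(-K x) is nondecreasing, so [f] cannot become
    negative. Asking for the inequality only where [f] <= 0 makes one lemma serve both Gronwall
    comparison and, with [K] = 0, trapping by the sign of a drift. *)
Lemma barrier f (df : R -> R) (K s t : R) : s <= t ->
  (forall x, s <= x <= t -> is_derive x 1 f (df x)) -> 0 <= f s ->
  (forall x, s <= x <= t -> f x <= 0 -> K * f x <= df x) -> 0 <= f t.
Proof.
move=> st hf fs hdf; rewrite leNgt; apply/negP => ft.
have [z [/andP[sz zt] fz hneg]] :
    exists z, [/\ s <= z < t, f z = 0 & forall x, z < x <= t -> f x < 0].
  by apply: last_nonneg => // x /hf /is_derive_continuous.
have zst x : z <= x <= t -> s <= x <= t by move=> /andP[zx ->]; rewrite (le_trans sz).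
have hg x : z <= x <= t ->
    is_derive x 1 (f * (fun t => expR (- K * t))) ((df x - K * f x) * expR (- K * x)).
  move=> /zst/hf hx; have := is_derive_expR_affine (- K) x => he.
  by apply: is_derive_eq; rewrite /GRing.scale /=; ring.
have [c /andP[zc ct]] := MVT_itv zt hg.
rewrite -[LHS]/(f t * expR (- K * t) - f z * expR (- K * z)) fz mul0r subr0 => E.
have : 0 <= f t * expR (- K * t).
  rewrite E !mulr_ge0 ?expR_ge0 ?subr_ge0 ?(ltW zt) //.
  by apply: hdf; [rewrite zst // !ltW|rewrite ltW // hneg // zc ltW].
by rewrite leNgt pmulr_llt0 ?expR_gt0 // ft.
Qed.

End Basics.

(** * Primitives and scalar ODEs *)

Section Primitives.
Variable R : realType.
Implicit Types (f g : R -> R) (x y z : R).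

(** Vanishing on the left half-line makes the integral from -1 equal to 0 at every negative point,
    also beyond -1 where the interval is empty; one formula then serves the whole line. *)
Lemma primitive_half f : continuous f -> (forall x, x <= 0 -> f x = 0) ->
  exists F : R -> R, forall x, is_derive x 1 F (f x).
Proof.
move=> cf f0; pose mu := @lebesgue_measure R.
pose F x : R := (\int[mu]_(t in `[(-1), x]) f t)%R.
exists F => x; have [x1|x1] := ltP (-1) x.
  have [||dF EF] := @continuous_FTC1_closed R f (-1) x (x + 1) _ _ x1 (cf x).
  - by lra.
  - apply: continuous_compact_integrable; first exact: segment_compact.
    by apply: continuous_within_itv => t _; exact: cf.
  by apply: DeriveDef; [exact: dF|rewrite -derive1E].
have F0 (t : R) : t < 0 -> F t = 0.
  move=> t0; rewrite /F; rewrite /Rintegral integral0_eq // => w /=; rewrite in_itv /= => /andP[_ wt].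
  by rewrite f0 //; lra.
apply/is_deriveP => e e0; exists 1 => // y; rewrite ltr_norml => yx.
have [x0 y0] : x < 0 /\ y < 0 by split; lra.
by rewrite !F0 // (f0 _ (ltW x0)) mul0r !subrr normr0 mulr_ge0 // ltW.
Qed.

Lemma primitive_exists f : continuous f ->
  exists F : R -> R, F 0 = 0 /\ forall x, is_derive x 1 F (f x).
Proof.
move=> cf.
have cmax g : continuous g -> continuous (fun x => g (Num.max x 0) - g 0).
  move=> cg x; apply: cvgB; last exact: cvg_cst.
  apply: (@continuous_comp _ _ _ (fun x => Num.max x 0) g); last exact: cg.
  by apply: continuous_max; [exact: cvg_id|exact: cvg_cst].
have cN : continuous (fun x => f (- x)).
  by move=> x; apply: (@continuous_comp _ _ _ (fun x => - x) f); [exact: oppr_continuous|exact: cf].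
have [F1 dF1] : exists F : R -> R, forall x, is_derive x 1 F (f (Num.max x 0) - f 0).
  by apply: primitive_half; [exact: cmax|move=> x x0; rewrite max_r // subrr].
have [F2 dF2] : exists F : R -> R, forall x, is_derive x 1 F (f (- (Num.max x 0)) - f (- 0)).
  apply: primitive_half; first exact: (cmax (fun x => f (- x))).
  by move=> x x0; rewrite max_r // subrr.
have dF2N x : is_derive x 1 (fun x => - F2 (- x)) (f (- Num.max (- x) 0) - f 0).
  have /is_deriveP h := dF2 (- x); apply/is_deriveP => e e0.
  have [d d0 hd] := h e e0; exists d => // y yx.
  have E : - y - - x = - (y - x) by ring.
  have := hd (- y); rewrite E !normrN => /(_ yx); rewrite oppr0 in hd *.
  by rewrite -[X in X <= _ -> _]normrN; congr (`|_| <= _); ring.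
(* [f] is [f 0] plus its excess on the right plus its excess on the left; each excess, the second
   one after a reflection, vanishes on the left half-line. *)
pose F x := F1 x + - F2 (- x) + f 0 * x.
exists (fun x => F x - F 0); split=> [|x]; first by rewrite subrr.
have h1 := dF1 x; have h2 := dF2N x.
have h3 := is_derive_mull (f 0) x.
have h4 : is_derive x 1 F (f (Num.max x 0) - f 0 + (f (- Num.max (- x) 0) - f 0) + f 0).
  by apply: is_deriveD.
have h5 : is_derive x 1 (cst (F 0)) 0 by exact: is_derive_cst.
have h6 := is_deriveB h4 h5.
apply: is_derive_eq h6 _; rewrite subr0.
have [x0|x0] := leP 0 x; first by rewrite max_r ?oppr0; lra.
by rewrite [Num.max (- x) 0]max_l; [rewrite opprK; lra|lra].
Qed.

(** The intervals of centre [u n] and radius 2 C / 2^n are nested; the limit is the supremum of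
    their left ends. *)
Lemma half_cauchy (u : nat -> R) (C : R) :
  (forall n, `|u n.+1 - u n| <= C * (1 / 2) ^+ n) ->
  exists l : R, forall n, `|u n - l| <= 2 * C * (1 / 2) ^+ n.
Proof.
move=> hu; pose h n : R := (1 / 2) ^+ n.
have hS n : h n.+1 = h n / 2 by rewrite /h exprS; lra.
have hn n : `|u n.+1 - u n| <= C * h n := hu n.
have lo n m : (n <= m)%N -> u n - 2 * C * h n <= u m - 2 * C * h m.
  move=> /subnK <-; elim: (m - n)%N => [|k IH]; first by rewrite add0n.
  apply: le_trans IH _; rewrite addSn hS; have := hn (k + n)%N; rewrite ler_norml; lra.
have hi n m : (n <= m)%N -> u m + 2 * C * h m <= u n + 2 * C * h n.
  move=> /subnK <-; elim: (m - n)%N => [|k IH]; first by rewrite add0n.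
  apply: le_trans IH; rewrite addSn hS; have := hn (k + n)%N; rewrite ler_norml; lra.
have Ch n : 0 <= C * h n by apply: le_trans (hn n).
have lohi n m : u n - 2 * C * h n <= u m + 2 * C * h m.
  have [/lo|/ltnW/hi] := leqP n m; [have := Ch m|have := Ch n]; lra.
pose S := range (fun n => u n - 2 * C * h n).
have S0 : has_sup S.
  split; first by exists (u 0%N - 2 * C * h 0%N), 0%N.
  by exists (u 0%N + 2 * C * h 0%N) => _ [n _ <-].
exists (sup S) => n; have h1 : u n - 2 * C * h n <= sup S by apply: (ub_le_sup S0.2); exists n.
have h2 : sup S <= u n + 2 * C * h n by apply: ge_sup S0.1 _ => _ [k _ <-].
by rewrite ler_norml -/(h n); lra.
Qed.

Lemma half_power_small (C e : R) : 0 < e -> exists n, C * (1 / 2) ^+ n < e.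
Proof.
move=> e0; have [C0|C0] := leP C 0; first by exists 0%N; rewrite expr0 mulr1; lra.
have [n hn] : exists n, C / e < n%:R :> R.
  by exists (Num.bound (C / e)); apply: archi_boundP; rewrite divr_ge0 ?ltW.
exists n; rewrite expr_div_n expr1n mulrA mulr1 ltr_pdivrMr ?exprn_gt0 //.
have : n%:R <= 2 ^+ n :> R by rewrite -natrX ler_nat ltnW // ltn_expl.
move: hn; rewrite ltr_pdivrMr // => h1 h2; apply: lt_le_trans h1 _.
by rewrite mulrC ler_pM2l.
Qed.

Lemma le_half_power (A C : R) : (forall n, A <= C * (1 / 2) ^+ n) -> A <= 0.
Proof.
move=> h; rewrite leNgt; apply/negP => A0; have [n hn] := half_power_small C A0.
by have := le_lt_trans (h n) hn; rewrite ltxx.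
Qed.

(** * Picard iteration on a half-line with an exponential weight *)

Section Picard.
Variables (F : R -> R -> R) (K B s y0 : R).
Hypotheses (K1 : 1 <= K) (cF : forall y, continuous (F ^~ y))
  (FK : forall x y z, `|F x y - F x z| <= K * `|y - z|) (FB : forall x y, `|F x y| <= B).

Let cFy (y : R -> R) : continuous y -> continuous (fun x => F x (y x)).
Proof.
move=> cy; apply: continuous_pointwise => x; apply/continuous_forP => e e0.
have K0 : 0 < K by move: K1; lra.
have /continuous_forP/(_ (e / 2)) [|d1 d10 h1] := @cF (y x) x; first by rewrite divr_gt0.
have /continuous_forP/(_ (e / 2 / K)) [|d2 d20 h2] := cy x; first by rewrite !divr_gt0.
exists (Num.min d1 d2) => [|z]; first by rewrite lt_min d10.
rewrite lt_min => /andP[/h1 z1 /h2 z2].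
have z3 : `|F z (y z) - F z (y x)| < e / 2.
  by apply: le_lt_trans (FK _ _ _) _; rewrite mulrC -ltr_pdivlMr.
have -> : F z (y z) - F x (y x) = (F z (y z) - F z (y x)) + (F z (y x) - F x (y x)) by ring.
by apply: le_lt_trans (ler_normD _ _) _; lra.
Qed.

Let prim (f : R -> R) : R -> R := get [set G | forall x, is_derive x 1 G (f x)].

Let primP f : continuous f -> forall x, is_derive x 1 (prim f) (f x).
Proof.
move=> /primitive_exists [G [_ hG]].
by have : [set G | forall x, is_derive x 1 G (f x)] (prim f) by exact: (getI hG).
Qed.

Let step (y : R -> R) : R -> R :=
  fun x => prim (fun t => F t (y t)) x + (y0 - prim (fun t => F t (y t)) s).

Let step_derive (y : R -> R) : continuous y -> forall x, is_derive x 1 (step y) (F x (y x)).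
Proof.
move=> cy x; have h1 := primP (cFy cy) x.
have h2 := is_derive_const (y0 - prim (fun t => F t (y t)) s) x.
by apply: is_derive_eq (is_derive_add h1 h2) _; rewrite addr0.
Qed.

Let step_s (y : R -> R) : step y s = y0. Proof. by rewrite /step addrC subrK. Qed.

Let u n := iter n step (cst y0).

Let u_cont n : continuous (u n).
Proof.
elim: n => [|n IH]; first by move=> x; exact: cst_continuous.
by move=> x; apply: is_derive_continuous (step_derive IH x).
Qed.

Let u_derive n x : is_derive x 1 (u n.+1) (F x (u n x)).
Proof. exact: (step_derive (@u_cont n) x). Qed.

Let u_s n : u n s = y0. Proof. by case: n => // n; rewrite /u /= step_s. Qed.

(** Since w' = 2 K w, integrating K w / 2^n gives at most w / 2^(n+1): each iteration halves the
    error, on the whole half-line at once. For the first iterate, B (x - s) <= w x because 2 K >=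
    1. *)
Let w (x : R) := B * expR (- (2 * K) * s) * expR (2 * K * x).

Let B0 : 0 <= B. Proof. by apply: le_trans (FB 0 0). Qed.

Let w_derive x : is_derive x 1 w (2 * K * w x).
Proof.
have h := is_derive_expR_affine (2 * K) x.
apply: is_derive_eq (is_derive_scale (B * expR (- (2 * K) * s)) h) _.
by rewrite /w; ring.
Qed.

Let wZ_derive (c x : R) : is_derive x 1 (fun x => c * w x) (c * (2 * K * w x)).
Proof. exact: is_derive_scale. Qed.

Let w_ge0 x : 0 <= w x. Proof. by rewrite /w !mulr_ge0 // expR_ge0. Qed.

Let u_step n x : s <= x -> `|u n.+1 x - u n x| <= w x * (1 / 2) ^+ n.
Proof.
elim: n x => [|n IH] x sx.
  rewrite expr0 mulr1 -[u 0%N x](u_s 1).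
  have : `|u 1 x - u 1 s| <= B * x - B * s.
    apply: (derive_abs_le (df := fun x => F x (u 0 x)) (dg := cst B) (g := *%R B)) => //.
    by move=> z _; exact: is_derive_mull.
  move=> /le_trans; apply; rewrite -mulrBr /w -mulrA -expRD ler_wpM2l //.
  have := expR_ge1Dx (2 * K * (x - s)).
  rewrite [_ + 2 * K * x](_ : _ = 2 * K * (x - s)); last by ring.
  apply: le_trans; have : 0 <= (2 * K - 1) * (x - s) by rewrite mulr_ge0 //; move: K1; lra.
  lra.
have dd z : is_derive z 1 (fun x => u n.+2 x - u n.+1 x) (F z (u n.+1 z) - F z (u n z)).
  by apply: is_derive_sub; exact: u_derive.
have := @derive_abs_le R (fun x => u n.+2 x - u n.+1 x) (fun x => (1 / 2) ^+ n.+1 * w x)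
  (fun z => F z (u n.+1 z) - F z (u n z)) (fun z => (1 / 2) ^+ n.+1 * (2 * K * w z)) s x sx.
move=> /(_ (fun z _ => dd z) (fun z _ => wZ_derive _ z)).
cbv beta; rewrite !u_s subrr subr0 => h.
apply: le_trans (h _) _.
  move=> z /andP[sz zx]; apply: le_trans (FK _ _ _) _; rewrite exprS.
  have := IH z (ltW sz); have K0 : 0 <= K by move: K1; lra.
  by move=> /(ler_wpM2l K0) /le_trans; apply; lra.
have : 0 <= (1 / 2) ^+ n.+1 * w s by rewrite mulr_ge0 ?exprn_ge0 //; lra.
by lra.
Qed.

Lemma picard : exists Y : R -> R, Y s = y0 /\
  forall x, s <= x -> is_derive x 1 Y (F x (Y x)).
Proof.
have /choice[y hy] : forall x, exists l, s <= x -> forall n, `|u n x - l| <= 2 * w x * (1 / 2) ^+ n.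
  move=> x; have [sx|sx] := leP s x; last by exists 0; lra.
  have [l hl] := @half_cauchy (fun n => u n x) (w x) (fun n => u_step n sx).
  by exists l.
have uB n x z : x <= z -> `|u n z - u n x| <= B * z - B * x.
  case: n => [|n] xz; first by rewrite subrr normr0 -mulrBr mulr_ge0 // subr_ge0.
  apply: (derive_abs_le (df := fun x => F x (u n x)) (dg := cst B) (g := *%R B)) => //.
  by move=> t _; exact: is_derive_mull.
have yB x z : s <= x -> x <= z -> `|y z - y x| <= B * z - B * x.
  move=> sx xz; have sz := le_trans sx xz.
  rewrite -subr_le0; apply: (@le_half_power _ (2 * w z + 2 * w x)) => n.
  have := hy x sx n; have := hy z sz n; have := uB n x z xz.
  have -> : y z - y x = (u n z - u n x) - (u n z - y z) + (u n x - y x) by ring.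
  have := ler_normD (u n z - u n x - (u n z - y z)) (u n x - y x).
  have := ler_normB (u n z - u n x) (u n z - y z); lra.
(* The limit is known only to the right of [s]; freezing it at [y s] on the left gives a continuous
   function on the line, to which [step] applies. This extra step makes it differentiable, and
   comparison with the iterates shows that nothing changes beyond [s]. *)
pose yt x := y (Num.max x s).
have smax x : s <= Num.max x s by rewrite le_max lexx orbT.
have cyt : continuous yt.
  apply: continuous_pointwise => x; apply/continuous_forP => e e0; exists (e / (B + 1)).
    by rewrite divr_gt0 // ltr_wpDl.
  move=> z zx.
  have {zx} zx : `|z - x| * (B + 1) < e by rewrite -ltr_pdivlMr // ltr_wpDl.
  have := max_dist_le x z s.
  have : `|yt z - yt x| <= B * `|Num.max z s - Num.max x s|.
    have [h|/ltW h] := leP (Num.max x s) (Num.max z s).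
      by rewrite [X in _ <= B * X]ger0_norm ?subr_ge0 // mulrBr; apply: yB.
    by rewrite distrC [X in _ <= B * X]distrC [X in _ <= B * X]ger0_norm ?subr_ge0 // mulrBr; apply: yB.
  move=> h1 h2; apply: le_lt_trans h1 _; have := ler_wpM2l B0 h2 => h3.
  by have := normr_ge0 (z - x); lra.
pose Y := step yt.
have dY x : is_derive x 1 Y (F x (yt x)) by exact: step_derive.
have Yy x : s <= x -> Y x = y x.
  move=> sx; apply/eqP; rewrite -subr_eq0 -normr_le0.
  apply: (@le_half_power _ (4 * w x)) => n.
  have dd z : is_derive z 1 (fun x => Y x - u n.+1 x) (F z (yt z) - F z (u n z)).
    by exact: is_derive_sub.
  have := @derive_abs_le R (fun x => Y x - u n.+1 x) (fun x => (1 / 2) ^+ n * w x)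
    (fun z => F z (yt z) - F z (u n z)) (fun z => (1 / 2) ^+ n * (2 * K * w z)) s x sx.
  move=> /(_ (fun z _ => dd z) (fun z _ => wZ_derive _ z)).
  cbv beta; rewrite u_s {2}/Y step_s subrr subr0 => h.
  have h1 : `|Y x - u n.+1 x| <= (1 / 2) ^+ n * w x.
    apply: le_trans (h _) _.
      move=> z /andP[sz zx]; apply: le_trans (FK _ _ _) _.
      rewrite /yt (max_l (ltW sz)); have := hy z (ltW sz) n; rewrite distrC; have K0 : 0 <= K by move: K1; lra.
      by move=> /(ler_wpM2l K0) /le_trans; apply; lra.
    have : 0 <= (1 / 2) ^+ n * w s by rewrite mulr_ge0 ?exprn_ge0 //; lra.
    lra.
  have := hy x sx n.+1; have := ler_normD (Y x - u n.+1 x) (u n.+1 x - y x).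
  rewrite [_ + (_ - _)]addrA subrK exprS => h2 h3.
  by have := mulr_ge0 (w_ge0 x) (exprn_ge0 n (ltac:(lra) : 0 <= 1 / 2 :> R)); lra.
exists Y; split; first exact: step_s.
by move=> x sx; have := dY x; rewrite /yt max_l // Yy.
Qed.

End Picard.

End Primitives.

(** * Lipschitz functions and null sets *)

Section AlmostEverywhere.
Variable R : realType.
Implicit Types (f g : R -> R) (x y z h : R).
Let mu := @lebesgue_measure R.

(** The supremum of the points whose value is at least [f al] must be [be]. Each point is compared
    only with its own neighbours, so different reasons may work at different points. *)
Lemma locally_nondecreasing f (al be : R) : al <= be ->
  (forall x, al <= x <= be -> exists2 d : R, 0 < d & forall y, al <= y <= be -> `|y - x| < d ->
     (x <= y -> f x <= f y) /\ (y <= x -> f y <= f x)) -> f al <= f be.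
Proof.
move=> ab h; pose S := [set y | al <= y <= be /\ f al <= f y].
have S0 : has_sup S.
  split; first by exists al; split; rewrite ?lexx.
  by exists be => y [] /andP[].
pose z := sup S.
have az : al <= z by apply: (ub_le_sup S0.2); split; rewrite ?lexx.
have zb : z <= be by apply: (ge_sup S0.1) => y [] /andP[].
have zab : al <= z <= be by rewrite az.
have [d d0 hd] := h z zab.
have [w [wab fw]] := sup_adherent d0 S0; rewrite -/z => zw.
have wz : w <= z by apply: (ub_le_sup S0.2); split.
have fz : f al <= f z.
  by apply: le_trans fw _; apply: (hd w wab _).2 => //; rewrite ltr_norml; lra.
have [<-//|zbe] := eqVneq z be.
have {}zbe : z < be by rewrite lt_neqAle zbe.
pose y := Num.min (z + d / 2) be.
have zy : z < y by rewrite /y lt_min zbe andbT; lra.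
have yb : y <= be by rewrite /y ge_min lexx orbT.
have yd : y <= z + d / 2 by rewrite /y ge_min lexx.
have yab : al <= y <= be by rewrite yb andbT; lra.
have fy : f al <= f y.
  by apply: le_trans fz _; apply: (hd y yab _).1; [rewrite ltr_norml; lra|exact: ltW].
suff : y <= z by rewrite leNgt zy.
by apply: (ub_le_sup S0.2); split.
Qed.

Lemma negligible_open_cover (N : set R) (e : R) : 0 < e -> mu.-negligible N ->
  exists U : set R, [/\ open U, N `<=` U & (mu U < e%:E)%E].
Proof.
move=> e0 [B [mB muB NB]].
have [|U [oU BU hU]] := @lebesgue_regularity_outer R B e mB _ e0.
  by rewrite [X in (X < _)%E]muB.
exists U; split => //; first exact: subset_trans NB BU.
have mU : measurable U by exact: measurable_realfun.open_measurable.
have -> : U = (U `\` B) `|` B by rewrite setUC setDUK.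
by rewrite /mu measureU0 //; exact: measurableD.
Qed.

(** [m] is the measure of the part of [U] in [al, x]: a penalty of total size at most [e] with slope
    1 on [U], which can pay for bad behaviour on a null set covered by [U]. *)
Lemma open_measure_profile (U : set R) (al e : R) : open U -> (mu U < e%:E)%E ->
  exists m : R -> R, [/\ forall x, 0 <= m x <= e, forall x y, x <= y -> m x <= m y &
    forall x y, al <= x -> x <= y -> `]x, y] `<=` U -> m y = m x + (y - x)].
Proof.
move=> oU Ue; have mU : measurable U by exact: measurable_realfun.open_measurable.
have mUI (i : interval R) : measurable (U `&` [set` i]) by exact: measurableI.
have fin (i : interval R) : (mu (U `&` [set` i]) < e%:E)%E.
  by apply: le_lt_trans Ue; apply: le_measure; rewrite ?inE;
    [exact: mUI|exact: mU|exact: subIsetl].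
have finn (i : interval R) : mu (U `&` [set` i]) \is a fin_num.
  by rewrite ge0_fin_numE //; apply: lt_trans (fin i) _; rewrite ltry.
exists (fun x => fine (mu (U `&` `[al, x]))); split.
- move=> x; rewrite fine_ge0 //=; rewrite -lee_fin fineK // ltW //; exact: fin.
- move=> x y xy; rewrite fine_le //; apply: le_measure; rewrite ?inE; [exact: mUI|exact: mUI|].
  by move=> z /= [Uz]; rewrite !in_itv /= => /andP[-> zx]; split => //; rewrite (le_trans zx).
- move=> x y ax xy xyU.
  have -> : U `&` `[al, y] = (U `&` `[al, x]) `|` `]x, y].
    apply/seteqP; split => z /=; rewrite !in_itv /=.
      move=> [Uz /andP[az zy]]; have [zx|xz] := leP z x.
        by left; split => //; rewrite az.
      by right.
    case=> [[Uz /andP[az zx]]|/andP[xz zy]].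
      by split => //; rewrite az (le_trans zx).
    by split; [apply: xyU; rewrite /= in_itv /= xz|rewrite zy (le_trans ax) // ltW].
  have mI : mu `]x, y] = (y - x)%:E.
    rewrite /mu lebesgue_measure_itv /= lte_fin.
    have [//|] := ltP x y; rewrite le_eqVlt ltNge xy orbF => /eqP ->.
    by rewrite subrr.
  have -> : (mu (U `&` `[al, x] `|` `]x, y]) = mu (U `&` `[al, x]) + (y - x)%:E)%E.
    rewrite -mI; apply: measureU; [exact: mUI|exact: measurable_itv|].
    apply/seteqP; split => z //= [[_]]; rewrite !in_itv /= => /andP[_ zx] /andP[xz _].
    by move: (lt_le_trans xz zx); rewrite ltxx.
  by rewrite fineD //; exact: finn.
Qed.

Lemma lipschitz_ae_derive_ge0 g (al be L : R) : al <= be -> 0 <= L ->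
  (forall x y, al <= x <= be -> al <= y <= be -> `|g x - g y| <= L * `|x - y|) ->
  {ae mu, forall x, exists2 d : R, is_derive x 1 g d & 0 <= d} -> g al <= g be.
Proof.
move=> ab L0 gL [N0 [mN0 muN0 hN0]].
pose N := ~` [set x : R | exists2 d : R, is_derive x 1 g d & 0 <= d].
have Nneg : mu.-negligible N by exists N0; split.
suff H (e : R) : 0 < e -> g al <= g be + (be - al + L) * e.
  rewrite -subr_ge0; apply/ler_addgt0Pl => e e0; pose e' := e / (be - al + L + 1).
  have k0 : 0 < be - al + L + 1 by lra.
  have e'0 : 0 < e' by rewrite divr_gt0.
  have := H _ e'0; have : e' * (be - al + L + 1) = e by rewrite divfK // gt_eqF.
  lra.
move=> e0; have [U [oU NU mU]] := negligible_open_cover e0 Nneg.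
have [m [m1 m2 m3]] := @open_measure_profile U al e oU mU.
(* On [U] the term [L * m] grows at rate [L] and compensates any decrease of [g]; off [U] the
   derivative of [g] is nonnegative and [e * x] absorbs the remainder. *)
have : g al + e * al + L * m al <= g be + e * be + L * m be.
  apply: (@locally_nondecreasing (fun x => g x + e * x + L * m x)) => // x xab.
  have [Ux|nUx] := pselect (U x).
    have /nbhs_ballP[d /= d0 hd] : nbhs x U by exact: open_nbhs_nbhs.
    exists d => // y yab yx; have key (a b : R) : al <= a <= be -> al <= b <= be -> a <= b ->
        `|a - x| < d -> `|b - x| < d -> g a + e * a + L * m a <= g b + e * b + L * m b.
      move=> aab bab le_ab ax bx.
      have -> : m b = m a + (b - a).
        apply: m3 => //; first by case/andP: aab.
        move=> z /=; rewrite in_itv /= => zab; apply: hd; rewrite /ball /= ltr_norml.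
        by move: ax bx; rewrite !ltr_norml; lra.
      have := gL _ _ aab bab; rewrite ler_norml [`|a - b|]distrC ger0_norm ?subr_ge0 //.
      by have := mulr_ge0 (ltW e0) (ltac:(rewrite subr_ge0//) : 0 <= b - a); lra.
    have xx : `|x - x| < d by rewrite subrr normr0.
    by split => xy; apply: key.
  have [d dg d0] : exists2 d : R, is_derive x 1 g d & 0 <= d.
    by apply: contrapT => H; apply: nUx; apply: NU.
  have /is_deriveP/(_ e e0)[r r0 hr] := dg; exists r => // y yab /hr.
  rewrite ler_norml => /andP[h1 h2]; split => xy.
    move: h1 h2; rewrite ger0_norm ?subr_ge0 // => h1 h2.
    have := ler_wpM2l L0 (m2 _ _ xy); have := mulr_ge0 d0 (ltac:(rewrite subr_ge0//) : 0 <= y - x).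
    lra.
  move: h1 h2; rewrite distrC ger0_norm ?subr_ge0 // => h1 h2.
  have := ler_wpM2l L0 (m2 _ _ xy); have := mulr_ge0 d0 (ltac:(rewrite subr_ge0//) : 0 <= x - y).
  lra.
have := m1 al; have := m1 be => /andP[_ h1] /andP[h2 _].
have := ler_wpM2l L0 h1; have := mulr_ge0 L0 h2; lra.
Qed.

Definition locally_lipschitz g := forall x : R, exists L d : R, 0 < d /\
  forall y z, `|y - x| < d -> `|z - x| < d -> `|g y - g z| <= L * `|y - z|.

Lemma ae_derive_ge0_nondecreasing g : locally_lipschitz g ->
  {ae mu, forall x, exists2 d : R, is_derive x 1 g d & 0 <= d} ->
  forall x y, x <= y -> g x <= g y.
Proof.
move=> gL hae x y xy; apply: locally_nondecreasing => // z _.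
have [L [d [d0 hL]]] := gL z; exists d => // w _ wz.
have key (a b : R) : a <= b -> `|a - z| < d -> `|b - z| < d -> g a <= g b.
  rewrite !ltr_norml => le_ab az bz; apply: (@lipschitz_ae_derive_ge0 g a b `|L|) => // s t sab tab.
  apply: (@le_trans _ _ (L * `|s - t|)); first by apply: hL; rewrite ltr_norml; lra.
  by rewrite ler_wpM2r // ler_norm.
have zz : `|z - z| < d by rewrite subrr normr0.
by split => h; apply: key.
Qed.

(** A convex corner with a strict gap; by [derive_or_kink] this is the only way in which a viscosity
    solution fails to be differentiable at a zero of [a]. *)
Definition kink (u : R -> R) (x : R) := exists c1 c2 d : R, [/\ c1 < c2, 0 < d &
  forall h, 0 < h < d -> u x - u (x - h) <= c1 * h /\ c2 * h <= u (x + h) - u x].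

(** A kink is labelled by a rational inside its gap, a radius 1 / (n+1) and the cell of that length
    containing it. Two kinks x < y with the same label are closer than the radius, so the increment
    of [u] from x to y would be both above and below the rational times y - x. *)
Lemma countable_kinks (u : R -> R) : countable (kink u).
Proof.
pose E (i : rat * nat * int) : set R := [set x |
  Num.floor (x * i.1.2.+1%:R) = i.2 /\ forall h, 0 < h < i.1.2.+1%:R^-1 ->
  u x - u (x - h) < ratr i.1.1 * h /\ ratr i.1.1 * h < u (x + h) - u x].
apply: (@sub_countable _ _ _ (\bigcup_(i in [set: rat * nat * int]) E i)).
  apply: subset_card_le => x [c1 [c2 [d [c12 d0 hd]]]].
  have [q] := rat_in_itvoo c12; rewrite in_itv /= => /andP[q1 q2].
  pose n := Num.bound d^-1.
  have hn : n.+1%:R^-1 < d.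
    rewrite invf_plt ?posrE //; apply: lt_trans (archi_boundP _) _; first by rewrite invr_ge0 ltW.
    by rewrite ltr_nat.
  exists (q, n, Num.floor (x * n.+1%:R)) => //; split => // h /andP[h0 h1] /=.
  have [hh1 hh2] := hd h (ltac:(rewrite h0 (lt_trans h1 hn)//)).
  by split; [apply: le_lt_trans hh1 _|apply: lt_le_trans hh2]; rewrite ltr_pM2r.
apply: bigcup_countable => // i _.
have Esub x y : E i x -> E i y -> x < y -> False.
  move=> [fx hx] [fy hy] xy.
  have k0 : 0 < i.1.2.+1%:R :> R by [].
  have hlt : 0 < y - x < i.1.2.+1%:R^-1.
    rewrite subr_gt0 xy /= -[X in _ < X]mul1r ltr_pdivlMr // mulrBl.
    have := floor_itv (x * i.1.2.+1%:R); have := floor_itv (y * i.1.2.+1%:R).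
    by rewrite fx fy intrD; lra.
  have [_] := hx _ hlt; have [+ _] := hy _ hlt.
  by rewrite subKr [x + _]addrC subrK => h1 /(lt_trans h1); rewrite ltxx.
have [[x Ex]|nE] := pselect (exists x, E i x).
  apply: (@sub_countable _ _ _ [set x]); last exact: countable1.
  apply: subset_card_le => y Ey /=; have [yx|xy|//] := ltgtP y x.
    by case: (Esub _ _ Ey Ex yx).
  by case: (Esub _ _ Ex Ey xy).
apply: (@sub_countable _ _ _ set0); last exact: countable0.
by apply: subset_card_le => y Ey; case: nE; exists y.
Qed.

End AlmostEverywhere.

(** * Test functions *)

Section Viscosity.
Variable R : realType.
Implicit Types (a u v w phi : R -> R) (G H : R -> R -> R) (x y z p q h : R).

Lemma derive1_fun (f df : R -> R) : (forall x, is_derive x 1 f (df x)) -> derive1 f = df.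
Proof. by move=> h; apply/funext => x; rewrite derive1E; apply: derive_val. Qed.

Lemma C2_intro (phi dphi ddphi : R -> R) :
  (forall x, is_derive x 1 phi (dphi x)) -> (forall x, is_derive x 1 dphi (ddphi x)) ->
  continuous ddphi -> C2 phi.
Proof.
move=> h1 h2 c; rewrite /C2 (derive1_fun h1) (derive1_fun h2).
by split; [move=> x; case: (h1 x)|move=> x; case: (h2 x)|exact: c].
Qed.

(** The strict inequalities at the ends move the minimum of [w - phi] inside, so a contact point is
    produced instead of assumed. [G] is arbitrary because subsolutions are treated as supersolutions
    for -H(x, -p), which is not coercive. *)
Lemma super_test a G (mu : R) w (phi dphi ddphi : R -> R) (s t z0 : R) :
  visc_super a G mu w ->
  (forall x, is_derive x 1 phi (dphi x)) -> (forall x, is_derive x 1 dphi (ddphi x)) ->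
  continuous ddphi ->
  s < z0 < t -> w z0 - phi z0 < w s - phi s -> w z0 - phi z0 < w t - phi t ->
  exists z, [/\ s < z < t, forall y, s <= y <= t -> w z - phi z <= w y - phi y &
    a z * ddphi z + G z (dphi z) <= mu].
Proof.
move=> [cw hw] h1 h2 c2 /andP[sz zt] hs ht.
have [|x _|z /andP[sz' zt'] hz] := @EVT_min_itv R (fun x => w x - phi x) s t.
- by rewrite ltW // (lt_trans sz).
- by apply: cvgB; [exact: cw|exact: (is_derive_continuous (h1 x))].
have hz0 := hz z0 (ltac:(rewrite !ltW//)).
have szlt : s < z.
  by rewrite lt_neqAle sz' andbT; apply/eqP => E; move: hz0; rewrite -E leNgt hs.
have ztlt : z < t.
  by rewrite lt_neqAle zt' andbT; apply/eqP => E; move: hz0; rewrite E leNgt ht.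
exists z; split => //; first by rewrite szlt.
pose psi y := phi y + (w z - phi z).
have h1' x : is_derive x 1 psi (dphi x).
  by apply: is_derive_eq (is_derive_add (h1 x) (is_derive_const _ _)) _; rewrite addr0.
have := hw psi z (C2_intro h1' h2 c2).
rewrite (derive1_fun h1') (derive1_fun h2); apply; first by rewrite /psi addrC subrK.
exists (Num.min (z - s) (t - z)); first by rewrite lt_min !subr_gt0 szlt.
move=> y; rewrite lt_min !ltr_norml => yz.
have := hz y (ltac:(apply/andP; split; lra)); rewrite /psi; lra.
Qed.

Lemma is_derive_quadratic (A B m x : R) :
  is_derive x 1 (fun y => A * (y - m) ^+ 2 + B * (y - m)) (2 * A * (x - m) + B).
Proof.
apply/is_deriveP => e e0; exists (e / (`|A| + 1)); first by rewrite divr_gt0 // ltr_wpDl.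
move=> y yx; have -> : A * (y - m) ^+ 2 + B * (y - m) - (A * (x - m) ^+ 2 + B * (x - m)) -
  (2 * A * (x - m) + B) * (y - x) = A * (y - x) * (y - x) by ring.
rewrite !normrM ler_wpM2r //; move: yx; rewrite ltr_pdivlMr ?ltr_wpDl //.
by have := normr_ge0 (y - x); have := normr_ge0 A; lra.
Qed.

Lemma is_derive_affine (A B m x : R) : is_derive x 1 (fun y => A * (y - m) + B) A.
Proof.
apply/is_deriveP => e e0; exists 1 => // y _.
have -> : A * (y - m) + B - (A * (x - m) + B) - A * (y - x) = 0 by ring.
by rewrite normr0 mulr_ge0 // ltW.
Qed.

Lemma super_quadratic a G (mu : R) w (A B m s t z0 : R) :
  visc_super a G mu w -> let phi y := A * (y - m) ^+ 2 + B * (y - m) in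
  s < z0 < t -> w z0 - phi z0 < w s - phi s -> w z0 - phi z0 < w t - phi t ->
  exists z, [/\ s < z < t, forall y, s <= y <= t -> w z - phi z <= w y - phi y &
    a z * (2 * A) + G z (2 * A * (z - m) + B) <= mu].
Proof.
move=> hw phi sz hs ht; have [||||||z hz] := @super_test a G mu w phi (fun z => 2 * A * (z - m) +
  B) (fun=> 2 * A) s t z0 hw.
- exact: is_derive_quadratic.
- by move=> x; exact: is_derive_affine.
- by move=> x; exact: cvg_cst.
- exact: sz.
- exact: hs.
- exact: ht.
by exists z.
Qed.

(* The test function is a concave parabola through the two ends of the chord; it is steep enough
   to the left to detach from [w] within a distance proportional to the chord, so that the
   contact point stays where [a] is quadratically small. *)
Lemma chord_le a G (mu : R) w (k x0 b c M de th : R) :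
  0 <= k -> (forall z, 0 <= a z <= k * (z - x0) ^+ 2) -> visc_super a G mu w ->
  c <= b -> 0 < M -> 0 < de -> 0 < th ->
  (forall h, 0 < h < de -> w x0 - w (x0 - h) <= b * h) ->
  (forall z p, `|z - x0| < de -> c - M <= p <= 2 * b - c + 5 * M -> mu + th <= G z p) ->
  exists2 de' : R, 0 < de' &
    forall h, 0 < h < de' -> w (x0 + h) - w x0 <= c * h /\ w x0 - w (x0 - h) <= c * h.
Proof.
move=> k0 ha hw cb M0 de0 th0 hb hG.
pose N := (b - c) / M + 2.
have MN : M * N = b - c + 2 * M by rewrite /N mulrDr mulrCA divff ?gt_eqF //; lra.
have N2 : 2 <= N by rewrite /N ler_wpDl // divr_ge0 ?subr_ge0 // ltW.
pose C := 2 * k * N * (b - c + 2 * M).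
have C0 : 0 <= C by rewrite /C !mulr_ge0 //; lra.
exists (Num.min (de / N) (th / (C + 1))).
  by rewrite lt_min !divr_gt0 //; lra.
move=> h; rewrite lt_min !ltr_pdivlMr; [|lra|lra] => /and3P[h0 hN hC].
pose r := M / h; have rh : r * h = M by rewrite /r divfK // gt_eqF.
have r0 : 0 < r by rewrite /r divr_gt0.
pose D := N * h; have hD : 2 * h <= D by rewrite ler_pM2r.
have D0 : 0 < D by lra.
have Dde : D < de by rewrite /D mulrC.
have rD : r * D = b - c + 2 * M by rewrite /D mulrCA rh mulrC MN.
have rDD : r * D ^+ 2 = D * (b - c + 2 * M) by rewrite expr2 mulrA rD mulrC.
have rhh : r * h ^+ 2 = M * h by rewrite expr2 mulrA rh.
have DM : 0 < D * M by rewrite mulr_gt0.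
have aD z : - D <= z - x0 <= D -> - th < a z * (2 * - r).
  move=> zD; have /andP[a0 az] := ha z.
  have zz : (z - x0) ^+ 2 <= D ^+ 2.
    by rewrite -subr_ge0 subr_sqr mulr_ge0 //; lra.
  have : a z <= k * D ^+ 2 by apply: le_trans az _; rewrite ler_wpM2l.
  move=> /(ler_wpM2l (ltW r0)); rewrite mulrCA rDD => h1.
  have E : C * h = 2 * (k * (D * (b - c + 2 * M))) by rewrite /C /D; ring.
  lra.
have contra z p : - D <= z - x0 <= D -> c - M <= p <= 2 * b - c + 5 * M ->
    a z * (2 * - r) + G z p <= mu -> False.
  move=> zD pD; have := aD z zD; have := hG z p _ pD; rewrite ltr_norml => /(_ (ltac:(lra))).
  lra.
have wD : w x0 - w (x0 - D) <= b * D by apply: hb; rewrite D0.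
clear hb hG ha aD hN hC C0 MN N2 k0 de0 th0 Dde; clearbody D r.
split; rewrite leNgt; apply/negP => hlt.
  have [|||z [zD _]] := @super_quadratic a G mu w (- r) (c + M) x0 (x0 - D) (x0 + h) x0 hw.
  - lra.
  - lra.
  - lra.
  apply: contra; first lra.
  have h1 : r * (z - x0) <= r * h by rewrite ler_pM2l //; lra.
  have h2 : r * (x0 - z) <= r * D by rewrite ler_pM2l //; lra.
  by lra.
have [|||z [zD _]] := @super_quadratic a G mu w (- r) (c - M) x0 (x0 - D) x0 (x0 - h) hw.
- lra.
- lra.
- lra.
apply: contra; first lra.
have h1 : r * (z - x0) <= 0 by rewrite pmulr_rle0 //; lra.
have h2 : r * (x0 - z) <= r * D by rewrite ler_pM2l //; lra.
by lra.
Qed.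

(** The growth conditions are reduced to qualitative consequences that are stable under (x, p) ->
    (-x, -p). *)
Record hamiltonian H (phat : R -> R) : Prop := Hamiltonian {
  ham_lip : forall B : R, exists2 K : R, 0 < K & forall x y p q, `|p| <= B -> `|q| <= B ->
    `|H x p - H y q| <= K * (`|x - y| + `|p - q|);
  ham_coercive : forall M : R, exists2 B : R, 0 <= B & forall x p, B <= `|p| -> M < H x p;
  ham_decr : forall x p q, p < q -> q <= phat x -> H x q < H x p;
  ham_incr : forall x p q, phat x <= p -> p < q -> H x p < H x q }.

Lemma ham_near H phat (x0 B th : R) : hamiltonian H phat -> 0 < th ->
  exists2 d : R, 0 < d & forall z p, `|z - x0| < d -> `|p| <= B -> `|H z p - H x0 p| < th.
Proof.
move=> /ham_lip/(_ B)[K K0 hK] th0; exists (th / K); first by rewrite divr_gt0.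
move=> z p zx pB; apply: le_lt_trans (hK z x0 p p pB pB) _.
by rewrite subrr normr0 addr0 mulrC -ltr_pdivlMr.
Qed.

(** An affine test function has no diffusion term, so contact with slope [P] or [- P] would give H
    <= mu where coercivity says H > mu. [P] also exceeds the oscillation of [w] nearby: this is the
    end condition at the point one unit beyond the chord. *)
Lemma super_locally_lipschitz a H phat (mu : R) w :
  hamiltonian H phat -> visc_super a H mu w -> locally_lipschitz w.
Proof.
move=> /ham_coercive/(_ mu)[B B0 hB] hw x0.
have cw : continuous w by case: hw.
have [|x _|m _ hm] := @EVT_min_itv R w (x0 - 2) (x0 + 2); [lra|exact: cw|].
have [|x _|M' _ hM] := @EVT_min_itv R (fun x => - w x) (x0 - 2) (x0 + 2); [lra| |].
  by apply: cvgN; exact: cw.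
pose P := Num.max (B + 1) (w M' - w m + 1).
have P1 : B + 1 <= P by rewrite /P le_max lexx.
have P2 : w M' - w m + 1 <= P by rewrite /P le_max lexx orbT.
have osc y z : x0 - 2 <= y <= x0 + 2 -> x0 - 2 <= z <= x0 + 2 -> w y - w z < P.
  by move=> /hM h1 /hm h2; lra.
have key y z : x0 - 1 < y -> y < z -> z < x0 + 1 ->
    w z - w y <= P * (z - y) /\ - (P * (z - y)) <= w z - w y.
  move=> yx yz zx; split; rewrite leNgt; apply/negP => hlt.
    have [|||t [_ _]] := @super_quadratic a H mu w 0 P 0 (y - 1) z y hw.
    - lra.
    - have := osc y (y - 1) (ltac:(lra)) (ltac:(lra)); lra.
    - lra.
    rewrite !mulr0 mul0r !add0r; apply/negP; rewrite -ltNge; apply: hB.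
    by rewrite ger0_norm; lra.
  have [|||t [_ _]] := @super_quadratic a H mu w 0 (- P) 0 y (z + 1) z hw.
  - lra.
  - lra.
  - have := osc z (z + 1) (ltac:(lra)) (ltac:(lra)); lra.
  rewrite !mulr0 mul0r !add0r; apply/negP; rewrite -ltNge; apply: hB.
  by rewrite normrN ger0_norm; lra.
exists P, 1; split => // y z; rewrite !ltr_norml => yx zx.
have [yz|zy|->] := ltgtP y z; last by rewrite !subrr normr0 mulr0.
- have [] := key y z (ltac:(lra)) yz (ltac:(lra)).
  by rewrite [`|y - z|]distrC [`|z - y|]gtr0_norm ?subr_gt0 // ler_norml; lra.
- have [] := key z y (ltac:(lra)) zy (ltac:(lra)).
  by rewrite [`|y - z|]gtr0_norm ?subr_gt0 // ler_norml; lra.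
Qed.

End Viscosity.

(** * Secant slopes at degenerate points *)

Section Secants.
Variable R : realType.
Implicit Types (a u v w phi : R -> R) (G H : R -> R -> R) (x y z p q h : R).

Lemma is_derive_derive1 (f : R -> R) x (d : R) : is_derive x 1 f d -> derive1 f x = d.
Proof. by move=> h; rewrite derive1E; apply: derive_val. Qed.

Lemma derivable_is_derive (f : R -> R) x : derivable f x 1 -> is_derive x 1 f (derive1 f x).
Proof. by move=> h; apply: DeriveDef; [exact: h|rewrite derive1E]. Qed.

Lemma is_derive_unique (f : R -> R) x (d1 d2 : R) :
  is_derive x 1 f d1 -> is_derive x 1 f d2 -> d1 = d2.
Proof. by move=> /is_derive_derive1 <- /is_derive_derive1. Qed.

Lemma is_derive_reflect (f : R -> R) x (d : R) :
  is_derive (- x) 1 f d -> is_derive x 1 (fun y => f (- y)) (- d).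
Proof.
move=> /is_deriveP h; apply/is_deriveP => e e0; have [r r0 hr] := h e e0; exists r => // y yx.
have E : - y - - x = - (y - x) by ring.
by have := hr (- y); rewrite E !normrN => /(_ yx); rewrite mulrN mulNr.
Qed.

Lemma visc_super_reflect a H (mu : R) w : visc_super a H mu w ->
  visc_super (fun x => a (- x)) (fun x p => H (- x) (- p)) mu (fun x => w (- x)).
Proof.
move=> [cw hw]; split.
  by move=> x; apply: (@continuous_comp _ _ _ (fun x => - x) w); [exact: oppr_continuous|exact: cw].
move=> phi x0 [d1 d2 c] E [e e0 he].
have h1 x : is_derive x 1 (fun y => phi (- y)) (- derive1 phi (- x)).
  by apply: is_derive_reflect; apply: derivable_is_derive; exact: d1.
have h2 x : is_derive x 1 (fun y => - derive1 phi (- y)) (derive1 (derive1 phi) (- x)).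
  rewrite -[derive1 (derive1 phi) (- x)]opprK; apply: is_derive_opp; apply: is_derive_reflect.
  by apply: derivable_is_derive; exact: d2.
have c2 : continuous (fun x => derive1 (derive1 phi) (- x)).
  by move=> x; apply: (@continuous_comp _ _ _ (fun x => - x)); [exact: oppr_continuous|exact: c].
have := hw _ (- x0) (C2_intro h1 h2 c2).
rewrite (derive1_fun h1) (derive1_fun h2) !opprK; apply; first exact: E.
exists e => // y yx; have := he (- y); rewrite opprK; apply.
by have -> : - y - x0 = - (y + x0) by [ring]; rewrite normrN.
Qed.

(** Changing the sign of [v] but not of x keeps [a] and the base point, so secant estimates transfer
    without exchanging left and right. *)
Lemma visc_subE a H (lam : R) v :
  visc_sub a H lam v <-> visc_super a (fun x p => - H x (- p)) (- lam) (fun x => - v x).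
Proof.
have key (f g : R -> R) : C2 f -> (forall x, g x = - f x) ->
    C2 g /\ forall x, derive1 g x = - derive1 f x /\ derive1 (derive1 g) x = - derive1 (derive1 f) x.
  move=> [d1 d2 c] /funext ->.
  have h1 x : is_derive x 1 (fun y => - f y) (- derive1 f x).
    by apply: is_derive_opp; apply: derivable_is_derive; exact: d1.
  have h2 x : is_derive x 1 (fun y => - derive1 f y) (- derive1 (derive1 f) x).
    by apply: is_derive_opp; apply: derivable_is_derive; exact: d2.
  have c2 : continuous (fun x => - derive1 (derive1 f) x) by move=> x; apply: cvgN; exact: c.
  split; first exact: C2_intro h1 h2 c2.
  by move=> x; rewrite (derive1_fun h1) (derive1_fun h2).
split=> -[cv hv]; split.
- by move=> x; apply: cvgN; exact: cv.
- move=> phi x0 hphi E [e e0 he].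
  have [C2N hN] := key phi (fun x => - phi x) hphi (fun=> erefl).
  have := hv _ x0 C2N; have [-> ->] := hN x0 => hh.
  rewrite -lerN2 opprK opprD opprK -mulrN; apply: hh; first by rewrite E opprK.
  by exists e => // y /he; rewrite lerNr.
- have -> : v = fun x => - - v x by apply/funext => x; rewrite opprK.
  by move=> x; apply: cvgN; exact: cv.
- move=> phi x0 hphi E [e e0 he].
  have [C2N hN] := key phi (fun x => - phi x) hphi (fun=> erefl).
  have := hv _ x0 C2N; have [-> ->] := hN x0 => hh.
  rewrite -lerN2 opprD -mulrN -[X in H _ X]opprK; apply: hh; first by rewrite E.
  by exists e => // y /he; rewrite lerN2.
Qed.

Lemma visc_sub_reflect a H (lam : R) v : visc_sub a H lam v ->
  visc_sub (fun x => a (- x)) (fun x p => H (- x) (- p)) lam (fun x => v (- x)).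
Proof. by move=> /visc_subE/visc_super_reflect h; apply/visc_subE. Qed.

Lemma hamiltonian_reflect H phat : hamiltonian H phat ->
  hamiltonian (fun x p => H (- x) (- p)) (fun x => - phat (- x)).
Proof.
case=> h1 h2 h3 h4; split.
- move=> B; have [K K0 hK] := h1 B; exists K => // x y p q pB qB.
  have := hK (- x) (- y) (- p) (- q); rewrite !normrN => /(_ pB qB).
  have E (s t : R) : `|- s - - t| = `|s - t| by rewrite -opprD normrN.
  by rewrite !E.
- by move=> M; have [B B0 hB] := h2 M; exists B => // x p pB; apply: hB; rewrite normrN.
- by move=> x p q pq qx; apply: h4; [rewrite lerNr|rewrite ltrN2].
- by move=> x p q px pq; apply: h3; [rewrite ltrN2|rewrite lerNl].
Qed.

(** The local Lipschitz constant is the crude bound on left secants from which [chord_le] starts. As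
    H exceeds [mu] at every slope above [c], one application reaches [c']; with [M = c' - c] all
    test slopes stay above [c]. *)
Lemma super_secant_le a H phat (mu : R) w (k x0 c c' th : R) :
  hamiltonian H phat -> 0 <= k -> (forall z, 0 <= a z <= k * (z - x0) ^+ 2) ->
  visc_super a H mu w -> c < c' -> 0 < th -> (forall p, c <= p -> mu + th <= H x0 p) ->
  exists2 d : R, 0 < d &
    forall h, 0 < h < d -> w (x0 + h) - w x0 <= c' * h /\ w x0 - w (x0 - h) <= c' * h.
Proof.
move=> hH k0 ha hw cc th0 hc.
have [L [d1 [d10 hL]]] := super_locally_lipschitz hH hw x0.
pose b := Num.max L c'; pose M := c' - c.
have bL : L <= b by rewrite /b le_max lexx.
have bc : c' <= b by rewrite /b le_max lexx orbT.
pose B := `|c| + `|2 * b - c' + 5 * M|.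
have [d2 d20 hd2] := @ham_near R H phat x0 B (th / 2) hH (ltac:(lra)).
apply: (@chord_le R a H mu w k x0 b c' M (Num.min d1 d2) (th / 2) k0 ha hw bc).
- by rewrite /M subr_gt0.
- by rewrite lt_min d10.
- lra.
- move=> h; rewrite lt_min => /and3P[h0 hd1 _].
  have := hL x0 (x0 - h); rewrite subrr normr0 => /(_ d10).
  have -> : x0 - h - x0 = - h by ring.
  have -> : x0 - (x0 - h) = h by ring.
  rewrite normrN gtr0_norm // => /(_ hd1); rewrite ler_norml => /andP[_ /le_trans]; apply.
  by rewrite ler_pM2r.
- move=> z p; rewrite lt_min => /andP[_ zd] pr.
  have cp : c <= p by move: pr; rewrite /M; lra.
  have pB : `|p| <= B.
    rewrite /B ler_norml; have := ler_norm (- c); have := ler_norm (2 * b - c' + 5 * M).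
    have := normr_ge0 c; have := normr_ge0 (2 * b - c' + 5 * M); rewrite normrN; lra.
  have := hd2 z p zd pB; rewrite ltr_norml; have := hc p cp; lra.
Qed.

Lemma super_secant_ge a H phat (mu : R) w (k x0 c c' th : R) :
  hamiltonian H phat -> 0 <= k -> (forall z, 0 <= a z <= k * (z - x0) ^+ 2) ->
  visc_super a H mu w -> c' < c -> 0 < th -> (forall p, p <= c -> mu + th <= H x0 p) ->
  exists2 d : R, 0 < d &
    forall h, 0 < h < d -> c' * h <= w (x0 + h) - w x0 /\ c' * h <= w x0 - w (x0 - h).
Proof.
move=> hH k0 ha hw cc th0 hc.
have [|||d d0 hd] := @super_secant_le _ _ _ mu _ k (- x0) (- c) (- c') th (hamiltonian_reflect hH) k0 _
  (visc_super_reflect hw) _ th0.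
- by move=> z; have := ha (- z); rewrite -opprD sqrrN opprK.
- by rewrite ltrN2.
- by move=> p pc; rewrite opprK; apply: hc; rewrite lerNl.
exists d => // h hh; have [] := hd h hh.
rewrite !opprD !opprK; split; lra.
Qed.

(** For a subsolution H is known to be below [lam] only in a window, so a secant bound can be raised
    only a little at a time. With d = c' - c the test slopes of [chord_le], after the change of
    sign, fill [c - 6 d, c + 2 d], whence the factor 6. *)
Lemma sub_secant_step a H phat (lam : R) v (k x0 c c' M th : R) :
  hamiltonian H phat -> 0 <= k -> (forall z, 0 <= a z <= k * (z - x0) ^+ 2) ->
  visc_sub a H lam v -> c < c' -> 6 * (c' - c) <= M -> 0 < th ->
  (forall p, c - M <= p <= c + M -> H x0 p <= lam - th) ->
  (exists2 d : R, 0 < d & forall h, 0 < h < d -> c * h <= v x0 - v (x0 - h)) ->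
  exists2 d : R, 0 < d &
    forall h, 0 < h < d -> c' * h <= v (x0 + h) - v x0 /\ c' * h <= v x0 - v (x0 - h).
Proof.
move=> hH k0 ha /visc_subE hv cc cM th0 hc [d1 d10 hd1].
have [d2 d20 hd2] := @ham_near R H phat x0 (`|c| + M) (th / 2) hH (ltac:(lra)).
have [||||||d d0 hd] := @chord_le R a _ (- lam) _ k x0 (- c) (- c') (c' - c) (Num.min d1 d2) (th /
  2) k0 ha hv.
- by rewrite lerN2 ltW.
- by rewrite subr_gt0.
- by rewrite lt_min d10.
- lra.
- move=> h; rewrite lt_min => /and3P[h0 h1 _]; have := hd1 h (ltac:(rewrite h0//)); lra.
- move=> z p; rewrite lt_min => /andP[_ zd] pr.
  have pB : `|- p| <= `|c| + M.
    rewrite ler_norml; have := ler_norm (- c); have := ler_norm c; rewrite normrN; lra.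
  have := hd2 z (- p) zd pB; rewrite ltr_norml; have := hc (- p) (ltac:(lra)); lra.
by exists d => // h hh; have [] := hd h hh; split; lra.
Qed.

Lemma sub_secant_ge a H phat (lam : R) v (k x0 c0 c1 M th : R) :
  hamiltonian H phat -> 0 <= k -> (forall z, 0 <= a z <= k * (z - x0) ^+ 2) ->
  visc_sub a H lam v -> c0 <= c1 -> 0 < M -> 0 < th ->
  (forall p, c0 - M <= p <= c1 + M -> H x0 p <= lam - th) ->
  (exists2 d : R, 0 < d & forall h, 0 < h < d -> c0 * h <= v x0 - v (x0 - h)) ->
  exists2 d : R, 0 < d &
    forall h, 0 < h < d -> c1 * h <= v (x0 + h) - v x0 /\ c1 * h <= v x0 - v (x0 - h).
Proof.
move=> hH k0 ha hv c01 M0 th0 hc h0.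
pose N := Num.bound ((c1 - c0) / (M / 7)).
have N0 : 0 < N.+1%:R :> R by [].
pose tau0 := (c1 - c0) / N.+1%:R.
have tN : tau0 * N.+1%:R = c1 - c0 by rewrite /tau0 divfK // gt_eqF.
have t0 : 0 <= tau0 by rewrite /tau0 divr_ge0 ?subr_ge0.
have tM : tau0 < M / 7.
  have : (c1 - c0) / (M / 7) < N.+1%:R.
    apply: lt_trans (archi_boundP _) _; last by rewrite ltr_nat.
    by rewrite divr_ge0 ?subr_ge0 //; lra.
  rewrite ltr_pdivrMr; last by lra.
  by rewrite /tau0 ltr_pdivrMr // mulrC.
have step i : (i <= N.+1)%N -> exists2 d : R, 0 < d &
    forall h, 0 < h < d -> (c0 + i%:R * tau0) * h <= v x0 - v (x0 - h).
  elim: i => [_|i IH iN].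
    by have [d d0 hd] := h0; exists d => // h; rewrite mul0r addr0; exact: hd.
  have iN' : i%:R * tau0 <= c1 - c0.
    by rewrite -tN [leRHS]mulrC ler_wpM2r // ler_nat ltnW.
  have i0 : 0 <= i%:R * tau0 by rewrite mulr_ge0.
  have [|tau_pos] := leP tau0 0.
    move=> tle; have tz : tau0 = 0 by apply/eqP; rewrite eq_le tle.
    have [d d0 hd] := IH (ltnW iN); exists d => // h; have := hd h.
    by rewrite tz !mulr0.
  have [||||d d0 hd] := @sub_secant_step a H phat lam v k x0 (c0 + i%:R * tau0) (c0 + i.+1%:R * tau0)
      (6 * tau0) th hH k0 ha hv _ _ th0.
  - by rewrite -natr1; lra.
  - by rewrite -natr1; lra.
  - by move=> p hp; apply: hc; lra.
  - exact: IH (ltnW iN).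
  by exists d => // h /hd[].
have := step N.+1 (leqnn _); rewrite mulrC tN addrC subrK => hN.
(* The climb was recorded for left secants only. A last step of size M / 7, allowed since 6 M / 7 <=
   M, gives both sides and also covers c0 = c1. *)
have [|||d d0 hd] := @sub_secant_step a H phat lam v k x0 c1 (c1 + M / 7) M th hH k0 ha hv _ _ th0 _ hN.
- lra.
- lra.
- by move=> p hp; apply: hc; lra.
exists d => // h hh; have [h1 h2] := hd h hh; case/andP: hh => h3 _.
by have := mulr_gt0 M0 h3; split; lra.
Qed.

(** [phi] need only be differentiable at x, so a differentiable function can test itself and one
    slope function can test another. *)
Definition subgradient w x p := exists phi : R -> R, is_derive x 1 phi p /\
  exists2 e : R, 0 < e & forall y, `|y - x| < e -> phi y - phi x <= w y - w x.

Lemma subgradient_derive w x p (d : R) : subgradient w x p -> is_derive x 1 w d -> p = d.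
Proof.
move=> [phi [dphi [e e0 he]]] dw.
have dz := is_derive_sub dw dphi.
suff : d - p = 0 by move/eqP; rewrite subr_eq0 => /eqP.
apply/eqP; rewrite -normr_le0; apply/ler_addgt0Pr => r r0; rewrite add0r.
have /is_deriveP/(_ _ r0)[s s0 hs] := dz.
pose t := Num.min e s / 2.
have t0 : 0 < t by rewrite /t divr_gt0 // lt_min e0.
have te : t < e by have : Num.min e s <= e by [rewrite ge_min lexx]; rewrite /t; lra.
have ts : t < s by have : Num.min e s <= s by [rewrite ge_min lexx orbT]; rewrite /t; lra.
have E1 : x + t - x = t by ring.
have E2 : x - t - x = - t by ring.
have := hs (x + t); rewrite E1 gtr0_norm // => /(_ ts).
have := hs (x - t); rewrite E2 normrN gtr0_norm // => /(_ ts).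
have := he (x + t); rewrite E1 gtr0_norm // => /(_ te).
have := he (x - t); rewrite E2 normrN gtr0_norm // => /(_ te).
rewrite !ler_norml => h1 h2 h3 h4.
have h5 : (d - p) * t <= r * t by lra.
have h6 : - (d - p) * t <= r * t by lra.
by move: h5 h6; rewrite !ler_pM2r //; lra.
Qed.

Lemma subgradient_lipschitz w x p (L e : R) : subgradient w x p -> 0 < e ->
  (forall y, `|y - x| < e -> `|w y - w x| <= L * `|y - x|) -> `|p| <= L.
Proof.
move=> [phi [dphi [e1 e10 he1]]] e0 hL.
apply/ler_addgt0Pr => r r0.
have /is_deriveP/(_ _ r0)[s s0 hs] := dphi.
pose t := Num.min (Num.min e e1) s / 2.
have m0 : 0 < Num.min (Num.min e e1) s by rewrite !lt_min e0 e10.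
have t0 : 0 < t by rewrite /t divr_gt0.
have te : t < e.
  by have : Num.min (Num.min e e1) s <= e by [rewrite !ge_min lexx]; rewrite /t; lra.
have te1 : t < e1.
  by have : Num.min (Num.min e e1) s <= e1 by [rewrite !ge_min lexx orbT]; rewrite /t; lra.
have ts : t < s.
  by have : Num.min (Num.min e e1) s <= s by [rewrite !ge_min lexx !orbT]; rewrite /t; lra.
have E1 : x + t - x = t by ring.
have E2 : x - t - x = - t by ring.
have := hs (x + t); rewrite E1 gtr0_norm // => /(_ ts).
have := hs (x - t); rewrite E2 normrN gtr0_norm // => /(_ ts).
have := he1 (x + t); rewrite E1 gtr0_norm // => /(_ te1).
have := he1 (x - t); rewrite E2 normrN gtr0_norm // => /(_ te1).
have := hL (x + t); rewrite E1 gtr0_norm // => /(_ te).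
have := hL (x - t); rewrite E2 normrN gtr0_norm // => /(_ te).
rewrite !ler_norml => h1 h2 h3 h4 h5 h6.
have h7 : p * t <= (L + r) * t by lra.
have h8 : - p * t <= (L + r) * t by lra.
by move: h7 h8; rewrite !ler_pM2r //; lra.
Qed.

End Secants.

(** * Interior regularity *)

Section Regularity.
Variable R : realType.
Implicit Types (a u v w phi : R -> R) (G H : R -> R -> R) (x y z p q h t : R).

Lemma is_derive_near (f g : R -> R) x (d e : R) : 0 < e ->
  (forall y, `|y - x| < e -> f y = g y) -> is_derive x 1 g d -> is_derive x 1 f d.
Proof.
move=> e0 fg /is_deriveP hg; apply/is_deriveP => r r0; have [s s0 hs] := hg r r0.
exists (Num.min e s); first by rewrite lt_min e0.
move=> y; rewrite lt_min => /andP[ye ys].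
by rewrite !fg ?subrr ?normr0 //; exact: hs.
Qed.

(** The conclusion is concavity of g - A t^2 written at three points; for A t^2 itself it is an
    equality. Were it violated, W plus the parabola [Q] of second derivative 2 A interpolating g at
    x and z would, up to a constant, touch w from below in between, against the last hypothesis. W =
    0 bounds second differences; W a second primitive of the expected v'' identifies v. *)
Lemma super_no_convex a G (mu : R) w (g W dW ddW : R -> R) (A x y z : R) :
  (forall t, g t = w t - W t) ->
  visc_super a G mu w ->
  (forall t, is_derive t 1 W (dW t)) -> (forall t, is_derive t 1 dW (ddW t)) -> continuous ddW ->
  x < y -> y < z ->
  (forall t p, x < t < z -> subgradient w t p -> mu < a t * (ddW t + 2 * A) + G t p) ->
  - (A * ((y - x) * (z - y) * (z - x))) <= (g y - g x) * (z - y) - (g z - g y) * (y - x).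
Proof.
move=> hg hw h1 h2 c2 xy yz hmu; rewrite leNgt; apply/negP => hlt.
have xz : 0 < z - x by lra.
pose B := (g z - g x) / (z - x) - A * (z - x).
have EB : B * (z - x) = g z - g x - A * (z - x) ^+ 2.
  by rewrite /B mulrBl divfK ?gt_eqF // -mulrA -expr2.
pose Q t := A * (t - x) ^+ 2 + B * (t - x).
have hQ t : is_derive t 1 (fun s => W s + Q s) (dW t + (2 * A * (t - x) + B)).
  by apply: is_derive_add => //; exact: is_derive_quadratic.
have hQ2 t : is_derive t 1 (fun s => dW s + (2 * A * (s - x) + B)) (ddW t + 2 * A).
  by apply: is_derive_add => //; exact: is_derive_affine.
have cQ : continuous (fun t => ddW t + 2 * A).
  by move=> t; apply: cvgD; [exact: c2|exact: cvg_cst].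
have key : g y - Q y < g x.
  rewrite -subr_gt0 -(pmulr_rgt0 _ xz).
  have -> : (z - x) * (g x - (g y - Q y)) =
    - ((g y - g x) * (z - y) - (g z - g y) * (y - x) + A * ((y - x) * (z - y) * (z - x))).
    transitivity ((z - x) * (g x - g y) + (z - x) * A * (y - x) ^+ 2 + (B * (z - x)) * (y - x)).
      by rewrite /Q; ring.
    by rewrite EB; ring.
  lra.
have Qx : Q x = 0 by rewrite /Q subrr expr0n /= !mulr0 addr0.
have Qz : Q z = g z - g x by rewrite /Q EB; ring.
have [|||t [txz hmin hle]] := @super_test R a G mu w _ _ _ x z y hw hQ hQ2 cQ.
- by rewrite xy.
- by move: key; rewrite Qx !hg; lra.
- by move: key; rewrite Qz !hg; lra.
have sg : subgradient w t (dW t + (2 * A * (t - x) + B)).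
  exists (fun s => W s + Q s); split; first exact: hQ.
  exists (Num.min (t - x) (z - t)); first by rewrite lt_min !subr_gt0.
  move=> s; rewrite lt_min !ltr_norml => st.
  have := hmin s (ltac:(lra)); lra.
by have := hmu t _ txz sg; rewrite ltNge hle.
Qed.

Lemma small_gap (C e m : R) : 0 <= C -> 0 < e -> 0 < m ->
  exists t, [/\ 0 < t, t < m & C * t <= e].
Proof.
move=> C0 e0 m0; exists (Num.min m (e / (C + 1)) / 2).
have C1 : 0 < C + 1 by lra.
have k0 : 0 < Num.min m (e / (C + 1)) by rewrite lt_min m0 divr_gt0.
have k1 : Num.min m (e / (C + 1)) <= m by rewrite ge_min lexx.
have : Num.min m (e / (C + 1)) <= e / (C + 1) by rewrite ge_min lexx orbT.
rewrite ler_pdivlMr // => k2; split; [lra|lra|].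
by have := mulr_ge0 C0 (ltW k0); lra.
Qed.

(** Secant slopes over adjacent intervals differ by at most C times the total length, so the
    supremum of the corrected left secants at [y] already serves as the derivative and no limit has
    to be taken. *)
Lemma C11_derive v (x0 d C : R) : 0 < d -> 0 <= C ->
  (forall x y z, x0 - d < x -> x < y -> y < z -> z < x0 + d ->
    `|(v y - v x) * (z - y) - (v z - v y) * (y - x)| <= C * ((y - x) * (z - y) * (z - x))) ->
  exists p : R -> R, forall y z, `|y - x0| < d -> `|z - x0| < d ->
    `|v z - v y - p y * (z - y)| <= C * (z - y) ^+ 2.
Proof.
move=> d0 C0 hv.
pose s x y := (v y - v x) / (y - x).
have sE x y : x < y -> s x y * (y - x) = v y - v x.
  by move=> xy; rewrite /s divfK // subr_eq0 gt_eqF.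
have slope x y z : x0 - d < x -> x < y -> y < z -> z < x0 + d ->
    - (C * (z - x)) <= s x y - s y z <= C * (z - x).
  move=> h1 h2 h3 h4; have := hv x y z h1 h2 h3 h4.
  have k0 : 0 < (y - x) * (z - y) by rewrite mulr_gt0 ?subr_gt0.
  rewrite -!sE //.
  have -> : s x y * (y - x) * (z - y) - s y z * (z - y) * (y - x) =
    (s x y - s y z) * ((y - x) * (z - y)) by ring.
  by rewrite normrM (gtr0_norm k0) [X in _ <= X]mulrCA mulrC ler_pM2l // ler_norml.
suff /choice[p hp] : forall y, exists p, `|y - x0| < d -> forall z, `|z - x0| < d ->
    `|v z - v y - p * (z - y)| <= C * (z - y) ^+ 2 by exists p => y z hy; exact: hp.
move=> y; have [yd|yd] := boolP (`|y - x0| < d); last by exists 0.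
move: yd; rewrite ltr_norml => yd.
pose S := [set r | exists2 x, x0 - d < x < y & r = s x y - C * (y - x)].
have S0 : has_sup S.
  pose x1 := (x0 - d + y) / 2; pose z1 := (x0 + d + y) / 2.
  split; first by exists (s x1 y - C * (y - x1)), x1 => //; rewrite /x1; lra.
  exists (s y z1 + C * (z1 - y)) => _ [x xy ->].
  by have := slope x y z1; rewrite /z1; lra.
pose p := sup S.
have p1 x : x0 - d < x -> x < y -> s x y <= p + C * (y - x).
  move=> h1 h2; have : s x y - C * (y - x) <= p.
    by apply: (ub_le_sup S0.2); exists x => //; rewrite h1.
  lra.
have p2 z : y < z -> z < x0 + d -> p <= s y z + C * (z - y).
  move=> h1 h2; apply: (ge_sup S0.1) => _ [x /andP[h3 h4] ->].
  by have := slope x y z h3 h4 h1 h2; lra.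
have p3 z : y < z -> z < x0 + d -> s y z <= p + C * (z - y).
  move=> h1 h2; apply/ler_addgt0Pr => e e0.
  have [||t [t0 t1 t2]] := @small_gap (2 * C) e (y - (x0 - d)) _ e0; [lra|lra|].
  have := slope (y - t) y z (ltac:(lra)) (ltac:(lra)) h1 h2.
  by have := p1 (y - t) (ltac:(lra)) (ltac:(lra)); lra.
have p4 x : x0 - d < x -> x < y -> p <= s x y + C * (y - x).
  move=> h1 h2; apply/ler_addgt0Pr => e e0.
  have [||t [t0 t1 t2]] := @small_gap (2 * C) e (x0 + d - y) _ e0; [lra|lra|].
  have := slope x y (y + t) h1 h2 (ltac:(lra)) (ltac:(lra)).
  by have := p2 (y + t) (ltac:(lra)) (ltac:(lra)); lra.
exists p => _ z; rewrite ltr_norml => zd.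
have [yz|zy|->] := ltgtP y z; last by rewrite !subrr mulr0 subrr normr0 expr0n mulr0.
- have zy0 : 0 < z - y by lra.
  rewrite -sE // -mulrBl normrM (gtr0_norm zy0) expr2 mulrA ler_pM2r // ler_norml.
  by have := p2 z yz (ltac:(lra)); have := p3 z yz (ltac:(lra)); lra.
- have zy0 : 0 < y - z by lra.
  have -> : v z - v y - p * (z - y) = (p - s z y) * (y - z).
    by rewrite mulrBl sE //; ring.
  rewrite -[(z - y) ^+ 2]sqrrN opprB normrM (gtr0_norm zy0) expr2 mulrA ler_pM2r // ler_norml.
  by have := p1 z (ltac:(lra)) zy; have := p4 z (ltac:(lra)) zy; lra.
Qed.

Lemma C11_is_derive v (p : R -> R) (x0 d C : R) : 0 <= C ->
  (forall y z, `|y - x0| < d -> `|z - x0| < d ->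
    `|v z - v y - p y * (z - y)| <= C * (z - y) ^+ 2) ->
  forall y, `|y - x0| < d -> is_derive y 1 v (p y) /\ {for y, continuous p}.
Proof.
move=> C0 hp y yd.
have r0 : 0 < d - `|y - x0| by lra.
have near z : `|z - y| < d - `|y - x0| -> `|z - x0| < d.
  move=> zy; have -> : z - x0 = (z - y) + (y - x0) by ring.
  by apply: le_lt_trans (ler_normD _ _) _; lra.
split.
  apply/is_deriveP => e e0; have [t [t0 t1 t2]] := small_gap C0 e0 r0.
  exists t => // z zy; apply: le_trans (hp y z yd _) _.
    by apply: near; apply: lt_trans zy t1.
  rewrite -[(z - y) ^+ 2]real_normK ?num_real // expr2 mulrA ler_wpM2r //; apply: le_trans t2.
  by rewrite ler_wpM2l // ltW.
apply/continuous_forP => e e0.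
have [t [t0 t1 t2]] := @small_gap (2 * C) (e / 2) _ (ltac:(lra)) (ltac:(lra)) r0.
exists t => // z zy; have zd : `|z - x0| < d by apply: near; apply: lt_trans zy t1.
have := hp y z yd zd; have := hp z y zd yd.
have [->|zNy] := eqVneq z y; first by rewrite [p _ - _]subrr normr0.
have n0 : 0 < `|z - y| by rewrite normr_gt0 subr_eq0.
rewrite -[(y - z) ^+ 2]sqrrN opprB => h1 h2.
have : `|(p z - p y) * (z - y)| <= 2 * C * (z - y) ^+ 2.
  have -> : (p z - p y) * (z - y) = (v y - v z - p z * (y - z)) + (v z - v y - p y * (z - y)) by ring.
  by apply: le_trans (ler_normD _ _) _; lra.
rewrite normrM -[(z - y) ^+ 2]real_normK ?num_real // expr2 mulrA ler_pM2r // => /le_lt_trans; apply.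
have : C * `|z - y| <= C * t by rewrite ler_wpM2l // ltW.
lra.
Qed.

Lemma ball3 (x0 e x z t : R) : x0 - e < x -> z < x0 + e -> x < t < z -> `|t - x0| < e.
Proof. by move=> *; rewrite ltr_norml; lra. Qed.

Lemma clamp_itv (lo hi y : R) : lo <= hi -> lo <= Num.max (Num.min y hi) lo <= hi.
Proof. by move=> lohi; rewrite le_max lexx orbT /= ge_max ge_min lexx orbT. Qed.

Lemma clampE (lo hi y : R) : lo <= y <= hi -> Num.max (Num.min y hi) lo = y.
Proof. by move=> /andP[h1 h2]; rewrite min_l // max_l. Qed.

Lemma clamp_continuous (lo hi : R) : continuous (fun y : R => Num.max (Num.min y hi) lo).
Proof.
apply: continuous_pointwise => y; apply/continuous_forP => r r0; exists r => // z zy.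
by apply: le_lt_trans (max_dist_le _ _ _) _; apply: le_lt_trans (min_dist_le _ _ _) _.
Qed.

Lemma ham_comp_continuous H phat (p : R -> R) y :
  hamiltonian H phat -> {for y, continuous p} -> {for y, continuous (fun z => H z (p z))}.
Proof.
move=> /ham_lip/(_ (`|p y| + 1))[K K0 hK] /continuous_forP cp; apply/continuous_forP => r r0.
have kr : 0 < r / (2 * K) by rewrite divr_gt0 //; lra.
have [s s0 hs] := cp _ kr; have [s1 s10 hs1] := cp 1 ltr01.
exists (Num.min s (Num.min (r / (2 * K)) s1)); first by rewrite !lt_min s0 kr.
move=> z; rewrite !lt_min => /and3P[/hs h1 h2 /hs1 h3].
have pz : `|p z| <= `|p y| + 1.
  have -> : p z = p y + (p z - p y) by ring.
  by apply: le_trans (ler_normD _ _) _; lra.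
apply: le_lt_trans (hK z y _ _ pz _) _; first by lra.
have : `|z - y| + `|p z - p y| < r / K.
  have -> : r / K = r / (2 * K) + r / (2 * K) by field; rewrite gt_eqF.
  lra.
by rewrite ltr_pdivlMr // mulrC.
Qed.

Lemma visc_sol_local_C1 a H phat (lam : R) v x0 :
  continuous a -> hamiltonian H phat -> visc_sol a H lam v -> 0 < a x0 ->
  exists2 d : R, 0 < d & exists p : R -> R, forall y, `|y - x0| < d ->
    [/\ 0 < a y, is_derive y 1 v (p y) & {for y, continuous p}].
Proof.
move=> ca hH [hsup hsub] a0.
have /continuous_forP/(_ (a x0 / 2))[|d1 d10 hd1] := ca x0; first by lra.
have [L0 [d2 [d20 hd2]]] := super_locally_lipschitz hH hsup x0.
pose L : R := `|L0|.
have [K K0 hK] := ham_lip hH L.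
pose d := Num.min 1 (Num.min d1 d2).
have d0 : 0 < d by rewrite /d !lt_min ltr01 d10.
have dd1 : d <= d1 by rewrite /d !ge_min lexx orbT.
have dd2 : d <= d2 by rewrite /d !ge_min lexx !orbT.
have d11 : d <= 1 by rewrite /d !ge_min lexx.
have L00 : 0 <= L by exact: normr_ge0.
have apos y : `|y - x0| < d -> a x0 / 2 < a y.
  by move=> yd; have := hd1 y (lt_le_trans yd dd1); rewrite ltr_norml; lra.
have vL y z : `|y - x0| < d -> `|z - x0| < d -> `|v y - v z| <= L * `|y - z|.
  move=> yd zd; apply: le_trans (hd2 y z (lt_le_trans yd dd2) (lt_le_trans zd dd2)) _.
  by rewrite ler_wpM2r // ler_norm.
pose B : R := `|H x0 0| + K * (1 + L).
have HB y p : `|y - x0| < d -> `|p| <= L -> - B <= H y p <= B.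
  move=> yd pL; have := hK y x0 p 0 pL; rewrite normr0 subr0 => /(_ L00) h.
  have h2 : K * (`|y - x0| + `|p|) <= K * (1 + L) by rewrite ler_pM2l //; lra.
  rewrite -ler_norml /B; have -> : H y p = H x0 0 + (H y p - H x0 0) by ring.
  by apply: le_trans (ler_normD _ _) _; lra.
(* On the ball [a] exceeds half its value at [x0], so a y * (2 A) outweighs |lam| and the bound [B]
   on H: no parabola of second derivative 2 A can touch [v] from below, and no opposite one from
   above. *)
pose A : R := (`|lam| + B + 1) / a x0.
have EA : A * a x0 = `|lam| + B + 1 by rewrite /A divfK // gt_eqF.
have B0 : 0 <= B by rewrite /B addr_ge0 // mulr_ge0 ?ltW //; lra.
have A0 : 0 < A by rewrite /A divr_gt0 //; have := normr_ge0 lam; lra.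
have Aa y : `|y - x0| < d -> `|lam| + B < a y * (2 * A).
  by move=> /apos h; have : A * (a x0 / 2) < A * a y by [rewrite ltr_pM2l]; lra.
have sgL w t p : `|t - x0| < d -> (forall y z, `|y - x0| < d -> `|z - x0| < d ->
    `|w y - w z| <= L * `|y - z|) -> subgradient w t p -> `|p| <= L.
  move=> td wL sg; apply: (@subgradient_lipschitz R w t p L (d - `|t - x0|) sg); first by lra.
  move=> y yt; apply: wL => //; have -> : y - x0 = (y - t) + (t - x0) by ring.
  by apply: le_lt_trans (ler_normD _ _) _; lra.
have hsub' := (visc_subE a H lam v).1 hsub.
have z1 t : is_derive t 1 (fun _ : R => 0 : R) ((fun _ : R => 0 : R) t) by exact: is_derive_const.
have zc : continuous (fun _ : R => 0 : R) by move=> t; exact: cst_continuous.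
have lamn : - `|lam| <= lam <= `|lam| by rewrite -ler_norml.
have c11 x y z : x0 - d < x -> x < y -> y < z -> z < x0 + d ->
    `|(v y - v x) * (z - y) - (v z - v y) * (y - x)| <= A * ((y - x) * (z - y) * (z - x)).
  move=> h1 h2 h3 h4; rewrite ler_norml; apply/andP; split.
    have g0 t : v t = v t - 0 by rewrite subr0.
    apply: (@super_no_convex a H lam v v _ _ _ A x y z g0 hsup z1 z1 zc h2 h3) => t p txz sg.
    rewrite add0r.
    have td := ball3 h1 h4 txz.
    have := HB t p td (sgL v t p td vL sg); have := Aa t td; clear - lamn; lra.
  have g0 t : - v t = - v t - 0 by rewrite subr0.
  have := @super_no_convex a _ (- lam) _ _ _ _ _ A x y z g0 hsub' z1 z1 zc h2 h3.
  move=> h; have {h} : - (A * ((y - x) * (z - y) * (z - x))) <=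
      (- v y - - v x) * (z - y) - (- v z - - v y) * (y - x).
    apply: h => t p txz sg; rewrite add0r.
    have td := ball3 h1 h4 txz.
    have pL : `|- p| <= L.
      rewrite normrN; apply: (sgL (fun x => - v x) t p td _ sg) => y' z' h5 h6.
      by rewrite -opprD normrN; exact: vL.
    have := HB t (- p) td pL; have := Aa t td; clear - lamn; lra.
  clear; lra.
have [p hp] := C11_derive d0 (ltW A0) c11.
exists d => //; exists p => y yd; have [h1 h2] := C11_is_derive (ltW A0) hp yd; split => //.
by have := apos y yd; clear - a0; lra.
Qed.

Lemma affine_of_slopes (g : R -> R) (x1 z1 : R) : x1 < z1 ->
  (forall y, x1 < y < z1 -> (g y - g x1) * (z1 - y) - (g z1 - g y) * (y - x1) = 0) ->
  exists be : R, forall y, x1 < y < z1 -> g y = g x1 + be * (y - x1).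
Proof.
move=> xz aff; have e0 : 0 < z1 - x1 by lra.
pose be := (g z1 - g x1) / (z1 - x1).
have Ebe : be * (z1 - x1) = g z1 - g x1 by rewrite /be divfK // gt_eqF.
exists be => y yd; have := aff y yd => h.
have : (g y - g x1 - be * (y - x1)) * (z1 - x1) = 0.
  rewrite -h.
  have -> : (g y - g x1 - be * (y - x1)) * (z1 - x1) =
    (g y - g x1) * (z1 - x1) - be * (z1 - x1) * (y - x1) by ring.
  by rewrite Ebe; ring.
by move/eqP; rewrite mulf_eq0 (gt_eqF e0) orbF => /eqP; lra.
Qed.

(** As v is already C^1, its subgradients equal [p] and f = (lam - H(y, p)) / a is a known
    continuous function. If W'' = f, then [super_no_convex] applies with every positive constant
    both to v - W and to its opposite, so v - W is affine. *)
Lemma visc_sol_local_C2 a H phat (lam : R) v x0 :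
  continuous a -> hamiltonian H phat -> visc_sol a H lam v -> 0 < a x0 ->
  exists2 d : R, 0 < d & exists q : R -> R, forall y, `|y - x0| < d ->
    is_derive y 1 v (q y) /\ is_derive y 1 q ((lam - H y (q y)) / a y).
Proof.
move=> ca hH hv a0; have [d d0 [p hp]] := visc_sol_local_C1 ca hH hv a0.
case: hv => hsup /visc_subE hsub'.
have apos y : `|y - x0| < d -> 0 < a y by move=> /hp[].
pose e : R := d / 2.
have e0 : 0 < e by rewrite /e; lra.
have ed : e < d by rewrite /e; lra.
(* Clamping to a smaller closed ball extends [f] continuously to the line, as global primitives
   require. *)
pose cl y := Num.max (Num.min y (x0 + e)) (x0 - e).
have cld y : `|cl y - x0| < d.
  by have := @clamp_itv (x0 - e) (x0 + e) y (ltac:(lra)); rewrite ltr_norml -/(cl y); lra.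
pose f y := (lam - H (cl y) (p (cl y))) / a (cl y).
have cf : continuous f.
  move=> y; rewrite /f.
  have ccl : {for y, continuous cl} by exact: clamp_continuous.
  have h1 : {for y, continuous (fun y => H (cl y) (p (cl y)))}.
    apply: (@continuous_comp _ _ _ cl (fun z => H z (p z))); first exact: ccl.
    by apply: ham_comp_continuous hH _; have [] := hp _ (cld y).
  have h2 : {for y, continuous (fun y => a (cl y))}.
    by apply: (@continuous_comp _ _ _ cl a); [exact: ccl|exact: ca].
  apply: cvgM; first by apply: cvgB; [exact: cvg_cst|exact: h1].
  by apply: cvgV; [rewrite gt_eqF // apos|exact: h2].
have [F [_ dF]] := primitive_exists cf.
have cF : continuous F by move=> y; exact: is_derive_continuous (dF y).
have [W [_ dW]] := primitive_exists cF.
pose g y := v y - W y.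
have fE t : `|t - x0| < e -> a t * f t = lam - H t (p t).
  move=> td; rewrite /f /cl clampE; last by move: td; rewrite ltr_norml; lra.
  by rewrite mulrC divfK // gt_eqF // apos // (lt_trans td).
have aff x y z : x0 - e < x -> x < y -> y < z -> z < x0 + e ->
    (g y - g x) * (z - y) - (g z - g y) * (y - x) = 0.
  move=> h1 h2 h3 h4; apply/eqP; rewrite -normr_le0; apply/ler_addgt0Pr => r r0; rewrite add0r.
  have k0 : 0 < (y - x) * (z - y) * (z - x) by rewrite !mulr_gt0 // subr_gt0 // (lt_trans h2).
  pose A' : R := r / ((y - x) * (z - y) * (z - x)).
  have EA' : A' * ((y - x) * (z - y) * (z - x)) = r by rewrite /A' divfK // gt_eqF.
  have A'0 : 0 < A' by rewrite divr_gt0.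
  have aA t : `|t - x0| < e -> 0 < a t * (2 * A').
    by move=> td; apply: mulr_gt0; [apply: apos; exact: lt_trans td ed|rewrite mulr_gt0].
  rewrite ler_norml -EA'; apply/andP; split.
    apply: (@super_no_convex a H lam v g W F f A' x y z (fun=> erefl) hsup dW dF cf h2 h3) => t s txz sg.
    have td := ball3 h1 h4 txz.
    have [_ h5 _] := hp t (lt_trans td ed); rewrite (subgradient_derive sg h5) mulrDr fE //.
    by have := aA t td; lra.
  have dW' t : is_derive t 1 (fun t => - W t) (- F t) by exact: is_derive_opp.
  have dF' t : is_derive t 1 (fun t => - F t) (- f t) by exact: is_derive_opp.
  have cf' : continuous (fun t => - f t) by move=> t; apply: cvgN; exact: cf.
  have := @super_no_convex a _ (- lam) _ (fun t => - v t - - W t) _ _ _ A' x y z (fun=> erefl)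
    hsub' dW' dF' cf' h2 h3.
  move=> h; have {h} : - (A' * ((y - x) * (z - y) * (z - x))) <=
      (- v y - - W y - (- v x - - W x)) * (z - y) - (- v z - - W z - (- v y - - W y)) * (y - x).
    apply: h => t s txz sg; have td := ball3 h1 h4 txz.
    have [_ h5 _] := hp t (lt_trans td ed).
    rewrite (subgradient_derive sg (is_derive_opp h5)) opprK mulrDr mulrN fE //.
    by have := aA t td; lra.
  by rewrite /g => h; rewrite -lerN2; apply: le_trans h _; rewrite le_eqVlt; apply/orP; left; apply/eqP; ring.
pose x1 : R := x0 - e / 2; pose z1 : R := x0 + e / 2.
have [||be gE] := @affine_of_slopes g x1 z1; first by rewrite /x1 /z1; lra.
  by move=> y /andP[h1 h2]; apply: aff => //; rewrite /x1 /z1; lra.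
have dv y : `|y - x0| < e / 2 -> is_derive y 1 v (F y + be).
  move=> yd; apply: (@is_derive_near v (fun t => W t + (be * (t - x1) + g x1)) y _ (e / 2 - `|y - x0|)).
  - by rewrite subr_gt0.
  - move=> t ty; have td : `|t - x0| < e / 2.
      have -> : t - x0 = (t - y) + (y - x0) by ring.
      by apply: le_lt_trans (ler_normD _ _) _; rewrite -ltrBrDr.
    rewrite [be * _ + _]addrC -gE; last by move: td; rewrite ltr_norml /x1 /z1; lra.
    by rewrite /g addrC subrK.
  - by apply: is_derive_add => //; exact: is_derive_affine.
exists (e / 2); first by lra.
exists (fun y => F y + be) => y yd; split; first exact: dv.
have ye : `|y - x0| < e by apply: lt_trans yd _; lra.
have [_ h5 _] := hp y (lt_trans ye ed); have Ep := is_derive_unique h5 (dv y yd).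
have Ef : f y = (lam - H y (F y + be)) / a y.
  by rewrite /f /cl clampE ?Ep //; move: ye; rewrite ltr_norml; lra.
rewrite -Ef; apply: is_derive_eq (is_derive_add (dF y) (is_derive_const _ _)) _.
by rewrite addr0.
Qed.

Lemma visc_sol_C2 a H phat (lam : R) v x :
  continuous a -> hamiltonian H phat -> visc_sol a H lam v -> 0 < a x ->
  is_derive x 1 v (derive1 v x) /\
  is_derive x 1 (derive1 v) ((lam - H x (derive1 v x)) / a x).
Proof.
move=> ca hH hv ax; have [d d0 [q hq]] := visc_sol_local_C2 ca hH hv ax.
have qE y : `|y - x| < d -> derive1 v y = q y.
  by move=> /hq[h _]; exact: is_derive_derive1.
have xx : `|x - x| < d by rewrite subrr normr0.
rewrite (qE x xx); have [h1 h2] := hq x xx; split => //.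
exact: is_derive_near d0 qE h2.
Qed.

End Regularity.

(** * Derivatives at degenerate points *)

Section DegeneratePoints.
Variable R : realType.
Implicit Types (a u v w phi : R -> R) (G H : R -> R -> R) (x y z p q h t l r s : R).

Record diffusion (k : R) a : Prop := Diffusion {
  diff_k : 0 <= k;
  diff_ge0 : forall x, 0 <= a x;
  diff_cont : continuous a;
  diff_quad : forall x y, a y = 0 -> a x <= k * (x - y) ^+ 2;
  diff_comp : forall x, 0 < a x ->
    exists l r, [/\ l < x < r, a l = 0, a r = 0 & forall z, l < z < r -> 0 < a z] }.

Lemma diffusion_reflect (k : R) a : diffusion k a -> diffusion k (fun x => a (- x)).
Proof.
case=> k0 a0 ca qa comp; split => //.
- by move=> x; apply: (@continuous_comp _ _ _ (fun x => - x) a); [exact: oppr_continuous|exact: ca].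
- by move=> x y ay; have := qa (- x) (- y) ay; rewrite -opprD sqrrN.
- move=> x ax; have [l [r [lxr al ar hz]]] := comp _ ax.
  exists (- r), (- l); split; rewrite ?opprK //; first by lra.
  by move=> z zr; apply: hz; lra.
Qed.

Lemma diff_quad_at (k : R) a x0 : diffusion k a -> a x0 = 0 ->
  forall z, 0 <= a z <= k * (z - x0) ^+ 2.
Proof. by move=> ha a0 z; rewrite (diff_ge0 ha) (diff_quad ha). Qed.

Lemma ham_continuous H phat x p : hamiltonian H phat -> {for p, continuous (H x)}.
Proof.
move=> /ham_lip/(_ (`|p| + 1))[K K0 hK]; apply/continuous_forP => e e0.
exists (Num.min 1 (e / K)); first by rewrite lt_min ltr01 divr_gt0.
move=> q; rewrite lt_min => /andP[q1 q2].
have qB : `|q| <= `|p| + 1.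
  have -> : q = p + (q - p) by ring.
  by apply: le_trans (ler_normD _ _) _; lra.
apply: le_lt_trans (hK x x q p qB _) _; first by lra.
by rewrite subrr normr0 add0r mulrC -ltr_pdivlMr.
Qed.

(* [pplus H phat lam x p] characterises the right end [p] of [{q | H x q <= lam}]. *)
Definition pplus H (phat : R -> R) (lam : R) x p := phat x <= p /\ H x p = lam.

Lemma pplus_exists H phat (lam : R) x : hamiltonian H phat -> H x (phat x) <= lam ->
  exists p, pplus H phat lam x p.
Proof.
move=> hH hx; have [B B0 hB] := ham_coercive hH lam.
pose b := Num.max (phat x) B.
have b1 : phat x <= b by rewrite le_max lexx.
have Hb : lam < H x b.
  apply: hB; apply: le_trans (ler_norm _); by rewrite le_max lexx orbT.
have [||p + E] := @IVT R (H x) (phat x) b lam b1.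
- by apply: continuous_within_itv => t _; exact: ham_continuous hH.
- by rewrite ge_min le_max hx (ltW Hb) orbT.
by rewrite in_itv /= => /andP[h1 h2]; exists p; split.
Qed.

Lemma pplus_gt H phat (lam : R) x p q : hamiltonian H phat -> pplus H phat lam x p ->
  p < q -> lam < H x q.
Proof. by move=> hH [h1 <-] pq; exact: ham_incr hH _ _ _ h1 pq. Qed.

Lemma pplus_ge H phat (lam : R) x p q : hamiltonian H phat -> pplus H phat lam x p ->
  H x q <= lam -> q <= p.
Proof. by move=> hH hp; rewrite !leNgt; apply: contra; exact: pplus_gt hH hp. Qed.

Lemma pplus_lt H phat (lam : R) x p c q : hamiltonian H phat -> pplus H phat lam x p ->
  H x c < lam -> c <= q -> q < p -> H x q < lam.
Proof.
move=> hH [h1 <-] hc cq qp; have [qx|xq] := leP q (phat x); last first.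
  by apply: ham_incr hH _ _ _ (ltW xq) qp.
apply: le_lt_trans hc; move: cq; rewrite le_eqVlt => /predU1P[->//|cq].
by rewrite ltW //; exact: ham_decr hH _ _ _ cq qx.
Qed.

Lemma ham_incr_le H phat x p q : hamiltonian H phat -> phat x <= p -> p <= q -> H x p <= H x q.
Proof.
move=> hH h1; rewrite le_eqVlt => /predU1P[->//|pq].
by rewrite ltW //; exact: ham_incr hH _ _ _ h1 pq.
Qed.

Lemma ham_decr_le H phat x p q : hamiltonian H phat -> q <= phat x -> p <= q -> H x q <= H x p.
Proof.
move=> hH h1; rewrite le_eqVlt => /predU1P[->//|pq].
by rewrite ltW //; exact: ham_decr hH _ _ _ pq h1.
Qed.

Lemma ham_min H phat x p : hamiltonian H phat -> H x (phat x) <= H x p.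
Proof.
move=> hH; have [h|/ltW h] := leP p (phat x); first exact: ham_decr_le hH _ h.
exact: ham_incr_le hH _ h.
Qed.

Lemma level_left H phat (lam : R) x : hamiltonian H phat -> H x (phat x) <= lam ->
  exists2 p, p <= phat x & H x p = lam.
Proof.
move=> hH hx; have [|p [h1 h2]] := @pplus_exists _ _ lam (- x) (hamiltonian_reflect hH).
  by rewrite !opprK.
by exists (- p); rewrite opprK in h1 h2; [rewrite lerNl|].
Qed.

(** If every slope had H > mu, both secant lemmas would apply with any [c], and the same secants
    would be at most 0 and at least [h]. *)
Lemma super_min_le (k : R) a H phat (mu : R) w x0 : diffusion k a -> hamiltonian H phat ->
  visc_super a H mu w -> a x0 = 0 -> H x0 (phat x0) <= mu.
Proof.
move=> ha hH hw a0; rewrite leNgt; apply/negP => hlt.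
have qa := diff_quad_at ha a0.
pose th := H x0 (phat x0) - mu.
have th0 : 0 < th by rewrite subr_gt0.
have hp p : mu + th <= H x0 p by rewrite /th addrC subrK; exact: ham_min hH.
have [d1 d10 h1] := @super_secant_le R a H phat mu w k x0 (-1) 0 th hH (diff_k ha) qa hw
  (ltac:(lra)) th0 (fun p _ => hp p).
have [d2 d20 h2] := @super_secant_ge R a H phat mu w k x0 2 1 th hH (diff_k ha) qa hw
  (ltac:(lra)) th0 (fun p _ => hp p).
pose h := Num.min d1 d2 / 2.
have m0 : 0 < Num.min d1 d2 by rewrite lt_min d10.
have hd1 : h < d1 by have : Num.min d1 d2 <= d1 by [rewrite ge_min lexx]; rewrite /h; lra.
have hd2 : h < d2 by have : Num.min d1 d2 <= d2 by [rewrite ge_min lexx orbT]; rewrite /h; lra.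
have h0 : 0 < h by rewrite /h; lra.
have [] := h1 h (ltac:(rewrite h0//)); have [] := h2 h (ltac:(rewrite h0//)); lra.
Qed.

Lemma secants_is_derive v x0 p : (forall e : R, 0 < e -> exists2 d : R, 0 < d &
    forall h, 0 < h < d -> [/\ (p - e) * h <= v (x0 + h) - v x0, v (x0 + h) - v x0 <= (p + e) * h,
      (p - e) * h <= v x0 - v (x0 - h) & v x0 - v (x0 - h) <= (p + e) * h]) ->
  is_derive x0 1 v p.
Proof.
move=> hs; apply/is_deriveP => e e0; have [d d0 hd] := hs e e0; exists d => // y yd.
have [yx|xy|->] := ltgtP y x0; last by rewrite !subrr mulr0 subrr normr0 mulr0.
- have h0 : 0 < x0 - y by lra.
  have Ey : x0 - (x0 - y) = y by ring.
  have [|_ _] := hd (x0 - y); first by move: yd; rewrite ltr_norml; lra.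
  rewrite Ey [`|y - x0|]distrC (gtr0_norm h0) ler_norml; lra.
- have h0 : 0 < y - x0 by lra.
  have Ey : x0 + (y - x0) = y by ring.
  have [|h1 h2 _ _] := hd (y - x0); first by move: yd; rewrite ltr_norml; lra.
  by move: h1 h2; rewrite Ey (gtr0_norm h0) ler_norml; lra.
Qed.

Lemma super_secant_pplus (k : R) a H phat (mu : R) w x0 p (e : R) :
  diffusion k a -> hamiltonian H phat -> visc_super a H mu w -> a x0 = 0 ->
  pplus H phat mu x0 p -> 0 < e ->
  exists2 d : R, 0 < d &
    forall h, 0 < h < d -> w (x0 + h) - w x0 <= (p + e) * h /\ w x0 - w (x0 - h) <= (p + e) * h.
Proof.
move=> ha hH hw a0 hp e0.
have hlt := pplus_gt hH hp (ltac:(lra) : p < p + e / 2).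
apply: (@super_secant_le R a H phat mu w k x0 (p + e / 2) (p + e) (H x0 (p + e / 2) - mu) hH
  (diff_k ha) (diff_quad_at ha a0) hw); [lra|lra|].
move=> q hq; rewrite addrC subrK; apply: ham_incr_le hH _ hq; case: hp; lra.
Qed.

Lemma sub_secant_pplus (k : R) a H phat (lam : R) v x0 p c (e : R) :
  diffusion k a -> hamiltonian H phat -> visc_sub a H lam v -> a x0 = 0 ->
  pplus H phat lam x0 p -> H x0 c < lam -> 0 < e ->
  (exists2 d : R, 0 < d & forall h, 0 < h < d -> c * h <= v x0 - v (x0 - h)) ->
  exists2 d : R, 0 < d &
    forall h, 0 < h < d -> (p - e) * h <= v (x0 + h) - v x0 /\ (p - e) * h <= v x0 - v (x0 - h).
Proof.
move=> ha hH hv a0 hp hc e0 hsec.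
have cp : c < p.
  rewrite ltNge; apply/negP => pc; case: (hp) => h1 h2.
  by have := ham_incr_le hH h1 pc; lra.
have /continuous_forP/(_ (lam - H x0 c))[|d d0 hd] := @ham_continuous H phat x0 c hH; first by lra.
(* [e' <= p - c] keeps the target [p - e'] above the start [c]; [M <= e' / 2] keeps the top of the
   window below [p], and [M <= d / 2] keeps its bottom [c - M] strictly inside the sublevel set. *)
pose e' := Num.min e (p - c).
have e'e : e' <= e by rewrite ge_min lexx.
have e'c : e' <= p - c by rewrite ge_min lexx orbT.
have e'0 : 0 < e' by rewrite lt_min e0 subr_gt0.
pose M := Num.min (d / 2) (e' / 2).
have M1 : M <= d / 2 by rewrite ge_min lexx.
have M2 : M <= e' / 2 by rewrite ge_min lexx orbT.
have M0 : 0 < M by rewrite lt_min !divr_gt0.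
have hcM : H x0 (c - M) < lam.
  have := hd (c - M); rewrite addrAC subrr add0r normrN (gtr0_norm M0) => /(_ (ltac:(lra))).
  by rewrite ltr_norml; lra.
have hpM : H x0 (p - e' / 2) < lam by apply: (pplus_lt hH hp hc); lra.
pose th := lam - Num.max (H x0 (c - M)) (H x0 (p - e' / 2)).
have th0 : 0 < th by rewrite subr_gt0 gt_max hcM.
have [||d' d'0 hd'] := @sub_secant_ge R a H phat lam v k x0 c (p - e') M th hH (diff_k ha)
  (diff_quad_at ha a0) hv _ M0 th0 _ hsec.
- lra.
- move=> q hq; have -> : lam - th = Num.max (H x0 (c - M)) (H x0 (p - e' / 2)) by rewrite /th; ring.
  rewrite le_max; have [qx|/ltW xq] := leP q (phat x0); apply/orP; [left|right].
    by apply: (ham_decr_le hH qx); lra.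
  by apply: (ham_incr_le hH xq); lra.
exists d' => // h hh; have [h1 h2] := hd' h hh; case/andP: hh => h0 _.
have : (p - e) * h <= (p - e') * h by rewrite ler_pM2r //; lra.
by split; lra.
Qed.

Lemma secants_pplus (k : R) a H phat (lam : R) v x0 p c :
  diffusion k a -> hamiltonian H phat -> visc_sol a H lam v -> a x0 = 0 ->
  pplus H phat lam x0 p -> H x0 c < lam ->
  (exists2 d : R, 0 < d & forall h, 0 < h < d -> c * h <= v x0 - v (x0 - h)) ->
  is_derive x0 1 v p.
Proof.
move=> ha hH [hv1 hv2] a0 hp hc hsec; apply: secants_is_derive => e e0.
have [d1 d10 h1] := super_secant_pplus ha hH hv1 a0 hp e0.
have [d2 d20 h2] := sub_secant_pplus ha hH hv2 a0 hp hc e0 hsec.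
exists (Num.min d1 d2); first by rewrite lt_min d10.
move=> h; rewrite lt_min => /and3P[h0 hd1 hd2].
by have [] := h1 h (ltac:(rewrite h0//)); have [] := h2 h (ltac:(rewrite h0//)); split.
Qed.

(** Slopes up to [c1] lie above level [lam0], so the left secants of u are at least [c2 < c1] near
    [x0], and monotonicity of v - u passes this on to v. Since [c2] has a level strictly between
    [lam0] and [lam], the secants of v start strictly inside the sublevel set and climb to p^+. *)
Lemma derive_at_degenerate (k : R) a H phat (lam0 lam : R) u v x0 p :
  diffusion k a -> hamiltonian H phat -> lam0 < lam ->
  visc_super a H lam0 u -> visc_sol a H lam v ->
  (forall x y, x <= y -> v x - u x <= v y - u y) -> a x0 = 0 ->
  pplus H phat lam x0 p -> is_derive x0 1 v p.
Proof.
move=> ha hH ll hu hv hmon a0 hp.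
have hmin := super_min_le ha hH hu a0.
have [c1 c1x Hc1] := @level_left H phat ((lam0 + lam) / 2) x0 hH (ltac:(lra)).
have [c2 c2x Hc2] := @level_left H phat ((lam0 + 3 * lam) / 4) x0 hH (ltac:(lra)).
have c21 : c2 < c1.
  by rewrite ltNge; apply/negP => h; have := ham_decr_le hH c2x h; lra.
apply: (secants_pplus ha hH hv a0 hp (c := c2)); first by lra.
have [||d d0 hd] := @super_secant_ge R a H phat lam0 u k x0 c1 c2 ((lam - lam0) / 2) hH
  (diff_k ha) (diff_quad_at ha a0) hu c21; first by lra.
  by move=> q qc; have := ham_decr_le hH c1x qc; lra.
exists d => // h hh; have [_ h1] := hd h hh.
by have := hmon (x0 - h) x0 (ltac:(lra)); lra.
Qed.

(** If a left secant below [c] were followed by a longer one above [c], a line of slope [c] would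
    touch v from above in between, giving H(z, c) >= lam. *)
Lemma left_secant_persist a H (lam : R) v x0 c (d : R) : visc_sub a H lam v ->
  (forall z, `|z - x0| < d -> H z c < lam) ->
  forall h h', 0 < h -> h < h' -> h' < d -> v x0 - v (x0 - h) < c * h ->
  v x0 - v (x0 - h') <= c * h'.
Proof.
move=> /visc_subE hv hc h h' h0 hh hd hlt; rewrite leNgt; apply/negP => hgt.
have [|||z [zx _]] := @super_quadratic R a _ (- lam) _ 0 (- c) x0 (x0 - h') x0 (x0 - h) hv.
- lra.
- lra.
- lra.
rewrite !mulr0 mul0r !add0r opprK lerN2 => hz.
have := hc z; rewrite ltr_norml => /(_ (ltac:(lra))); lra.
Qed.

Lemma left_secant_dichotomy H phat a (lam : R) v x0 c : hamiltonian H phat ->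
  visc_sub a H lam v -> H x0 c < lam ->
  (exists2 d : R, 0 < d & forall h, 0 < h < d -> c * h <= v x0 - v (x0 - h)) \/
  (exists2 d : R, 0 < d & forall h, 0 < h < d -> v x0 - v (x0 - h) <= c * h).
Proof.
move=> hH hv hc.
have [d d0 hd] := @ham_near R H phat x0 `|c| ((lam - H x0 c) / 2) hH (ltac:(lra)).
have hcz z : `|z - x0| < d -> H z c < lam.
  by move=> zd; have := hd z c zd (lexx _); rewrite ltr_norml; lra.
have [hl|hl] := pselect (exists2 d : R, 0 < d & forall h, 0 < h < d -> c * h <= v x0 - v (x0 - h)).
  by left.
right; exists d => // h /andP[h0 hd']; apply: contrapT => hn; apply: hl.
exists h => // h1 /andP[h10 h1h]; rewrite leNgt; apply/negP => hlt; apply: hn.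
exact: left_secant_persist hv hcz _ _ h10 h1h hd' hlt.
Qed.

(** If min H(x0, .) = mu, the two roots coincide and squeeze the secants. Otherwise the dichotomy is
    used on the left with [phat x0] and, by reflection, on the right with a slightly larger [c2]:
    either one lets the secants run to p^+ or p^-, or both fail and leave a corner, whose gap comes
    from using two different slopes. *)
Lemma derive_or_kink (k : R) a H phat (mu : R) u x0 :
  diffusion k a -> hamiltonian H phat -> visc_sol a H mu u -> a x0 = 0 ->
  (exists2 p, is_derive x0 1 u p & H x0 p <= mu) \/ kink u x0.
Proof.
move=> ha hH hu a0; have hmin := super_min_le ha hH hu.1 a0.
have haR := diffusion_reflect ha; have hHR := hamiltonian_reflect hH.
have huR : visc_sol (fun x => a (- x)) (fun x p => H (- x) (- p)) mu (fun x => u (- x)).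
  by case: hu => h1 h2; split; [exact: visc_super_reflect|exact: visc_sub_reflect].
have a0R : a (- - x0) = 0 by rewrite opprK.
have [p hp] := pplus_exists hH hmin.
have hminR : H (- - x0) (- - phat (- - x0)) <= mu by rewrite !opprK.
have [q hq] := pplus_exists hHR hminR.
move: hmin; rewrite le_eqVlt => /predU1P[E|hmin].
  left; exists p; last by case: hp => _ ->.
  have pE : p = phat x0.
    case: (hp) => h1 h2; apply/eqP; rewrite eq_le h1 andbT leNgt; apply/negP => hlt.
    by have := ham_incr hH (lexx _) hlt; lra.
  have qE : q = - p.
    case: (hq) => h1 h2; rewrite !opprK in h1 h2; rewrite pE.
    apply/eqP; rewrite eq_le h1 andbT leNgt; apply/negP => hlt.
    by have := ham_decr hH (ltac:(lra) : - q < phat x0) (lexx _); lra.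
  apply: secants_is_derive => e e0.
  have [d1 d10 h1] := super_secant_pplus ha hH hu.1 a0 hp e0.
  have [d2 d20 h2] := super_secant_pplus haR hHR huR.1 a0R hq e0.
  exists (Num.min d1 d2); first by rewrite lt_min d10.
  move=> h; rewrite lt_min => /and3P[h0 hd1 hd2].
  have [] := h1 h (ltac:(rewrite h0//)); have [] := h2 h (ltac:(rewrite h0//)).
  rewrite qE !opprD !opprK => ? ? ? ?; split => //; lra.
have /continuous_forP/(_ (mu - H x0 (phat x0)))[|d d0 hd] := @ham_continuous H phat x0 (phat x0) hH.
  by rewrite subr_gt0.
pose c2 := phat x0 + d / 2.
have Hc2 : H x0 c2 < mu.
  have := hd c2; rewrite /c2 addrAC subrr add0r gtr0_norm; last by lra.
  by move=> /(_ (ltac:(lra))); rewrite ltr_norml; lra.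
have [hl|[d1 d10 h1]] := left_secant_dichotomy hH hu.2 hmin.
  by left; exists p; [exact: secants_pplus ha hH hu a0 hp hmin hl|case: hp => _ ->].
have Hc2R : H (- - x0) (- - c2) < mu by rewrite !opprK.
have [hl|[d2 d20 h2]] := left_secant_dichotomy hHR huR.2 Hc2R.
  left; exists (- q); last by case: hq => _; rewrite opprK => ->.
  have := secants_pplus haR hHR huR a0R hq Hc2R hl.
  move=> /is_derive_reflect.
  have -> : (fun y => u (- - y)) = u by apply/funext => y; rewrite opprK.
  by [].
right; exists (phat x0), c2, (Num.min d1 d2); split.
- by rewrite /c2; lra.
- by rewrite lt_min d10.
- move=> h; rewrite lt_min => /and3P[h0 hd1 hd2]; split; first by apply: h1; rewrite h0.
  by have := h2 h (ltac:(rewrite h0//)); rewrite [- (- x0 - h)]opprD !opprK; lra.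
Qed.

End DegeneratePoints.

(** * Comparison for the slope equation *)

Section ODE.
Variable R : realType.
Implicit Types (a u v w phi : R -> R) (G H : R -> R -> R) (x y z p q h t l r s : R).

Lemma MVT_open (f df : R -> R) (a b : R) : a < b ->
  (forall x, a < x < b -> is_derive x 1 f (df x)) ->
  (forall x, a <= x <= b -> {for x, continuous f}) ->
  exists2 c, a < c < b & f b - f a = df c * (b - a).
Proof.
move=> ab h cf.
have h' x : x \in `]a, b[ -> is_derive x 1 f (df x) by rewrite in_itv /=; exact: h.
have [c cab E] := MVT ab h' (continuous_within_itv cf).
by exists c => //; move: cab; rewrite in_itv.
Qed.

Lemma bounded_itv (f : R -> R) s t : s <= t ->
  (forall x, s <= x <= t -> {for x, continuous f}) ->
  exists2 B : R, 0 <= B & forall x, s <= x <= t -> `|f x| <= B.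
Proof.
move=> st cf; have [m _ hm] := EVT_min_itv st cf.
have [x xst|M _ hM] := @EVT_min_itv R (fun x => - f x) s t st.
  by apply: cvgN; exact: cf.
exists (`|f m| + `|f M|); first by rewrite addr_ge0.
move=> x xst; have := hm x xst; have := hM x xst; rewrite ler_norml.
have := ler_norm (f M); have := ler_norm (- f m); rewrite normrN.
have := normr_ge0 (f m); have := normr_ge0 (f M); lra.
Qed.

Lemma positive_itv (f : R -> R) s t : s <= t ->
  (forall x, s <= x <= t -> {for x, continuous f}) -> (forall x, s <= x <= t -> 0 < f x) ->
  exists2 m : R, 0 < m & forall x, s <= x <= t -> m <= f x.
Proof. by move=> st cf f0; have [c cst hc] := EVT_min_itv st cf; exists (f c); [exact: f0|]. Qed.

(** [K] depends on the interval and on [B] and is fixed before the two slopes, so that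
    [upper_slope_local] can choose the initial error [e] in terms of it. *)
Lemma ode_gronwall a H phat (lam B s t : R) : continuous a -> hamiltonian H phat -> s <= t ->
  (forall x, s <= x <= t -> 0 < a x) ->
  exists K : R, forall (y1 dy1 y2 dy2 : R -> R) (e : R), 0 <= e ->
    (forall x, s <= x <= t -> is_derive x 1 y1 (dy1 x)) ->
    (forall x, s <= x <= t -> is_derive x 1 y2 (dy2 x)) ->
    (forall x, s <= x <= t -> dy1 x <= (lam - H x (y1 x)) / a x) ->
    (forall x, s <= x <= t -> (lam - H x (y2 x)) / a x <= dy2 x) ->
    (forall x, s <= x <= t -> `|y1 x| <= B) -> (forall x, s <= x <= t -> `|y2 x| <= B) ->
    y1 s <= y2 s + e ->
    forall x, s <= x <= t -> y1 x <= y2 x + e * (expR (- K * s) * expR (K * x)).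
Proof.
move=> ca hH st a0; have [K' K'0 hK] := ham_lip hH B.
have [|m m0 hm] := @positive_itv a s t st _ a0; first by move=> x _; exact: ca.
exists (K' / m) => y1 dy1 y2 dy2 e e0 h1 h2 hd1 hd2 hB1 hB2 hs x /andP[sx xt].
set K := K' / m; have K0 : 0 <= K by rewrite divr_ge0 // ltW.
pose E z := expR (- K * s) * expR (K * z).
have E0 z : 0 <= E z by rewrite mulr_ge0 ?expR_ge0.
have Es : E s = 1 by rewrite /E -expRD mulNr addNr expR0.
have sub z : s <= z <= x -> s <= z <= t by move=> /andP[-> zx]; rewrite (le_trans zx).
have dE z : is_derive z 1 E (K * E z).
  apply: is_derive_eq (is_derive_scale _ (is_derive_expR_affine K z)) _.
  by rewrite /E mulrCA.
have : 0 <= y2 x + e * E x - y1 x.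
  apply: (@barrier R (fun z => y2 z + e * E z - y1 z) (fun z => dy2 z + e * (K * E z) - dy1 z) K s x sx).
  - move=> z /sub zst; apply: is_derive_sub (h1 z zst).
    exact: is_derive_add (h2 z zst) (is_derive_scale e (dE z)).
  - by rewrite Es mulr1; lra.
  - move=> z /sub zst hz.
    have az := a0 z zst; have mz := hm z zst.
    have eE : 0 <= e * E z by rewrite mulr_ge0.
    have y12 : 0 <= y1 z - y2 z by lra.
    have hH12 : H z (y2 z) - H z (y1 z) <= K' * (y1 z - y2 z).
      have := hK z z (y2 z) (y1 z) (hB2 z zst) (hB1 z zst).
      rewrite subrr normr0 add0r [`|y2 z - y1 z|]distrC (ger0_norm y12); apply: le_trans.
      exact: ler_norm.
    have k1 : (lam - H z (y1 z)) / a z - (lam - H z (y2 z)) / a z <= K * (y1 z - y2 z).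
      rewrite -mulrBl ler_pdivrMr //.
      apply: (@le_trans _ _ (K' * (y1 z - y2 z))); first by lra.
      rewrite [leRHS]mulrAC ler_wpM2r // /K mulrAC ler_pdivlMr //.
      by rewrite ler_pM2l.
    have := hd1 z zst; have := hd2 z zst.
    have -> : e * (K * E z) = K * (e * E z) by ring.
    lra.
rewrite /E; lra.
Qed.

Lemma ode_compare a H phat (lam : R) (y1 dy1 y2 dy2 : R -> R) s t :
  continuous a -> hamiltonian H phat -> s <= t -> (forall x, s <= x <= t -> 0 < a x) ->
  (forall x, s <= x <= t -> is_derive x 1 y1 (dy1 x)) ->
  (forall x, s <= x <= t -> is_derive x 1 y2 (dy2 x)) ->
  (forall x, s <= x <= t -> dy1 x <= (lam - H x (y1 x)) / a x) ->
  (forall x, s <= x <= t -> (lam - H x (y2 x)) / a x <= dy2 x) ->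
  y1 s <= y2 s -> y1 t <= y2 t.
Proof.
move=> ca hH st a0 h1 h2 hd1 hd2 hs.
have [|B1 B10 hB1] := @bounded_itv y1 s t st; first by move=> x /h1/is_derive_continuous.
have [|B2 B20 hB2] := @bounded_itv y2 s t st; first by move=> x /h2/is_derive_continuous.
have [K hK] := @ode_gronwall a H phat lam (B1 + B2) s t ca hH st a0.
have := hK y1 dy1 y2 dy2 0 (lexx _) h1 h2 hd1 hd2.
rewrite addr0 => h; rewrite -[y2 t]addr0 -(mul0r (expR (- K * s) * expR (K * t))).
apply: h => //; last by rewrite st lexx.
- by move=> x /hB1 hx; apply: le_trans hx _; rewrite lerDl.
- by move=> x /hB2 hx; apply: le_trans hx _; rewrite lerDr.
Qed.

Definition ode_sol a H (lam : R) s t (y : R -> R) :=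
  forall x, s <= x <= t -> is_derive x 1 y ((lam - H x (y x)) / a x).

Lemma ode_sol_le a H phat (lam : R) (y1 y2 : R -> R) s t :
  continuous a -> hamiltonian H phat -> s <= t -> (forall x, s <= x <= t -> 0 < a x) ->
  ode_sol a H lam s t y1 -> ode_sol a H lam s t y2 -> y1 s <= y2 s -> y1 t <= y2 t.
Proof.
move=> ca hH st a0 h1 h2 hs.
exact: ode_compare ca hH st a0 h1 h2 (fun _ _ => lexx _) (fun _ _ => lexx _) hs.
Qed.

Lemma ode_ge_const a H phat (lam c : R) (y : R -> R) s t :
  continuous a -> hamiltonian H phat -> s <= t -> (forall x, s <= x <= t -> 0 < a x) ->
  ode_sol a H lam s t y -> (forall x, s <= x <= t -> H x c <= lam) -> c <= y s -> c <= y t.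
Proof.
move=> ca hH st a0 h1 hc hs.
apply: (@ode_compare a H phat lam (fun=> c) (fun=> 0) y _ s t ca hH st a0
  (fun x _ => is_derive_const c x) h1 _ _ hs).
- by move=> x xst; rewrite divr_ge0 ?subr_ge0 ?hc // ltW // a0.
- by move=> x _; exact: lexx.
Qed.

Lemma ode_le_const a H phat (lam c : R) (y : R -> R) s t :
  continuous a -> hamiltonian H phat -> s <= t -> (forall x, s <= x <= t -> 0 < a x) ->
  ode_sol a H lam s t y -> (forall x, s <= x <= t -> lam <= H x c) -> y s <= c -> y t <= c.
Proof.
move=> ca hH st a0 h1 hc hs.
apply: (@ode_compare a H phat lam y _ (fun=> c) (fun=> 0) s t ca hH st a0 h1
  (fun x _ => is_derive_const c x) _ _ hs).
- by move=> x _; exact: lexx.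
- move=> x xst; rewrite -oppr_ge0 -mulNr divr_ge0 //; last by rewrite ltW // a0.
  by rewrite opprB subr_ge0 hc.
Qed.

Lemma sub_ode_sol a H (lam : R) s t s' t' (y : R -> R) : s <= s' -> t' <= t ->
  ode_sol a H lam s t y -> ode_sol a H lam s' t' y.
Proof. by move=> h1 h2 h x /andP[h3 h4]; apply: h; rewrite (le_trans h1) ?(le_trans h4). Qed.

(** Otherwise H z would decrease from [c'] to [c] while H x0 increases there by a fixed amount. This
    is upper semicontinuity of [phat]. *)
Lemma ham_incr_near H phat x0 c : hamiltonian H phat -> phat x0 < c ->
  exists2 d : R, 0 < d & forall z, `|z - x0| < d -> phat z <= c.
Proof.
move=> hH hc; pose c' := (phat x0 + c) / 2.
have hlt : H x0 c' < H x0 c by apply: (ham_incr hH); rewrite /c'; lra.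
have th0 : 0 < (H x0 c - H x0 c') / 2 by lra.
have [d d0 hd] := @ham_near R H phat x0 (`|c| + `|c'|) _ hH th0.
exists d => // z zd; rewrite leNgt; apply/negP => hz.
have := hd z c zd (ltac:(rewrite lerDl//)); have := hd z c' zd (ltac:(rewrite lerDr//)).
have : H z c < H z c' by apply: (ham_decr hH _ (ltW hz)); rewrite /c'; lra.
rewrite !ltr_norml; lra.
Qed.

Lemma upper_branch_near H phat (lam : R) l p : hamiltonian H phat ->
  H l (phat l) < lam -> pplus H phat lam l p ->
  exists c d : R, [/\ c < p, 0 < d &
    forall z, l <= z -> z < l + d -> H z c <= lam /\ phat z <= c].
Proof.
move=> hH hmin hp.
have php : phat l < p.
  case: (hp) => h1 h2; rewrite lt_neqAle h1 andbT; apply/eqP => E.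
  by move: h2; rewrite -E => h2; move: hmin; rewrite h2 ltxx.
pose c := (phat l + p) / 2.
have cp : c < p by rewrite /c; lra.
have pc : phat l < c by rewrite /c; lra.
have Hc : H l c < lam by case: (hp) => _ <-; apply: (ham_incr hH) => //; exact: ltW.
have [e1 e10 he1] := ham_incr_near hH pc.
have [e2 e20 he2] := @ham_near R H phat l `|c| (lam - H l c) hH (ltac:(lra)).
exists c, (Num.min e1 e2); split => //; first by rewrite lt_min e10.
move=> z lz; rewrite -ltrBlDl lt_min => /andP[z1 z2].
have zl : `|z - l| = z - l by rewrite ger0_norm // subr_ge0.
split; last by apply: he1; rewrite zl.
by have := he2 z c; rewrite zl => /(_ z2 (lexx _)); rewrite ltr_norml; lra.
Qed.

(** Differentiability at [l] gives, through the mean value theorem, only some points near [l] with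
    slope close to [m], not a limit of [q]; forward comparison from such points supplies the
    rest. *)
Lemma mean_slope_near v (q : R -> R) l r (m e z : R) :
  (forall z, l < z < r -> is_derive z 1 v (q z)) -> is_derive l 1 v m -> 0 < e ->
  l < z < r -> exists2 xi, l < xi < z & `|q xi - m| <= e.
Proof.
move=> hv dv e0 /andP[lz zr]; have /is_deriveP/(_ _ e0)[s s0 hs] := dv.
pose t := Num.min s (z - l) / 2.
have m0 : 0 < Num.min s (z - l) by rewrite lt_min s0 subr_gt0.
have m1 : Num.min s (z - l) <= s by rewrite ge_min lexx.
have m2 : Num.min s (z - l) <= z - l by rewrite ge_min lexx orbT.
have t0 : 0 < t by rewrite /t; lra.
have ts : t < s by rewrite /t; lra.
have tz : t < z - l by rewrite /t; lra.
have [|||xi /andP[x1 x2] E] := @MVT_open v q l (l + t).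
- by rewrite ltrDl.
- by move=> x hx; apply: hv; lra.
- move=> x /andP[]; rewrite le_eqVlt => /predU1P[<- _|lx xt].
    exact: is_derive_continuous dv.
  by apply: (@is_derive_continuous _ _ _ (q x)); apply: hv; lra.
exists xi; first by lra.
have E1 : l + t - l = t by ring.
have := hs (l + t); rewrite E1 (gtr0_norm t0) => /(_ ts).
by rewrite E E1 -mulrBl normrM (gtr0_norm t0) ler_pM2r.
Qed.

(** Beyond [phat] a larger slope has a larger H and grows more slowly, so the gap cannot come to
    exceed [e]. No constant depending on [a] appears, so the bound survives as [s] tends to an end
    of the component. *)
Lemma slope_contract a H phat (lam e : R) (q1 q2 : R -> R) s t :
  hamiltonian H phat -> s <= t -> (forall x, s <= x <= t -> 0 < a x) -> 0 <= e ->
  ode_sol a H lam s t q1 -> ode_sol a H lam s t q2 ->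
  (forall x, s <= x <= t -> phat x <= q2 x) -> q1 s <= q2 s + e -> q1 t <= q2 t + e.
Proof.
move=> hH st apos e0 h1 h2 hp hs; rewrite -subr_ge0.
pose dq x := (lam - H x (q1 x)) / a x - (lam - H x (q2 x)) / a x.
have -> : q2 t + e - q1 t = e - (q1 t - q2 t) by ring.
apply: (@barrier R (fun x => e - (q1 x - q2 x)) (fun x => 0 - dq x) 0 s t st).
- by move=> x xst; exact: is_derive_sub (is_derive_const e x) (is_derive_sub (h1 x xst) (h2 x xst)).
- by lra.
- move=> x xst hx; rewrite mul0r /dq -mulrBl sub0r -mulNr.
  apply: divr_ge0; last by rewrite ltW // apos.
  have : H x (q2 x) <= H x (q1 x) by apply: (ham_incr_le hH (hp x xst)); lra.
  by lra.
Qed.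

(* Near the left end [l] of a component both slopes lie where [H z] increases, so their distance
   decreases in [z]; differentiability at [l] makes it arbitrarily small on points tending to [l]. *)
Lemma slope_unique_near (k : R) a H phat (lam : R) v1 v2 (q1 q2 : R -> R) l r p :
  diffusion k a -> hamiltonian H phat -> l < r -> (forall z, l < z < r -> 0 < a z) ->
  (forall z, l < z < r -> is_derive z 1 v1 (q1 z)) ->
  (forall z, l < z < r -> is_derive z 1 v2 (q2 z)) ->
  (forall z, l < z < r -> is_derive z 1 q1 ((lam - H z (q1 z)) / a z)) ->
  (forall z, l < z < r -> is_derive z 1 q2 ((lam - H z (q2 z)) / a z)) ->
  H l (phat l) < lam -> pplus H phat lam l p -> is_derive l 1 v1 p -> is_derive l 1 v2 p ->
  exists2 d : R, 0 < d & forall z, l < z < r -> z < l + d -> q1 z = q2 z.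
Proof.
move=> ha hH lr apos hv1 hv2 hq1 hq2 hmin hp d1 d2.
have ca := diff_cont ha.
have [c [d [cp d0 hcd]]] := upper_branch_near hH hmin hp.
have sub s t : l < s -> t < r -> forall x, s <= x <= t -> l < x < r.
  by move=> h1 h2 x /andP[h3 h4]; rewrite (lt_le_trans h1) ?(le_lt_trans h4).
have near s t x : l < s -> t < l + d -> s <= x <= t -> l <= x /\ x < l + d.
  by move=> ls td /andP[h1 h2]; rewrite ltW ?(lt_le_trans ls) // (le_lt_trans h2).
have lower (v q : R -> R) : (forall z, l < z < r -> is_derive z 1 v (q z)) ->
    (forall z, l < z < r -> is_derive z 1 q ((lam - H z (q z)) / a z)) -> is_derive l 1 v p ->
    forall z, l < z < r -> z < l + d -> c <= q z.
  move=> hv hq dv z zlr zd.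
  have [xi /andP[x1 x2] hxi] := mean_slope_near hv dv (ltac:(rewrite subr_gt0//) : 0 < p - c) zlr.
  case/andP: zlr => lz zr.
  apply: (@ode_ge_const a H phat lam c q xi z ca hH (ltW x2)).
  - by move=> x /(sub xi z x1 zr); exact: apos.
  - by move=> x /(sub xi z x1 zr); exact: hq.
  - by move=> x /(near xi z x x1 zd)[h1 h2]; exact: (hcd x h1 h2).1.
  - by move: hxi; rewrite ler_norml lerNl opprB lerD2l lerN2 => /andP[].
have half (w1 w2 g1 g2 : R -> R) : (forall z, l < z < r -> is_derive z 1 w1 (g1 z)) ->
    (forall z, l < z < r -> is_derive z 1 w2 (g2 z)) ->
    (forall z, l < z < r -> is_derive z 1 g1 ((lam - H z (g1 z)) / a z)) ->
    (forall z, l < z < r -> is_derive z 1 g2 ((lam - H z (g2 z)) / a z)) ->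
    is_derive l 1 w1 p -> is_derive l 1 w2 p ->
    (forall z, l < z < r -> z < l + d -> c <= g2 z) ->
    forall z, l < z < r -> z < l + d -> g1 z <= g2 z.
  move=> hw1 hw2 hg1 hg2 dw1 dw2 cg z zlr zd; apply/ler_addgt0Pr => e e0.
  have hw z' : l < z' < r -> is_derive z' 1 (fun x => w1 x - w2 x) (g1 z' - g2 z').
    by move=> hz'; exact: is_derive_sub (hw1 z' hz') (hw2 z' hz').
  have [xi /andP[x1 x2]] := mean_slope_near hw (is_derive_sub dw1 dw2) e0 zlr.
  rewrite subrr subr0 ler_norml => /andP[_ hxi].
  case/andP: zlr => lz zr.
  apply: (@slope_contract a H phat lam e g1 g2 xi z hH (ltW x2)).
  - by move=> x /(sub xi z x1 zr); exact: apos.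
  - exact: ltW.
  - by move=> x /(sub xi z x1 zr); exact: hg1.
  - by move=> x /(sub xi z x1 zr); exact: hg2.
  - move=> x xz; have xlr := sub xi z x1 zr x xz; have [h1 h2] := near xi z x x1 zd xz.
    by apply: le_trans (cg x xlr h2); exact: (hcd x h1 h2).2.
  - by rewrite addrC -lerBlDr.
exists d => // z zlr zd; apply/eqP; rewrite eq_le.
have c1 := lower _ _ hv1 hq1 d1; have c2 := lower _ _ hv2 hq2 d2.
by rewrite (half v1 v2 q1 q2) //= (half v2 v1 q2 q1).
Qed.

Lemma slope_unique (k : R) a H phat (lam : R) v1 v2 (q1 q2 pp : R -> R) :
  diffusion k a -> hamiltonian H phat ->
  (forall z, 0 < a z -> is_derive z 1 v1 (q1 z)) ->
  (forall z, 0 < a z -> is_derive z 1 v2 (q2 z)) ->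
  (forall z, 0 < a z -> is_derive z 1 q1 ((lam - H z (q1 z)) / a z)) ->
  (forall z, 0 < a z -> is_derive z 1 q2 ((lam - H z (q2 z)) / a z)) ->
  (forall z, a z = 0 -> [/\ H z (phat z) < lam, pplus H phat lam z (pp z),
     is_derive z 1 v1 (pp z) & is_derive z 1 v2 (pp z)]) ->
  forall x, 0 < a x -> q1 x = q2 x.
Proof.
move=> ha hH hv1 hv2 hq1 hq2 h0 x ax.
have [l [r [/andP[lx xr] al ar apos]]] := diff_comp ha ax.
have ca := diff_cont ha; have [hmin hp d1 d2] := h0 l al.
have [d d0 hd] := @slope_unique_near k a H phat lam v1 v2 q1 q2 l r (pp l) ha hH
  (lt_trans lx xr) apos (fun z hz => hv1 z (apos z hz)) (fun z hz => hv2 z (apos z hz))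
  (fun z hz => hq1 z (apos z hz)) (fun z hz => hq2 z (apos z hz)) hmin hp d1 d2.
pose s := l + Num.min (d / 2) (x - l).
have m0 : 0 < Num.min (d / 2) (x - l) by rewrite lt_min divr_gt0 // subr_gt0.
have m1 : Num.min (d / 2) (x - l) <= d / 2 by rewrite ge_min lexx.
have m2 : Num.min (d / 2) (x - l) <= x - l by rewrite ge_min lexx orbT.
have sx : s <= x by rewrite /s; lra.
have E : q1 s = q2 s by apply: hd; rewrite /s; lra.
have pos z : s <= z <= x -> 0 < a z by move=> hz; apply: apos; rewrite /s in hz; lra.
apply/eqP; rewrite eq_le.
rewrite (@ode_sol_le a H phat lam q1 q2 s x) ?E //=; first last.
- by move=> z /pos; exact: hq2.
- by move=> z /pos; exact: hq1.
apply: (@ode_sol_le a H phat lam q2 q1 s x) => //; last by rewrite E.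
- by move=> z /pos; exact: hq2.
- by move=> z /pos; exact: hq1.
Qed.

End ODE.

(** * Existence for the slope equation *)

Section Existence.
Variable R : realType.
Implicit Types (a u v w phi : R -> R) (G H : R -> R -> R) (x z p q h t l r s : R).

Lemma dist_clamp_le (lo hi x z : R) :
  `|Num.max (Num.min z hi) lo - Num.max (Num.min x hi) lo| <= `|z - x|.
Proof. by apply: le_trans (max_dist_le _ _ _) (min_dist_le _ _ _). Qed.

(** Clamping x to [s, t] and the slope to [-P, P] makes the field bounded and Lipschitz, as [picard]
    requires. The constant [P], where the drift is negative, and [p0], a solution at a level not
    above [lam], then confine the solution, so that the clamps are inactive. *)
Lemma ode_exists a H phat (lam0 lam P y0 : R) (p0 : R -> R) s t :
  continuous a -> hamiltonian H phat -> lam0 <= lam -> s <= t ->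
  (forall x, s <= x <= t -> 0 < a x) -> ode_sol a H lam0 s t p0 ->
  (forall x, s <= x <= t -> - P <= p0 x <= P) -> (forall x, lam < H x P) -> p0 s <= y0 <= P ->
  exists Y : R -> R, [/\ Y s = y0, ode_sol a H lam s t Y & forall x, s <= x <= t -> p0 x <= Y x <= P].
Proof.
move=> ca hH ll st a0 hp0 hb hP /andP[y01 y02].
have P0 : 0 <= P by have := hb s (ltac:(rewrite lexx//)); lra.
have [|m m0 hm] := @positive_itv R a s t st _ a0; first by move=> x _; exact: ca.
have [K' K'0 hK] := ham_lip hH P.
pose cl x := Num.max (Num.min x t) s; pose cp p := Num.max (Num.min p P) (- P).
have clst x : s <= cl x <= t by exact: clamp_itv.
have cpP p : `|cp p| <= P by rewrite ler_norml; apply: clamp_itv; lra.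
have clE x : s <= x <= t -> cl x = x by exact: clampE.
have acl x : 0 < a (cl x) by exact: a0.
pose F x y := (lam - H (cl x) (cp y)) / a (cl x).
pose K := K' / m.
have K0 : 0 <= K by rewrite divr_ge0 // ltW.
have FK x p q : `|F x p - F x q| <= (K + 1) * `|p - q|.
  have h : `|F x p - F x q| <= K * `|p - q|.
    rewrite /F -mulrBl normrM normfV (gtr0_norm (acl x)) ler_pdivrMr //.
    have -> : lam - H (cl x) (cp p) - (lam - H (cl x) (cp q)) = - (H (cl x) (cp p) - H (cl x) (cp q)) by ring.
    rewrite normrN; apply: le_trans (hK _ _ _ _ (cpP p) (cpP q)) _; rewrite subrr normr0 add0r.
    apply: (@le_trans _ _ (K' * `|p - q|)); first by rewrite ler_pM2l //; exact: dist_clamp_le.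
    rewrite [leRHS]mulrAC ler_wpM2r // /K mulrAC ler_pdivlMr // ler_pM2l //; exact: hm.
  by apply: le_trans h _; rewrite ler_wpM2r //; lra.
pose B := (`|lam| + `|H s 0| + K' * (t - s + P)) / m.
have FB x p : `|F x p| <= B.
  rewrite /F normrM normfV (gtr0_norm (acl x)) /B.
  have h1 : `|lam - H (cl x) (cp p)| <= `|lam| + `|H s 0| + K' * (t - s + P).
    have -> : lam - H (cl x) (cp p) = lam - H s 0 - (H (cl x) (cp p) - H s 0) by ring.
    apply: le_trans (ler_normB _ _) _; apply: lerD; first exact: ler_normB.
    apply: le_trans (hK _ _ _ _ (cpP p) _) _; first by rewrite normr0.
    rewrite subr0 ler_pM2l // lerD ?cpP //.
    by have /andP[h1 h2] := clst x; rewrite ger0_norm ?subr_ge0 // lerD2r.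
  apply: ler_pM => //; first by rewrite invr_ge0 ltW.
  by rewrite lef_pV2 ?posrE ?acl //; exact: hm.
have cF p : continuous (F ^~ p).
  move=> x; rewrite /F.
  have ccl : {for x, continuous cl} by exact: clamp_continuous.
  have h1 : {for x, continuous (fun y => H (cl y) (cp p))}.
    apply: (@continuous_comp _ _ _ cl (fun z => H z (cp p))); first exact: ccl.
    by apply: (ham_comp_continuous (p := fun=> cp p) hH); exact: cvg_cst.
  have h2 : {for x, continuous (fun y => a (cl y))}.
    by apply: (@continuous_comp _ _ _ cl a); [exact: ccl|exact: ca].
  apply: cvgM; first by apply: cvgB; [exact: cvg_cst|exact: h1].
  by apply: cvgV; [rewrite gt_eqF|exact: h2].
have [Y [Ys dY]] := @picard R F (K + 1) B s y0 (ltac:(lra)) cF FK FB.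
have sub x : s <= x <= t -> forall z, s <= z <= x -> s <= z <= t.
  by move=> /andP[_ xt] z /andP[-> zx]; rewrite (le_trans zx).
have Yup x : s <= x <= t -> Y x <= P.
  move=> xst; rewrite -subr_ge0; case/andP: (xst) => sx _.
  apply: (@barrier R (fun z => P - Y z) (fun z => 0 - F z (Y z)) 0 s x sx).
  - by move=> z /andP[sz _]; exact: is_derive_sub (is_derive_const P z) (dY z sz).
  - by rewrite Ys subr_ge0.
  - move=> z zx hz; rewrite mul0r sub0r /F -mulNr divr_ge0 ?(ltW (acl z)) // opprB subr_ge0.
    have -> : cp (Y z) = P by rewrite /cp [Num.min _ _]min_r ?max_l //; lra.
    exact: ltW.
have Ylo x : s <= x <= t -> p0 x <= Y x.
  move=> xst; rewrite -subr_ge0; case/andP: (xst) => sx _.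
  apply: (@barrier R (fun z => Y z - p0 z) (fun z => F z (Y z) - (lam0 - H z (p0 z)) / a z) K s x sx).
  - move=> z zx; have zst := sub x xst z zx; case/andP: zx => sz _.
    exact: is_derive_sub (dY z sz) (hp0 z zst).
  - by rewrite Ys subr_ge0.
  - move=> z zx hz; have zst := sub x xst z zx; have az := a0 z zst.
    have /andP[pb1 pb2] := hb z zst.
    have cpY : `|cp (Y z) - p0 z| <= p0 z - Y z.
      rewrite -{1}(@clampE R (- P) P (p0 z)) ?pb1 //; apply: le_trans (dist_clamp_le _ _ _ _) _.
      by rewrite ler0_norm // opprB.
    have h1 : H z (cp (Y z)) - H z (p0 z) <= K' * (p0 z - Y z).
      apply: le_trans (ler_norm _) _; apply: le_trans (hK _ _ _ _ (cpP _) _) _.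
        by rewrite ler_norml pb1.
      by rewrite subrr normr0 add0r ler_pM2l.
    rewrite /F clE // -mulrBl ler_pdivlMr //.
    apply: (@le_trans _ _ (K' * (Y z - p0 z))); last by lra.
    rewrite mulrAC ler_wnM2r // /K mulrAC ler_pdivlMr // ler_pM2l //; exact: hm.
exists Y; split => // [x xst|x xst]; last by rewrite Yup // Ylo.
case/andP: (xst) => sx _; have := dY x sx; rewrite /F clE // /cp clampE // Yup // andbT.
by have := hb x xst; have := Ylo x xst; lra.
Qed.

Lemma blow_right (f df : R -> R) a (k th B s m : R) : s < m -> 0 < th -> 0 < k ->
  (forall z, s <= z < m -> is_derive z 1 f (df z)) ->
  (forall z, s <= z < m -> 0 < a z <= k * (z - m) ^+ 2) ->
  (forall z, s <= z < m -> df z <= - (th / a z)) ->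
  exists2 z, s <= z < m & f z < - B.
Proof.
move=> sm th0 k0 hf ha hdf.
pose c := th / k; have c0 : 0 < c by rewrite divr_gt0.
(* The primitive of -c / (z - m)^2, the weakest decrease compatible with the bound on [a]; it tends
   to -oo as z increases to [m], and [D] below measures how far it has to fall. *)
pose psi z := c * (z - m)^-1.
have dpsi z : z < m -> is_derive z 1 psi (- (c / (z - m) ^+ 2)).
  move=> zm; have zm0 : z - m != 0 by rewrite subr_eq0 lt_eqF.
  have d1 : is_derive z 1 (fun y => 1 * (y - m) + 0) 1 by exact: is_derive_affine.
  have zm0' : 1 * (z - m) + 0 != 0 by rewrite mul1r addr0.
  have d2 := @is_deriveV R (fun y => 1 * (y - m) + 0) z 1 1 zm0' d1; have d3 := is_derive_scale c d2.
  rewrite /psi (_ : (fun z => _) = (fun y => c * (1 * (y - m) + 0)^-1)); last first.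
    by apply/funext => y; rewrite mul1r addr0.
  apply: is_derive_eq d3 _; rewrite /GRing.scale /= !mul1r addr0.
  by rewrite mulr1 mulrN.
pose D : R := `|f s - psi s + B| + 1.
have D0 : 0 < D by rewrite ltr_wpDl.
pose t : R := Num.min (m - s) (c / D).
have t0 : 0 < t by rewrite lt_min subr_gt0 sm divr_gt0.
have t1 : t <= m - s by rewrite ge_min lexx.
have t2 : D <= c / t by rewrite ler_pdivlMr // mulrC -ler_pdivlMr // ge_min lexx orbT.
exists (m - t); first by lra.
have : f (m - t) - f s <= psi (m - t) - psi s.
  apply: (@derive_le R f psi df (fun z => - (c / (z - m) ^+ 2))); first by lra.
  - by move=> x hx; apply: hf; lra.
  - by move=> x hx; apply: dpsi; lra.
  - move=> x hx; have xm : s <= x < m by lra.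
    apply: le_trans (hdf x xm) _; rewrite lerN2 /c.
    have /andP[a0 a1] := ha x xm.
    have q0 : 0 < (x - m) ^+ 2 by rewrite exprn_even_gt0 //= subr_eq0 lt_eqF //; case/andP: xm.
    by rewrite -mulrA -invfM ler_pM2l // lef_pV2 ?posrE ?(mulr_gt0 k0 q0).
have -> : psi (m - t) = - (c / t).
  by rewrite /psi addrAC subrr add0r invrN mulrN.
have := ler_norm (f s - psi s + B); rewrite /D in t2 *; lra.
Qed.

Lemma blow_left (f df : R -> R) a (k th B m x : R) : m < x -> 0 < th -> 0 < k ->
  (forall z, m < z <= x -> is_derive z 1 f (df z)) ->
  (forall z, m < z <= x -> 0 < a z <= k * (z - m) ^+ 2) ->
  (forall z, m < z <= x -> df z <= - (th / a z)) ->
  exists2 z, m < z <= x & B < f z.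
Proof.
move=> mx th0 k0 hf ha hdf.
have [||||z zx hz] := @blow_right (fun y => - f (- y)) (fun y => df (- y)) (fun y => a (- y)) k th
  B (- x) (- m) _ th0 k0.
- by rewrite ltrN2.
- move=> z hz; rewrite -[df (- z)]opprK; apply: is_derive_opp; apply: is_derive_reflect.
  by apply: hf; lra.
- by move=> z hz; have := ha (- z) (ltac:(lra)); rewrite -opprB opprK addrC sqrrN opprK.
- by move=> z hz; apply: hdf; lra.
by exists (- z); [lra|rewrite ltrN2 in hz].
Qed.

End Existence.

(** * Construction of the upper slope *)

Section Construction.
Variable R : realType.

Lemma itv_norm_le (lo hi p : R) : lo <= p <= hi -> `|p| <= `|lo| + `|hi|.
Proof.
have := ler_norm (- lo); have := ler_norm hi; have := normr_ge0 lo; have := normr_ge0 hi.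
by rewrite normrN ler_norml; lra.
Qed.

(** Above [pp + e] the slope at level [lam] is pushed down, between [cm] and [clo] it is pushed up,
    and below [cm] the slope at level [lam0] is pushed down. Taking [cm] on the left branch halfway
    between the two levels makes the last two strips adjacent. *)
Lemma barrier_constants H phat (lam0 lam P x0 pp e : R) : hamiltonian H phat -> lam0 < lam ->
  H x0 (phat x0) <= lam0 -> pplus H phat lam x0 pp -> 0 < e -> pp < P ->
  exists de th cm clo : R,
    [/\ [/\ 0 < de, 0 < th, cm <= clo, clo <= P & pp - e <= clo],
      forall z p : R, `|z - x0| < de -> pp + e <= p <= P -> lam + th <= H z p,
      forall z p : R, `|z - x0| < de -> cm <= p <= clo -> H z p <= lam - th &
      forall z p : R, `|z - x0| < de -> - P <= p <= cm -> lam0 + th <= H z p].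
Proof.
move=> hH ll0 hm0 hpp e0 ppP.
have [cm cmx Hcm] := @level_left R H phat ((lam0 + lam) / 2) x0 hH (ltac:(lra)).
have ppx : phat x0 <= pp by case: hpp.
have cmpp : cm < pp.
  rewrite lt_neqAle (le_trans cmx ppx) andbT; apply/eqP => E.
  by case: hpp => _; rewrite -E Hcm; lra.
pose e' := Num.min e ((pp - cm) / 2).
have e'0 : 0 < e' by rewrite lt_min e0 divr_gt0 // subr_gt0.
have e'e : e' <= e by rewrite ge_min lexx.
have e'c : e' <= (pp - cm) / 2 by rewrite ge_min lexx orbT.
pose clo := pp - e'.
have cmlo : cm <= clo by rewrite /clo; lra.
have clopp : clo < pp by rewrite /clo; lra.
have cloe : pp - e <= clo by rewrite /clo; lra.
have Hclo : H x0 clo < lam by apply: (pplus_lt hH hpp (c := cm)) => //; rewrite Hcm; lra.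
have Hcup : lam < H x0 (pp + e) by apply: (pplus_gt hH hpp); lra.
(* Each margin at [x0] is at least 2 [th]; one [th] is spent on moving from [x0] to a nearby [z]. *)
pose th := Num.min ((H x0 (pp + e) - lam) / 2) (Num.min ((lam - H x0 clo) / 2) ((lam - lam0) / 4)).
have th0 : 0 < th by rewrite !lt_min !divr_gt0 // subr_gt0.
have th1 : th <= (H x0 (pp + e) - lam) / 2 by rewrite ge_min lexx.
have th2 : th <= (lam - H x0 clo) / 2 by rewrite !ge_min lexx orbT.
have th3 : th <= (lam - lam0) / 4 by rewrite !ge_min lexx !orbT.
clearbody th; clear e'0 e'e e'c; clearbody clo; clear e'.
pose B : R := `|P| + `|cm| + `|clo|.
have [n1 n2 n3] : [/\ 0 <= `|P|, 0 <= `|cm| & 0 <= `|clo|] by split; exact: normr_ge0.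
have [de de0 hde] := @ham_near R H phat x0 B th hH th0.
have inB (lo hi p : R) : lo <= p <= hi -> `|lo| + `|hi| <= B -> `|p| <= B.
  by move=> /itv_norm_le h1 h2; exact: le_trans h1 h2.
exists de, th, cm, clo; split => //.
- by split => //; lra.
- move=> z p zd /andP[h1 h2]; have pB : `|p| <= B by apply: (inB cm P); [lra|rewrite /B; clear - n3; lra].
  have := hde z p zd pB; rewrite ltr_norml.
  have : H x0 (pp + e) <= H x0 p by apply: (ham_incr_le hH) => //; clear - ppx e0; lra.
  clear - th1; lra.
- move=> z p zd /andP[h1 h2]; have pB : `|p| <= B by apply: (inB cm clo); [rewrite h1|rewrite /B; clear - n1; lra].
  have := hde z p zd pB; rewrite ltr_norml; have [h3|/ltW h3] := leP p (phat x0).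
    by have := ham_decr_le hH h3 h1; rewrite Hcm; clear - th3 th0 ll0; lra.
  by have := ham_incr_le hH h3 h2; clear - th2 th0; lra.
- move=> z p zd /andP[h1 h2]; have pB : `|p| <= B by apply: (inB (- P) cm); [rewrite h1|rewrite /B normrN; clear - n3; lra].
  have := hde z p zd pB; rewrite ltr_norml; have := ham_decr_le hH cmx h2.
  by rewrite Hcm; clear - th3 th0 ll0; lra.
Qed.

Implicit Types (x z p q h t l r s : R).
Variables (k : R) (a : R -> R) (H : R -> R -> R) (phat : R -> R) (lam0 lam P : R) (p0 : R -> R).
Hypotheses (ha : diffusion k a) (hH : hamiltonian H phat) (ll : lam0 < lam)
  (hp0 : forall x, 0 < a x -> is_derive x 1 p0 ((lam0 - H x (p0 x)) / a x))
  (hb : forall x, 0 < a x -> - P <= p0 x <= P)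
  (hP : forall x p, P <= `|p| -> lam < H x p)
  (hmin : forall x, a x = 0 -> H x (phat x) <= lam0).

Definition started_above x : set R := [set r | exists s t (y : R -> R),
  [/\ s <= x <= t, forall z, s <= z <= t -> 0 < a z, y s = P, ode_sol a H lam s t y &
      (forall z, s <= z <= t -> p0 z <= y z <= P) /\ r = y x]].

Definition upper_slope x : R := inf (started_above x).

Let ca : continuous a := diff_cont ha.

Let HP x : 0 < a x -> forall z, lam < H z P.
Proof. by move=> /hb hx z; apply: hP; rewrite ler_norm. Qed.

Let exists_from y0 s t : s <= t -> (forall x, s <= x <= t -> 0 < a x) -> p0 s <= y0 <= P ->
  exists Y : R -> R, [/\ Y s = y0, ode_sol a H lam s t Y & forall x, s <= x <= t -> p0 x <= Y x <= P].
Proof.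
move=> st a0 hy; apply: (ode_exists ca hH (ltW ll) st a0 _ _ _ hy).
- by move=> x /a0; exact: hp0.
- by move=> x /a0; exact: hb.
- by apply: (@HP s); apply: a0; rewrite lexx.
Qed.

Lemma started_above_nonempty x : 0 < a x -> started_above x !=set0.
Proof.
move=> ax; have ax' z : x <= z <= x -> 0 < a z.
  by move=> h; have -> : z = x by [apply/eqP; rewrite eq_le andbC].
have [|Y [Y1 Y2 Y3]] := @exists_from P x x (lexx _) ax'.
  by have := hb ax; lra.
by exists (Y x), x, x, Y; split => //; rewrite lexx.
Qed.

Lemma started_above_lb x : lbound (started_above x) (p0 x).
Proof. by move=> _ [s [t [y [xst _ _ _ [hy ->]]]]]; have /andP[] := hy x xst. Qed.

Lemma upper_slope_le x r : started_above x r -> upper_slope x <= r.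
Proof. by move=> h; apply: ge_inf => //; exists (p0 x); exact: started_above_lb. Qed.

Lemma upper_slope_ge x c : 0 < a x -> (forall r, started_above x r -> c <= r) -> c <= upper_slope x.
Proof. by move=> ax h; apply: lb_le_inf => //; exact: started_above_nonempty. Qed.

Lemma upper_slope_bounds x : 0 < a x -> p0 x <= upper_slope x <= P.
Proof.
move=> ax; rewrite (upper_slope_ge ax) /=; last exact: started_above_lb.
have [r hr] := started_above_nonempty ax; apply: le_trans (upper_slope_le hr) _.
by case: hr => s [t [y [xst _ _ _ [hy ->]]]]; have /andP[] := hy x xst.
Qed.

(** [Y] starts at the infimum in [s]. A competitor begun before [s] is above [Y] at [s], one begun
    later starts at [P], and order is preserved; conversely a near-minimal competitor at [s] stays
    close to [Y] by Gronwall. *)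
Lemma upper_slope_local s t : s <= t -> (forall x, s <= x <= t -> 0 < a x) ->
  exists2 Y : R -> R, ode_sol a H lam s t Y & forall x, s <= x <= t -> upper_slope x = Y x.
Proof.
move=> st a0; have as0 : 0 < a s by apply: a0; rewrite lexx.
have [Y [Ys Ysol Yb]] := exists_from st a0 (upper_slope_bounds as0).
exists Y => // x xst; case/andP: (xst) => sx xt.
have sub z : s <= z <= x -> 0 < a z.
  by move=> /andP[h1 h2]; apply: a0; rewrite h1 (le_trans h2).
apply/eqP; rewrite eq_le; apply/andP; split; last first.
  apply: upper_slope_ge; first exact: a0.
  move=> _ [s1 [t1 [y [/andP[s1x xt1] a1 ys1 ysol [yb ->]]]]].
  have [s1s|/ltW ss1] := leP s1 s.
    apply: (@ode_sol_le R a H phat lam Y y s x ca hH sx sub).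
    - exact: sub_ode_sol (lexx _) xt Ysol.
    - exact: sub_ode_sol s1s xt1 ysol.
    - rewrite Ys; apply: upper_slope_le; exists s1, t1, y; split => //.
      by rewrite s1s (le_trans sx).
  apply: (@ode_sol_le R a H phat lam Y y s1 x ca hH s1x).
  - by move=> z /andP[h1 h2]; apply: sub; rewrite (le_trans ss1).
  - exact: sub_ode_sol ss1 xt Ysol.
  - exact: sub_ode_sol (lexx _) xt1 ysol.
  - by rewrite ys1; have /andP[] := Yb s1 (ltac:(rewrite ss1 (le_trans s1x)//)).
have [K hK] := @ode_gronwall R a H phat lam P s t ca hH st a0.
pose E := expR (- K * s) * expR (K * x).
have E0 : 0 < E by rewrite mulr_gt0 ?expR_gt0.
apply/ler_addgt0Pr => e e0.
have e10 : 0 < e / E by rewrite divr_gt0.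
have [_ [s1 [t1 [y [/andP[s1s st1] a1 ys1 ysol [yb ->]]]]] hy] :=
  @inf_adherent R (started_above s) _ e10
   (conj (started_above_nonempty as0) (ex_intro _ _ (@started_above_lb s))).
have a2 z : s1 <= z <= t -> 0 < a z.
  move=> /andP[h1 h2]; have [h3|/ltW h3] := leP z t1; first by apply: a1; rewrite h1.
  by apply: a0; rewrite h2 (le_trans st1).
(* The near-minimal [y] may stop before [t], so it is replaced by the solution [Z] from the same
   start on all of [s1, t]. *)
have s1t := le_trans s1s st.
have [|Z [Zs Zsol Zb]] := @exists_from P s1 t s1t a2.
  by have := @hb s1 (a2 s1 (ltac:(rewrite lexx//))); lra.
have Zy : Z s <= y s.
  apply: (@ode_sol_le R a H phat lam Z y s1 s ca hH s1s).
  - by move=> z /andP[h1 h2]; apply: a2; rewrite h1 (le_trans h2).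
  - exact: sub_ode_sol (lexx _) st Zsol.
  - exact: sub_ode_sol (lexx _) st1 ysol.
  - by rewrite Zs ys1.
have abs_le (f : R -> R) z : 0 < a z -> p0 z <= f z <= P -> `|f z| <= P.
  by move=> /hb h1 h2; rewrite ler_norml; lra.
have sub1 z : s <= z <= t -> s1 <= z <= t by move=> /andP[h1 ->]; rewrite (le_trans s1s).
have ZY : Z x <= Y x + e / E * E.
  apply: (hK Z _ Y _ (e / E) (ltW e10) (sub_ode_sol s1s (lexx _) Zsol) Ysol
    (fun _ _ => lexx _) (fun _ _ => lexx _)) => //.
  - by move=> z zst; apply: abs_le; [exact: a0|apply: Zb; exact: sub1].
  - by move=> z zst; apply: abs_le; [exact: a0|exact: Yb].
  - by rewrite Ys; apply: le_trans Zy _; exact: ltW hy.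
apply: (@le_trans _ _ (Z x)); last by rewrite divfK ?gt_eqF in ZY.
apply: upper_slope_le; exists s1, t, Z; split => //.
by rewrite (le_trans s1s) // xt.
Qed.

Lemma positive_near x : 0 < a x -> exists2 d : R, 0 < d & forall z, `|z - x| <= d -> 0 < a z.
Proof.
move=> ax; have /continuous_forP/(_ _ ax)[d d0 hd] := @ca x.
exists (d / 2); first by rewrite divr_gt0.
move=> z zx; have /hd : `|z - x| < d by apply: le_lt_trans zx _; lra.
by rewrite ltr_norml; lra.
Qed.

Lemma upper_slope_derive x : 0 < a x ->
  is_derive x 1 upper_slope ((lam - H x (upper_slope x)) / a x).
Proof.
move=> ax; have [d d0 hd] := positive_near ax.
have [||Y Ysol YE] := @upper_slope_local (x - d) (x + d); first by lra.
  by move=> z hz; apply: hd; rewrite ler_norml; lra.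
have xx : x - d <= x <= x + d by lra.
rewrite (YE x xx); apply: (is_derive_near d0 _ (Ysol x xx)).
by move=> z; rewrite ltr_norml => hz; apply: YE; lra.
Qed.

(** At a point of equality [p0] would touch the slope from below, so the derivatives would agree,
    whereas the two equations differ there by (lam - lam0) / a. *)
Lemma upper_slope_gt x : 0 < a x -> p0 x < upper_slope x.
Proof.
move=> ax; have /andP[h1 _] := upper_slope_bounds ax.
rewrite lt_neqAle h1 andbT; apply/eqP => E.
have [d d0 hd] := positive_near ax.
have sg : subgradient upper_slope x ((lam0 - H x (p0 x)) / a x).
  exists p0; split; first exact: hp0.
  exists d => // z zx; have /upper_slope_bounds/andP[h2 _] := hd z (ltW zx).
  by rewrite -E lerD2r.
have := subgradient_derive sg (upper_slope_derive ax); rewrite -E => E2.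
by have := congr1 (fun y => y * a x) E2; rewrite !divfK ?gt_eqF //; have := ll; lra.
Qed.

Let upper_slope_sol s t : (forall x, s <= x <= t -> 0 < a x) -> ode_sol a H lam s t upper_slope.
Proof. by move=> h x /h; exact: upper_slope_derive. Qed.

Let k1 : 0 < k + 1. Proof. by have := diff_k ha; lra. Qed.

Let quad z y : a y = 0 -> a z <= (k + 1) * (z - y) ^+ 2.
Proof.
move=> ay; apply: le_trans (diff_quad ha z ay) _; rewrite ler_wpM2r ?sqr_ge0 //; lra.
Qed.

(** * Trapping the slope near a zero of the diffusion *)

Section Barriers.
Variables (x0 de th cm clo cup : R).
Hypotheses (th0 : 0 < th) (clop : clo <= P)
  (hU : forall z p, `|z - x0| < de -> cup <= p <= P -> lam + th <= H z p)
  (hL : forall z p, `|z - x0| < de -> cm <= p <= clo -> H z p <= lam - th)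
  (hD : forall z p, `|z - x0| < de -> - P <= p <= cm -> lam0 + th <= H z p)
  (cmlo : cm <= clo).

Let H_clo z : `|z - x0| < de -> H z clo <= lam.
Proof. by move=> zd; have := hL zd (ltac:(rewrite cmlo lexx//) : cm <= clo <= clo); have := th0; lra. Qed.

Let stay_below s t : s <= t -> (forall z, s <= z <= t -> 0 < a z) ->
  (forall z, s <= z <= t -> `|z - x0| < de) -> upper_slope s <= cup -> upper_slope t <= cup.
Proof.
move=> st pos near hs; have [cP|/ltW Pc] := leP cup P; last first.
  apply: le_trans Pc; have /upper_slope_bounds/andP[]// : 0 < a t.
  by apply: pos; rewrite st lexx.
apply: (ode_le_const ca hH st pos (upper_slope_sol pos) _ hs) => z /near zd.
by have := hU zd (ltac:(rewrite lexx//) : cup <= cup <= P); have := th0; lra.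
Qed.

(** Every competitor starts at [P], to the right of [l], and cannot cross [clo] downwards. Exceeding
    [cup] at x would propagate leftwards to all of (l, x], where the drift is at most -th / a, and
    the slope would be unbounded near [l]. *)
Lemma upper_slope_interior l x : a l = 0 -> l < x -> (forall z, l < z <= x -> 0 < a z) ->
  `|l - x0| < de -> `|x - x0| < de -> clo <= upper_slope x <= cup.
Proof.
rewrite !ltr_norml => al lx pos ld xd.
have near z : l < z <= x -> `|z - x0| < de by move=> zx; rewrite ltr_norml; lra.
have ax : 0 < a x by apply: pos; rewrite lx lexx.
apply/andP; split.
  apply: upper_slope_ge => // _ [s [t [y [/andP[sx xt] pos1 ys ysol [yb ->]]]]].
  have ls : l < s.
    rewrite ltNge; apply/negP => sl; have := pos1 l; rewrite al ltxx => h.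
    by have : false by apply: h; rewrite sl (le_trans (ltW lx)).
  have sub z : s <= z <= x -> l < z <= x by move=> /andP[h1 ->]; rewrite (lt_le_trans ls).
  apply: (@ode_ge_const R a H phat lam clo y s x ca hH sx).
  - by move=> z /sub; exact: pos.
  - exact: sub_ode_sol (lexx _) xt ysol.
  - by move=> z /sub/near; exact: H_clo.
  - by rewrite ys.
rewrite leNgt; apply/negP => hlt.
have above z : l < z <= x -> cup < upper_slope z.
  move=> /andP[lz zx]; rewrite ltNge; apply/negP => hz; move: hlt; apply/negP; rewrite -leNgt.
  have sub y : z <= y <= x -> l < y <= x by move=> /andP[h1 ->]; rewrite (lt_le_trans lz).
  by apply: (stay_below zx) => // y /sub; [exact: pos|exact: near].
have [|||z zx hz] := @blow_left R upper_slope (fun z => (lam - H z (upper_slope z)) / a z) a (k +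
  1) th P l x lx th0 k1.
- by move=> z /pos; exact: upper_slope_derive.
- by move=> z zx; rewrite pos //= quad.
- move=> z zx; rewrite -mulNr ler_pM2r ?invr_gt0 ?pos //.
  have /andP[_ h2] := upper_slope_bounds (pos z zx).
  by have := hU (near z zx) (ltac:(rewrite h2 ltW // above//) : cup <= upper_slope z <= P); lra.
by have /andP[_] := upper_slope_bounds (pos z zx); rewrite leNgt hz.
Qed.

(** Here competitors may start far from [x0]. Instead, a drift of constant sign would make the slope
    unbounded before [x0] if it never rose to [clo] or never fell to [cup]; once reached, these
    bounds persist. *)
Lemma upper_slope_left_end s : s < x0 -> a x0 = 0 -> (forall z, s <= z < x0 -> 0 < a z) ->
  x0 - s < de -> exists2 x1, s <= x1 < x0 & forall x, x1 <= x < x0 -> clo <= upper_slope x <= cup.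
Proof.
move=> sx ax0 pos sd.
have near z : s <= z < x0 -> `|z - x0| < de by move=> zx; rewrite ltr_norml; lra.
have quad0 z : s <= z < x0 -> 0 < a z <= (k + 1) * (z - x0) ^+ 2.
  by move=> zx; rewrite pos //= quad.
(* Once below [cm], [p0] would stay there and run to -oo at [x0]. This is how the solution at level
   [lam0] keeps the new slope from p^-. *)
have p0cm z0 : s <= z0 < x0 -> cm <= p0 z0.
  move=> /andP[sz0 z0x]; rewrite leNgt; apply/negP => hlt.
  have sub z : z0 <= z < x0 -> s <= z < x0 by move=> /andP[h1 ->]; rewrite (le_trans sz0).
  have /andP[Pcm _] : - P <= p0 z0 <= P by apply: hb; apply: pos; rewrite sz0.
  have below z : z0 <= z < x0 -> p0 z <= cm.
    move=> /andP[h1 h2].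
    have sub1 y : z0 <= y <= z -> s <= y < x0.
      by move=> /andP[h3 h4]; rewrite (le_trans sz0) // (le_lt_trans h4).
    apply: (@ode_le_const R a H phat lam0 cm p0 z0 z ca hH h1).
    - by move=> y /sub1; exact: pos.
    - by move=> y /sub1/pos; exact: hp0.
    - move=> y /sub1/near yd.
      have := hD yd (ltac:(rewrite lexx andbT ltW // (le_lt_trans Pcm)//) : - P <= cm <= cm).
      by have := th0; lra.
    - exact: ltW.
  have [|||z zx hz] := @blow_right R p0 (fun z => (lam0 - H z (p0 z)) / a z) a (k + 1) th P z0 x0
    z0x th0 k1.
  - by move=> z /sub/pos; exact: hp0.
  - by move=> z /sub; exact: quad0.
  - move=> z zx; have zs := sub z zx; rewrite -mulNr ler_pM2r ?invr_gt0 ?pos //.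
    have /andP[h1 _] := hb (pos z zs).
    by have := hD (near z zs) (ltac:(rewrite h1 below//) : - P <= p0 z <= cm); lra.
  by have /andP[] := hb (pos z (sub z zx)); rewrite leNgt hz.
have [x1 x1s hx1] : exists2 x1, s <= x1 < x0 & clo <= upper_slope x1.
  apply: contrapT => hn.
  have lt z : s <= z < x0 -> upper_slope z < clo.
    by move=> zs; rewrite ltNge; apply/negP => h; apply: hn; exists z.
  have [|||z zs hz] := @blow_right R (fun z => - upper_slope z) (fun z => - ((lam - H z
    (upper_slope z)) / a z)) a (k + 1) th P s x0 sx th0 k1.
  - by move=> z /pos az; exact: is_derive_opp (upper_slope_derive az).
  - exact: quad0.
  - move=> z zs; rewrite lerN2 ler_pM2r ?invr_gt0 ?pos //.
    have /andP[h1 _] := upper_slope_bounds (pos z zs).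
    by have := hL (near z zs) (ltac:(rewrite (le_trans (p0cm z zs)) //= ltW // lt//) : cm <= upper_slope z <= clo); lra.
  by have /andP[_] := upper_slope_bounds (pos z zs); rewrite ltrN2 in hz; rewrite leNgt hz.
have [x2 x2s hx2] : exists2 x2, s <= x2 < x0 & upper_slope x2 <= cup.
  apply: contrapT => hn.
  have gt z : s <= z < x0 -> cup < upper_slope z.
    by move=> zs; rewrite ltNge; apply/negP => h; apply: hn; exists z.
  have [|||z zs hz] := @blow_right R upper_slope (fun z => (lam - H z (upper_slope z)) / a z) a (k
    + 1) th P s x0 sx th0 k1.
  - by move=> z /pos az; exact: upper_slope_derive az.
  - exact: quad0.
  - move=> z zs; rewrite -mulNr ler_pM2r ?invr_gt0 ?pos //.
    have /andP[_ h1] := upper_slope_bounds (pos z zs).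
    by have := hU (near z zs) (ltac:(rewrite h1 ltW // gt//) : cup <= upper_slope z <= P); lra.
  have /andP[h1 _] := hb (pos z zs); have /andP[h2 _] := upper_slope_bounds (pos z zs).
  by have := le_trans h1 h2; rewrite leNgt hz.
case/andP: x1s => s1 x1x; case/andP: x2s => s2 x2x.
exists (Num.max x1 x2); first by rewrite le_max s1 gt_max x1x.
move=> x /andP[]; rewrite ge_max => /andP[h1 h2] hx; apply/andP; split.
  have sub z : x1 <= z <= x -> s <= z < x0.
    by move=> /andP[h3 h4]; rewrite (le_trans s1) // (le_lt_trans h4).
  have posx z : x1 <= z <= x -> 0 < a z by move=> /sub; exact: pos.
  apply: (ode_ge_const ca hH h1 posx (upper_slope_sol posx) _ hx1) => z /sub/near.
  exact: H_clo.
have sub z : x2 <= z <= x -> s <= z < x0.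
  by move=> /andP[h3 h4]; rewrite (le_trans s2) // (le_lt_trans h4).
by apply: (stay_below h2) => // z /sub; [exact: pos|exact: near].
Qed.

End Barriers.

Lemma upper_slope_near x0 pp (e : R) : a x0 = 0 -> pplus H phat lam x0 pp -> 0 < e ->
  exists2 d : R, 0 < d & forall x, `|x - x0| < d -> 0 < a x -> `|upper_slope x - pp| <= e.
Proof.
move=> ax0 hpp e0.
have [[xa axa]|noA] := pselect (exists x, 0 < a x); last first.
  by exists 1 => // x _ ax; case: noA; exists x.
have ppP : pp < P.
  rewrite ltNge; apply/negP => h; have := @hP x0 pp (le_trans h (ler_norm _)).
  by case: hpp => _ ->; rewrite ltxx.
have [de [th [cm [clo [[de0 th0 cmlo cloP cloe] hU hL hD]]]]] := barrier_constants hH ll (hmin ax0) hpp e0 ppP.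
have fin x : clo <= upper_slope x <= pp + e -> `|upper_slope x - pp| <= e.
  by rewrite ler_norml; lra.
have inner z0 x : a z0 = 0 -> `|z0 - x0| < de -> z0 < x -> `|x - x0| < de -> 0 < a x ->
    `|upper_slope x - pp| <= e.
  move=> az0 zd z0x xd ax; have [l [r [/andP[lx xr] al ar pos]]] := diff_comp ha ax.
  have z0l : z0 <= l.
    rewrite leNgt; apply/negP => lz0; have := pos z0; rewrite az0 ltxx => h.
    by have : false by apply: h; rewrite lz0 (lt_trans z0x).
  apply: fin; apply: (upper_slope_interior th0 cloP hU hL cmlo al lx _ _ xd).
    by move=> z /andP[h1 h2]; apply: pos; rewrite h1 (le_lt_trans h2).
  by move: zd xd; rewrite !ltr_norml; lra.
have x0d : `|x0 - x0| < de by rewrite subrr normr0.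
pose s := x0 - de / 2.
have [sx sde] : s < x0 /\ x0 - s < de by rewrite /s; split; lra.
(* If [a] vanishes at some [z0] just left of [x0], every component met beyond [z0] has its left end
   nearby and [inner] suffices. Otherwise the points on the left belong to one component, which may
   begin far away. *)
have [hpos|hzero] := pselect (forall z, s <= z < x0 -> 0 < a z).
  have [x1 x1s hx1] := upper_slope_left_end th0 hU hL hD cmlo sx ax0 hpos sde.
  exists (Num.min de (x0 - x1)); first by rewrite lt_min de0 subr_gt0; case/andP: x1s.
  move=> x; rewrite lt_min => /andP[xd xx1] ax; have [xx0|x0x|E] := ltgtP x x0.
  - by apply: fin; apply: hx1; move: xx1; rewrite ltr_norml; lra.
  - exact: inner ax0 x0d x0x xd ax.
  - by move: ax; rewrite E ax0 ltxx.
have [z0 z0s az0] : exists2 z0, s <= z0 < x0 & a z0 = 0.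
  apply: contrapT => hn; apply: hzero => z zs; rewrite lt_neqAle (diff_ge0 ha) andbT.
  by apply/eqP => E; apply: hn; exists z.
exists (Num.min de (x0 - z0)); first by rewrite lt_min de0 subr_gt0; case/andP: z0s.
move=> x; rewrite lt_min => /andP[xd xz0] ax; apply: (inner z0 x az0) => //.
  by rewrite ltr_norml; lra.
by move: xz0; rewrite ltr_norml; lra.
Qed.

Lemma upper_solution_exists : exists U q : R -> R,
  [/\ U 0 = 0, forall x, is_derive x 1 U (q x), continuous q,
      forall x, a x = 0 -> pplus H phat lam x (q x) &
      forall x, 0 < a x -> is_derive x 1 q ((lam - H x (q x)) / a x) /\ p0 x < q x].
Proof.
have /choice[pp hpp] : forall x, exists p, a x = 0 -> pplus H phat lam x p.
  move=> x; have [ax|ax] := eqVneq (a x) 0; last by exists 0 => E; rewrite E eqxx in ax.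
  have [|p hp] := @pplus_exists R H phat lam x hH; last by exists p.
  exact: le_trans (hmin ax) (ltW ll).
pose q x := if 0 < a x then upper_slope x else pp x.
have qpos x : 0 < a x -> q x = upper_slope x by move=> ax; rewrite /q ax.
have q0 x : a x = 0 -> q x = pp x by move=> ax; rewrite /q ax ltxx.
have dq x : 0 < a x -> is_derive x 1 q ((lam - H x (q x)) / a x).
  move=> ax; have [d d0 hd] := positive_near ax; rewrite qpos //.
  apply: (is_derive_near d0 _ (upper_slope_derive ax)) => z zd.
  by apply: qpos; apply: hd; exact: ltW.
have cq : continuous q.
  apply: continuous_pointwise => x; have [ax|ax] := ltP 0 (a x).
    exact: is_derive_continuous (dq x ax).
  have {}ax : a x = 0 by apply/eqP; rewrite eq_le ax (diff_ge0 ha).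
  have px := hpp x ax; apply/continuous_forP => e e0.
  have e20 : 0 < e / 2 by rewrite divr_gt0.
  have [d1 d10 h1] := upper_slope_near ax px e20.
  have Hup : lam < H x (pp x + e / 2) by apply: (pplus_gt hH px); lra.
  have [c cx Hc] := @level_left R H phat ((lam0 + lam) / 2) x hH (ltac:(by have := hmin ax; have :=
    ll; lra)).
  have Hc' : H x c < lam by rewrite Hc; have := ll; lra.
  have cpp : c < pp x.
    by case: (px) => h2 h3; rewrite ltNge; apply/negP => h; have := ham_incr_le hH h2 h; lra.
  (* [pp x - e / 2] alone might lie below p^-; raising it to [c] keeps [b] strictly inside the
     sublevel set, so that b <= pp z at neighbouring zeros. *)
  pose b := Num.max c (pp x - e / 2).
  have cb : c <= b by rewrite le_max lexx.
  have be : pp x - e / 2 <= b by rewrite le_max lexx orbT.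
  have bp : b < pp x by rewrite gt_max cpp; lra.
  have Hb : H x b < lam by exact: (pplus_lt hH px Hc' cb bp).
  pose th := Num.min (H x (pp x + e / 2) - lam) (lam - H x b).
  have th0 : 0 < th by rewrite lt_min !subr_gt0 Hup.
  have th1 : th <= H x (pp x + e / 2) - lam by rewrite ge_min lexx.
  have th2 : th <= lam - H x b by rewrite ge_min lexx orbT.
  have [d2 d20 h2] := @ham_near R H phat x (`|pp x + e / 2| + `|b|) th hH th0.
  have [d3 d30 h3] := @ham_incr_near R H phat x (pp x + e / 2) hH (ltac:(case: px; lra)).
  exists (Num.min d1 (Num.min d2 d3)); first by rewrite !lt_min d10 d20.
  move=> z; rewrite !lt_min => /and3P[zd1 zd2 zd3]; rewrite (q0 x ax).
  have [az|az] := ltP 0 (a z).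
    by rewrite qpos //; apply: le_lt_trans (h1 z zd1 az) _; lra.
  have {}az : a z = 0 by apply/eqP; rewrite eq_le az (diff_ge0 ha).
  rewrite (q0 z az); have pz := hpp z az.
  have k1' := h2 z (pp x + e / 2) zd2 (ltac:(rewrite lerDl//)).
  have k2' := h2 z b zd2 (ltac:(rewrite lerDr//)).
  have u1 : pp z <= pp x + e / 2.
    rewrite leNgt; apply/negP => h; case: (pz) => _ E.
    have := ham_incr_le hH (h3 z zd3) (ltW h); move: k1'; rewrite ltr_norml; lra.
  have u2 : b <= pp z.
    by apply: (pplus_ge hH pz); move: k2'; rewrite ltr_norml; lra.
  by rewrite ltr_norml; lra.
have [U [U0 dU]] := primitive_exists cq.
exists U, q; split => //.
- by move=> x ax; rewrite q0 //; exact: hpp.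
- by move=> x ax; split; [exact: dq|rewrite qpos //; exact: upper_slope_gt].
Qed.

End Construction.

(** * The theorem *)

Section Main.
Variable R : realType.
Implicit Types (a u v w phi U q : R -> R) (G H : R -> R -> R) (x y z p h t l r s : R).

Lemma second_order_min (g dg : R -> R) x0 (c e : R) : 0 < e ->
  (forall y, is_derive y 1 g (dg y)) -> is_derive x0 1 dg c ->
  (forall y, `|y - x0| < e -> g x0 <= g y) -> 0 <= c.
Proof.
move=> e0 hg hc hmin; rewrite leNgt; apply/negP => c0.
have dg0 : dg x0 = 0.
  apply/esym; apply: (subgradient_derive _ (hg x0)); exists (fun=> 0); split.
    exact: is_derive_const.
  by exists e => // y /hmin; rewrite subrr subr_ge0.
have /is_deriveP/(_ (- c / 2) (ltac:(lra)))[d d0 hd] := hc.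
pose t := Num.min d e / 2.
have m0 : 0 < Num.min d e by rewrite lt_min d0.
have m1 : Num.min d e <= d by rewrite ge_min lexx.
have m2 : Num.min d e <= e by rewrite ge_min lexx orbT.
have xt : x0 < x0 + t by rewrite /t; lra.
have [xi /andP[x1 x2] E] := MVT_itv xt (fun y _ => hg y).
have := hd xi; rewrite gtr0_norm ?subr_gt0 // => /(_ (ltac:(rewrite /t in x2; lra))).
rewrite dg0 subr0 ler_norml => /andP[_ h1].
have neg : dg xi < 0 by have : 0 < - c * (xi - x0) by [rewrite mulr_gt0 //; lra]; lra.
have := hmin (x0 + t); rewrite addrAC subrr add0r gtr0_norm => [/(_ (ltac:(rewrite /t; lra)))|]; last by lra.
have : g (x0 + t) - g x0 < 0 by rewrite E pmulr_llt0 //; lra.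
lra.
Qed.

(** Differentiability of [U] fixes the slope of the test function, and second derivatives are
    compared only where their coefficient is positive. A general [G] lets the lemma serve -U too. *)
Lemma classical_super a G (mu : R) U q : (forall x, 0 <= a x) ->
  (forall x, is_derive x 1 U (q x)) -> (forall x, a x = 0 -> G x (q x) <= mu) ->
  (forall x, 0 < a x -> exists2 c : R, is_derive x 1 q c & a x * c + G x (q x) <= mu) ->
  visc_super a G mu U.
Proof.
move=> a0 dU h0 hpos; split; first by move=> x; exact: is_derive_continuous (dU x).
move=> phi x0 [d1 d2 c2] E [e e0 he].
have dphi y : is_derive y 1 phi (derive1 phi y) by apply: derivable_is_derive; exact: d1.
have ddphi y : is_derive y 1 (derive1 phi) (derive1 (derive1 phi) y).
  by apply: derivable_is_derive; exact: d2.
have sg : subgradient U x0 (derive1 phi x0).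
  by exists phi; split => //; exists e => // y /he; rewrite E lerD2r.
rewrite (subgradient_derive sg (dU x0)).
have := a0 x0; rewrite le_eqVlt => /predU1P[ax|ax]; first by rewrite -ax mul0r add0r h0.
have [c dc hc] := hpos x0 ax; apply: le_trans hc; rewrite lerD2r ler_pM2l // -subr_ge0.
apply: (@second_order_min (fun y => U y - phi y) (fun y => q y - derive1 phi y) x0 _ e e0
  (fun y => is_derive_sub (dU y) (dphi y)) (is_derive_sub dc (ddphi x0))).
by move=> y /he; rewrite E subrr subr_ge0.
Qed.

Record slope_sol a H (lam : R) U q : Prop := SlopeSol {
  slope_derive : forall x, is_derive x 1 U (q x);
  slope_continuous : continuous q;
  slope_degenerate : forall x, a x = 0 -> H x (q x) = lam;
  slope_ode : forall x, 0 < a x -> is_derive x 1 q ((lam - H x (q x)) / a x) }.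

Lemma slope_sol_visc a H (lam : R) U q : (forall x, 0 <= a x) ->
  slope_sol a H lam U q -> visc_sol a H lam U.
Proof.
move=> a0 [h1 h2 h3 h4].
have E x : 0 < a x -> a x * ((lam - H x (q x)) / a x) = lam - H x (q x).
  by move=> ax; rewrite mulrC divfK // gt_eqF.
split.
  apply: (classical_super a0 h1) => [x /h3 ->//|x ax].
  by exists ((lam - H x (q x)) / a x); [exact: h4|rewrite E // subrK].
apply/visc_subE; apply: (@classical_super a _ _ _ (fun x => - q x) a0 (fun x => is_derive_opp (h1 x))).
- by move=> x /h3; rewrite opprK => ->.
- move=> x ax; exists (- ((lam - H x (q x)) / a x)); first by apply: is_derive_opp; exact: h4.
  by rewrite mulrN E // opprK -opprD subrK.
Qed.

Lemma slope_sol_regular a H phat (lam : R) U q : continuous a -> hamiltonian H phat ->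
  slope_sol a H lam U q -> regular_classical a H lam U.
Proof.
move=> ca hH [h1 h2 h3 h4]; rewrite /regular_classical (derive1_fun h1).
split; [by move=> x; case: (h1 x)|exact: h2| |exact: h3|].
- move=> x ax; split; first by case: (h4 x ax).
  pose f z := (lam - H z (q z)) / a z.
  have cf : {for x, continuous f}.
    apply: cvgM; first by apply: cvgB; [exact: cvg_cst|exact: ham_comp_continuous hH (h2 x)].
    by apply: cvgV; [rewrite gt_eqF|exact: ca].
  have /continuous_forP/(_ _ ax)[d d0 hd] := ca x.
  have fE z : `|z - x| < d -> derive1 q z = f z.
    move=> /hd; rewrite ltr_norml => zd; apply: is_derive_derive1; apply: h4; lra.
  apply/continuous_forP => e e0; have /continuous_forP/(_ e e0)[r r0 hr] := cf.
  exists (Num.min d r); first by rewrite lt_min d0.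
  move=> z; rewrite lt_min => /andP[zd /hr]; rewrite !fE //.
  by rewrite subrr normr0.
- by move=> x ax; rewrite (is_derive_derive1 (h4 x ax)) mulrC divfK ?gt_eqF // subrK.
Qed.

Lemma slope_sol_reflect a H (lam : R) U q :
  slope_sol (fun x => a (- x)) (fun x p => H (- x) (- p)) lam U q ->
  slope_sol a H lam (fun x => U (- x)) (fun x => - q (- x)).
Proof.
move=> [h1 h2 h3 h4]; split.
- by move=> x; apply: is_derive_reflect; exact: h1.
- move=> x; apply: cvgN; apply: (@continuous_comp _ _ _ (fun x => - x) q).
    exact: oppr_continuous.
  exact: h2.
- by move=> x ax; have := h3 (- x); rewrite opprK => /(_ ax).
- move=> x ax; have := h4 (- x); rewrite !opprK => /(_ ax) h.
  by rewrite -[_ / _]opprK; apply: is_derive_opp; apply: is_derive_reflect.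
Qed.

(** Uniqueness is stated against any supersolution [u1] at level [lam0] instead of [u0]; this is the
    independence of the choice of u_{lam0}. *)
Lemma upper_solution (k : R) a H phat (lam0 lam : R) u0 :
  diffusion k a -> hamiltonian H phat -> lam0 < lam -> is_lipschitz u0 -> visc_sol a H lam0 u0 ->
  exists U q, [/\ slope_sol a H lam U q, U 0 = 0, forall x, a x = 0 -> pplus H phat lam x (q x),
    forall x, 0 < a x -> derive1 u0 x < q x &
    forall u1 v, visc_super a H lam0 u1 -> visc_sol a H lam v ->
      (forall x y, x <= y -> v x - u1 x <= v y - u1 y) -> v 0 = 0 -> forall x, v x = U x].
Proof.
move=> ha hH ll [L hL] hu0; have ca := diff_cont ha.
have [B B0 hB] := ham_coercive hH lam.
(* [P >= B] puts all slopes of size at least [P] above level [lam]; [P >= L] bounds the slope of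
   [u0]. *)
pose P := Num.max B L.
have PB : B <= P by rewrite le_max lexx.
have PL : L <= P by rewrite le_max lexx orbT.
have hmin x : a x = 0 -> H x (phat x) <= lam0 by exact: super_min_le ha hH hu0.1.
have [||||U [q [U0 dU cq hq0 hqp]]] := @upper_solution_exists R k a H phat lam0 lam P (derive1 u0) ha hH ll.
- by move=> x ax; exact: (visc_sol_C2 ca hH hu0 ax).2.
- move=> x ax; have [h1 _] := visc_sol_C2 ca hH hu0 ax.
  rewrite -ler_norml; apply: le_trans PL.
  apply: (@subgradient_lipschitz R u0 x _ L 1) => //.
  by exists u0; split => //; exists 1.
- by move=> x p /(le_trans PB); exact: hB.
- exact: hmin.
have hs : slope_sol a H lam U q.
  by split => // [x ax|x ax]; [case: (hq0 x ax)|case: (hqp x ax)].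
exists U, q; split => //; first by move=> x ax; case: (hqp x ax).
move=> u1 v hu1 hv hmon v0 x.
have dv0 z : a z = 0 -> is_derive z 1 v (q z).
  by move=> az; exact: derive_at_degenerate ha hH ll hu1 hv hmon az (hq0 z az).
have dvp z : 0 < a z -> derive1 v z = q z.
  move=> az; apply: (@slope_unique R k a H phat lam v U (derive1 v) q q ha hH) => //.
  - by move=> y ay; exact: (visc_sol_C2 ca hH hv ay).1.
  - by move=> y ay; exact: (visc_sol_C2 ca hH hv ay).2.
  - by move=> y ay; case: (hqp y ay).
  - move=> y ay; split => //; [exact: le_lt_trans (hmin y ay) ll|exact: hq0|exact: dv0].
have dv z : is_derive z 1 (fun y => v y - U y) 0.
  have h : is_derive z 1 v (q z).
    have := diff_ge0 ha z; rewrite le_eqVlt => /predU1P[/esym az|az]; first exact: dv0.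
    by rewrite -dvp //; exact: (visc_sol_C2 ca hH hv az).1.
  by apply: is_derive_eq (is_derive_sub h (dU z)) _; rewrite subrr.
have := is_derive_0_is_cst x 0 dv; rewrite /= v0 U0 subrr => /eqP.
by rewrite subr_eq0 => /eqP.
Qed.

Lemma nonkink_derive (k : R) a H phat (lam0 : R) u0 x :
  diffusion k a -> hamiltonian H phat -> visc_sol a H lam0 u0 -> ~ kink u0 x ->
  is_derive x 1 u0 (derive1 u0 x) /\ (a x = 0 -> H x (derive1 u0 x) <= lam0).
Proof.
move=> ha hH hu nk; have := diff_ge0 ha x; rewrite le_eqVlt => /predU1P[/esym ax|ax].
  have [[p dp hp]|//] := derive_or_kink ha hH hu ax.
  by rewrite (is_derive_derive1 dp).
by split; [exact: (visc_sol_C2 (diff_cont ha) hH hu ax).1|move=> E; rewrite E ltxx in ax].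
Qed.

Lemma ae_kink (u : R -> R) (Q : R -> Prop) : (forall x, ~ kink u x -> Q x) ->
  {ae (@lebesgue_measure R), forall x, Q x}.
Proof.
move=> h; exists (kink u); split.
- exact: countable_measurable (countable_kinks u).
- exact: countable_lebesgue_measure0 (countable_kinks u).
- by move=> x /= nQ; apply: contrapT => /h.
Qed.

(** An almost everywhere sign of the derivative controls increments only thanks to local Lipschitz
    continuity, which supersolutions have by coercivity. *)
Lemma ae_deriv_gt_nondecreasing v w : locally_lipschitz v -> locally_lipschitz w ->
  ae_deriv_gt v w -> forall x y, x <= y -> v x - w x <= v y - w y.
Proof.
move=> hv hw hae x y xy.
apply: (@ae_derive_ge0_nondecreasing R (fun z => v z - w z)) => //.
- move=> z; have [L1 [d1 [d10 h1]]] := hv z; have [L2 [d2 [d20 h2]]] := hw z.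
  exists (L1 + L2), (Num.min d1 d2); split; first by rewrite lt_min d10.
  move=> s t; rewrite !lt_min => /andP[s1 s2] /andP[t1 t2].
  have -> : v s - w s - (v t - w t) = (v s - v t) - (w s - w t) by ring.
  rewrite mulrDl; apply: le_trans (ler_normB _ _) _; apply: lerD; [exact: h1|exact: h2].
- case: hae => N [mN muN hN]; exists N; split => //; apply: subset_trans hN => z /= nz [dv [dw lt]].
  apply: nz; exists (derive1 v z - derive1 w z); last by rewrite subr_ge0 ltW.
  exact: is_derive_sub (derivable_is_derive dv) (derivable_is_derive dw).
Qed.

Lemma diffusion_ok_diffusion (kappa : R) a : diffusion_ok kappa a -> diffusion (kappa ^+ 2) a.
Proof.
move=> [a01 lip _ comp].
have a0 x : 0 <= a x by case/andP: (a01 x).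
have ca : continuous a.
  have cs : continuous (fun x => Num.sqrt (a x)).
    apply: continuous_pointwise => x; apply/continuous_forP => e e0.
    exists (e / (`|kappa| + 1)); first by rewrite divr_gt0 // ltr_wpDl.
    move=> y; rewrite ltr_pdivlMr ?ltr_wpDl // => yx; apply: le_lt_trans (lip y x) _.
    apply: le_lt_trans yx; rewrite mulrC ler_wpM2l //.
    by apply: le_trans (ler_norm _) _; rewrite lerDl.
  have -> : a = fun x => Num.sqrt (a x) * Num.sqrt (a x).
    by apply/funext => x; rewrite -expr2 sqr_sqrtr.
  by move=> x; apply: cvgM; exact: cs.
have left_zero (b : R -> R) x : continuous b -> (forall z, 0 <= b z) -> 0 < b x ->
    (exists2 z, z <= x & b z = 0) -> exists l, [/\ l < x, b l = 0 & forall z, l < z <= x -> 0 < b z].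
  move=> cb b0 bx [z zx bz].
  have [|||l [/andP[_ lx] bl hl]] := @last_nonneg R (fun y => - b y) z x zx.
  - by move=> y _; apply: cvgN; exact: cb.
  - by rewrite bz oppr0.
  - by rewrite oppr_lt0.
  exists l; split => //; first by apply/eqP; rewrite -oppr_eq0 bl.
  by move=> y /hl; rewrite oppr_lt0.
have zero_in s t x (M : R) : s <= x <= t -> 0 < a x ->
    (forall y, @connected_component R [set z | 0 < a z] x y -> `|y| <= M) ->
    (M < `|s|) || (M < `|t|) -> exists2 z, s <= z <= t & a z = 0.
  move=> xst ax hM hst; apply: contrapT => hn.
  have pos z : s <= z <= t -> 0 < a z.
    move=> zst; rewrite lt_neqAle a0 andbT; apply/eqP => E; apply: hn; by exists z.
  have cc y : s <= y <= t -> @connected_component R [set z | 0 < a z] x y.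
    move=> yst; exists [set` `[s, t]]; last by rewrite /= in_itv.
    split; [by rewrite /= in_itv| |].
      by move=> z /=; rewrite in_itv /=; exact: pos.
    by apply/connected_intervalP; exact: interval_is_interval.
  case/andP: xst => sx xt; have st := le_trans sx xt.
  case/orP: hst => h.
    by have := hM s (cc s (ltac:(rewrite lexx//))); rewrite leNgt h.
  by have := hM t (cc t (ltac:(rewrite lexx st//))); rewrite leNgt h.
split => //; first exact: sqr_ge0.
- move=> x y ay; have := lip x y; rewrite ay sqrtr0 subr0 ger0_norm ?sqrtr_ge0 // => h.
  rewrite -[a x]sqr_sqrtr // -[(x - y) ^+ 2]real_normK ?num_real // -exprMn.
  by rewrite lerXn2r ?nnegrE ?sqrtr_ge0 // (le_trans _ h) ?sqrtr_ge0.
- move=> x ax; have [M hM] := comp x ax.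
  (* Larger than [M] and than |x|: were [a] positive all the way from x to N or to -N, that point
     would lie in the component of x, beyond its bound. *)
  pose N := `|M| + `|x| + 1.
  have N0 : M < N by have := ler_norm M; have := normr_ge0 x; rewrite /N; lra.
  have Nx : - N < x < N.
    by have := ler_norm x; have := ler_norm (- x); have := normr_ge0 M; rewrite normrN /N; lra.
  have Npos : 0 <= N by rewrite /N !addr_ge0.
  have [||z1 z1s az1] := @zero_in (- N) x x M _ ax hM.
  - by rewrite lexx andbT; lra.
  - by rewrite normrN ger0_norm ?N0.
  have [||z2 z2s az2] := @zero_in x N x M _ ax hM.
  - by rewrite lexx /=; lra.
  - by rewrite (ger0_norm Npos) N0 orbT.
  have [l [lx al hl]] : exists l, [/\ l < x, a l = 0 & forall z, l < z <= x -> 0 < a z].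
    by apply: left_zero => //; exists z1 => //; case/andP: z1s.
  have [r [rx ar hr]] : exists l, [/\ l < - x, a (- l) = 0 & forall z, l < z <= - x -> 0 < a (- z)].
    apply: (left_zero (fun z => a (- z))) => //; last first.
    - by exists (- z2); rewrite ?opprK // lerN2; case/andP: z2s.
    - by rewrite opprK.
    - by move=> z; apply: (@continuous_comp _ _ _ (fun x => - x) a); [exact: oppr_continuous|exact: ca].
  exists l, (- r); split => //; first by lra.
  move=> z /andP[lz zr]; have [zx|xz] := leP z x; first by apply: hl; rewrite lz.
  by have := hr (- z); rewrite opprK; apply; lra.
Qed.

Lemma H_sqc_hamiltonian (al0 al1 gam eta : R) H : 0 < al0 -> 0 < al1 -> 2 < gam -> 0 < eta ->
  H_sqc al0 al1 gam eta H -> exists phat, hamiltonian H phat.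
Proof.
move=> al00 al10 gam2 eta0 [h1 h2 h3 _ [phat hp]]; exists phat; split.
- move=> B; pose K1 := al1 * (2 * `|B| + 1) `^ (gam - 1); pose K2 := al1 * (`|B| `^ gam + 1).
  have K10 : 0 <= K1 by rewrite mulr_ge0 ?powR_ge0 // ltW.
  have K20 : 0 < K2 by rewrite mulr_gt0 // ltr_wpDl // powR_ge0.
  exists (K1 + K2); first by lra.
  move=> x y p q pB qB; have BB := ler_norm B.
  have np := normr_ge0 p; have nq := normr_ge0 q; have nB := normr_ge0 B.
  have -> : H x p - H y q = (H x p - H x q) + (H x q - H y q) by ring.
  apply: le_trans (ler_normD _ _) _.
  have k1 : `|H x p - H x q| <= K1 * `|p - q|.
    apply: le_trans (h2 x p q) _; rewrite ler_wpM2r // ler_pM2l //.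
    by apply: ge0_ler_powR; rewrite ?nnegrE; lra.
  have k2 : `|H x q - H y q| <= K2 * `|x - y|.
    apply: le_trans (h3 x y q) _; rewrite ler_wpM2r // ler_pM2l // lerD2r.
    by apply: ge0_ler_powR; rewrite ?nnegrE; lra.
  have := mulr_ge0 K10 (normr_ge0 (x - y)); have := mulr_ge0 (ltW K20) (normr_ge0 (p - q)); lra.
(* For |p| >= 1 the power |p|^gam dominates |p|, so a linear bound fixes the threshold. *)
- move=> M; pose B := Num.max 1 ((`|M| + al0^-1 + 1) / al0).
  have B1 : 1 <= B by rewrite le_max lexx.
  have B2 : (`|M| + al0^-1 + 1) / al0 <= B by rewrite le_max lexx orbT.
  exists B; first by lra.
  move=> x p pB; have [h _] := h1 x p; apply: lt_le_trans h.
  have p1 : `|p| <= `|p| `^ gam.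
    rewrite -{1}[`|p|]powRr1 //; apply: ler_powR; first by apply: le_trans pB.
    by lra.
  have : `|M| + al0^-1 + 1 <= al0 * `|p| `^ gam.
    rewrite mulrC -ler_pdivrMr //; apply: le_trans B2 _; exact: le_trans pB p1.
  by have := ler_norm M; lra.
- move=> x p q pq qx; have [_ hd _] := hp x; rewrite -subr_gt0; apply: lt_le_trans (hd p q pq qx).
  by rewrite mulr_gt0 // normr_gt0 subr_eq0 lt_eqF.
- move=> x p q xp pq; have [_ _ hi] := hp x; rewrite -subr_gt0; apply: lt_le_trans (hi p q pq xp).
  by rewrite mulr_gt0 // normr_gt0 subr_eq0 lt_eqF.
Qed.

Lemma pplus_is_pplus H phat (lam : R) x p : hamiltonian H phat -> pplus H phat lam x p ->
  is_pplus H lam x p.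
Proof.
by move=> hH hp; split; [case: hp => _ ->|move=> r; exact: pplus_ge hH hp].
Qed.

End Main.

Theorem mainTheorem13 (R : realType) (kappa : R) (a : R -> R)
    (alpha0 alpha1 gamma eta : R) (H : R -> R -> R) (lam0 lam : R) (u0 : R -> R) :
  0 < alpha0 -> 0 < alpha1 -> 2 < gamma -> 0 < eta ->
  diffusion_ok kappa a ->
  H_sqc alpha0 alpha1 gamma eta H ->
  is_lambda0 a H lam0 ->
  lam0 < lam ->
  is_lipschitz u0 -> visc_sol a H lam0 u0 ->
  (* (a) *)
  (exists up : R -> R,
     [/\ visc_sol a H lam up, ae_deriv_gt up u0, up 0 = 0,
         regular_classical a H lam up &
         (forall x, a x = 0 -> is_pplus H lam x ((derive1 up) x))] /\
     (* uniqueness, and independence of the choice of u_{lambda0} *)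
     (forall u1 : R -> R, is_lipschitz u1 -> visc_sol a H lam0 u1 ->
           forall v : R -> R, visc_sol a H lam v -> ae_deriv_gt v u1 -> v 0 = 0 ->
             forall x, v x = up x))
  /\
  (* (b) *)
  (exists um : R -> R,
     [/\ visc_sol a H lam um, ae_deriv_gt u0 um, um 0 = 0,
         regular_classical a H lam um &
         (forall x, a x = 0 -> is_pminus H lam x ((derive1 um) x))] /\
     (forall u1 : R -> R, is_lipschitz u1 -> visc_sol a H lam0 u1 ->
           forall v : R -> R, visc_sol a H lam v -> ae_deriv_gt u1 v -> v 0 = 0 ->
             forall x, v x = um x)).
Proof.
move=> al00 al10 gam2 eta0 aok Hok _ ll ulip hu0.
have ha := diffusion_ok_diffusion aok; have ca := diff_cont ha; have a0 := diff_ge0 ha.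
have [phat hH] := H_sqc_hamiltonian al00 al10 gam2 eta0 Hok.
split.
  have [U [q [hs U0 hpp hlt huniq]]] := upper_solution ha hH ll ulip hu0.
  exists U; split; last first.
    move=> u1 _ hu1 v hv hae v0; apply: (huniq u1 v hu1.1 hv _ v0).
    exact: ae_deriv_gt_nondecreasing (super_locally_lipschitz hH hv.1) (super_locally_lipschitz hH hu1.1) hae.
  have dU := slope_derive hs; have EU := derive1_fun dU.
  split; [exact: slope_sol_visc hs| |exact: U0|exact: slope_sol_regular ca hH hs|]; last first.
    by move=> x ax; rewrite EU; exact: pplus_is_pplus hH (hpp x ax).
  (* Where a x = 0 and [u0] is differentiable, H at its derivative is at most lam0 < lam, which
     forces strict inequality with p^+; where a x > 0 it comes with the construction of [q]. *)
  apply: (@ae_kink R u0) => x nk; have [d1 d2] := nonkink_derive ha hH hu0 nk.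
  split; first by case: (dU x).
  split; first by case: d1.
  rewrite EU; have := a0 x; rewrite le_eqVlt => /predU1P[/esym ax|]; last exact: hlt.
  have h := d2 ax; have [hq1 hq2] := hpp x ax.
  rewrite lt_neqAle (pplus_ge hH (hpp x ax)) ?andbT; last exact: le_trans h (ltW ll).
  by apply/eqP => E; move: h; rewrite E hq2 leNgt ll.
have haR := diffusion_reflect ha; have hHR := hamiltonian_reflect hH.
have hu0R : visc_sol (fun x => a (- x)) (fun x p => H (- x) (- p)) lam0 (fun x => u0 (- x)).
  by split; [exact: visc_super_reflect hu0.1|exact: visc_sub_reflect hu0.2].
have ulipR : is_lipschitz (fun x => u0 (- x)).
  by case: ulip => L hL; exists L => x y; have := hL (- x) (- y); rewrite -opprD normrN.
have [U [q [hs U0 hpp hlt huniq]]] := upper_solution haR hHR ll ulipR hu0R.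
have hsR := slope_sol_reflect hs.
have dU := slope_derive hsR; have EU := derive1_fun dU.
have hpm x : a x = 0 -> is_pminus H lam x (- q (- x)).
  move=> ax; have axR : a (- - x) = 0 by rewrite opprK.
  have [h1 h2] := pplus_is_pplus hHR (hpp (- x) axR).
  split=> [|r hr]; first by rewrite opprK in h1.
  by have := h2 (- r); rewrite !opprK => /(_ hr); rewrite lerNl.
exists (fun x => U (- x)); split; last first.
  move=> u1 _ hu1 v hv hae v0 x.
  have hvR : visc_sol (fun x => a (- x)) (fun x p => H (- x) (- p)) lam (fun x => v (- x)).
    by split; [exact: visc_super_reflect hv.1|exact: visc_sub_reflect hv.2].
  have hmon := ae_deriv_gt_nondecreasing (super_locally_lipschitz hH hu1.1) (super_locally_lipschitz hH hv.1) hae.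
  have := huniq (fun x => u1 (- x)) (fun x => v (- x)) (visc_super_reflect hu1.1) hvR.
  rewrite oppr0 => h; have := h _ v0 (- x); rewrite opprK; apply => s t st.
  have : - t <= - s by rewrite lerN2.
  by move=> /hmon; lra.
split; [exact: slope_sol_visc hsR| |by rewrite oppr0|exact: slope_sol_regular ca hH hsR|]; last first.
  by move=> x ax; rewrite EU; exact: hpm.
apply: (@ae_kink R u0) => x nk; have [d1 d2] := nonkink_derive ha hH hu0 nk.
split; first by case: d1.
split; first by case: (dU x).
rewrite EU; have := a0 x; rewrite le_eqVlt => /predU1P[/esym ax|ax].
  have h := d2 ax; have [hq1 hq2] := hpm x ax.
  rewrite lt_neqAle hq2 ?andbT; last exact: le_trans h (ltW ll).
  have axR : a (- - x) = 0 by rewrite opprK.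
  have [_] := hpp (- x) axR; rewrite opprK => Hq.
  by apply/eqP => E; move: h; rewrite -E Hq leNgt ll.
have := hlt (- x); rewrite opprK => /(_ ax).
have d1R : is_derive (- x) 1 (fun y => u0 (- y)) (- derive1 u0 x).
  by apply: is_derive_reflect; rewrite opprK.
by rewrite (is_derive_derive1 d1R) ltrNl.
Qed.
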